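(* Let $B$ be a standard Brownian motion in one dimension and let $\theta=\log 2/\log 6$. Let $K\subseteq[0,1]^2$ be the self-affine set constructed from the patterns $A$ and $B$ as described in the context. Then there exists a function $f:[0,1]\to[0,1]$ whose graph is $K$, which is Hölder continuous of parameter $\theta$, which satisfies $\dim_{\mathcal M}(\mathrm{Gr}(f))=1+\log 3/\log 6$, and such that almost surely \[ \dim(\mathrm{Gr}(B+f))=\frac{1+\log_2(5^{2\theta}+1)}{2}>\max\Big\{\dim(\mathrm{Gr}(f)),\frac32\Big\}=\log_2(5^\theta+1). \]
   Context: $\dim$ denotes Hausdorff dimension, $\dim_{\mathcal M}$ denotes Minkowski (box) dimension, and $\mathrm{Gr}(h)=\{(t,h(t)):t\in[0,1]\}$. Construction of $K$. Patterns (in the matrices, the lower row corresponds to the lower half of a rectangle and columns go from left to right; a $1$ means the subrectangle is kept): \[ A=\begin{pmatrix}0&0&0&0&0&1\\1&1&1&1&1&0\end{pmatrix},\qquad B=\begin{pmatrix}1&0&0&0&0&0\\0&1&1&1&1&1\end{pmatrix} \] (the pattern $B$ is not to be confused with the Brownian motion $B$). Let $\mathcal{Q}_0=\{[0,1]^2\}$, with label $A$ assigned to its rectangle. Given the collection $\mathcal{Q}_j$ of labelled rectangles, subdivide each rectangle of $\mathcal{Q}_j$ into $12$ equal closed rectangles of width $6^{-(j+1)}$ and height $2^{-(j+1)}$ (6 columns, 2 rows). If its label is $A$ (resp. $B$), keep only the subrectangles corresponding to the pattern $A$ (resp. $B$). If its label is $A$, the six kept rectangles receive, from left to right, the labels $A,B,A,B,A,A$;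 if its label is $B$, they receive, from left to right, the labels $B,B,A,B,A,B$. $\mathcal{Q}_{j+1}$ is the collection of all kept rectangles with these labels. Then $K=\bigcap_{j\ge0}\bigcup_{R\in\mathcal{Q}_j}R$. *)

(* Defs.v *)
From HB Require Import structures.
From mathcomp Require Import all_boot all_order all_algebra.
From mathcomp Require Import all_classical all_reals all_analysis.

Set Implicit Arguments.
Unset Strict Implicit.
Unset Printing Implicit Defensive.

Import Order.TTheory GRing.Theory Num.Theory.
Import numFieldNormedType.Exports.

Local Open Scope classical_set_scope.
Local Open Scope ring_scope.

Definition log_base {R : realType} (b x : R) : R := ln x / ln b.

Definition theta (R : realType) : R := ln 2 / ln 6.

Definition graph {R : realType} (h : R -> R) : set (R * R) :=
  [set (t, h t) | t in `[0, 1]].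

Definition holder {R : realType} (a : R) (h : R -> R) : Prop :=
  exists C : R, forall s t : R, s \in `[0, 1] -> t \in `[0, 1] ->
    `|h s - h t| <= C * `|s - t| `^ a.

(* The norm that the library puts on R * R is the sup norm, so the Euclidean
   distance is written out. *)
Definition edist {R : realType} (p q : R * R) : R :=
  Num.sqrt ((p.1 - q.1) ^+ 2 + (p.2 - q.2) ^+ 2).

(* The union with [set 0] makes the diameter of the empty set 0, not -oo. *)
Definition diam {R : realType} (E : set (R * R)) : \bar R :=
  ereal_sup ([set 0%E] `|` [set (edist p q)%:E | p in E & q in E]).

Section HausdorffDimension.
Local Open Scope ereal_scope.

Definition hausdorff_premeasure {R : realType} (s delta : R)
    (A : set (R * R)) : \bar R :=
  ereal_inf [set \sum_(0 <= k <oo) diam (E k) `^ s | E in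
    [set E : (set (R * R))^nat | A `<=` \bigcup_k E k /\
                                 forall k, diam (E k) <= delta%:E]].

(* The supremum is the limit as delta tends to 0. *)
Definition hausdorff_measure {R : realType} (s : R)
    (A : set (R * R)) : \bar R :=
  ereal_sup [set hausdorff_premeasure s delta A |
              delta in [set delta | (0 < delta)%R]].

(* Taking s > 0 avoids the convention for 0 `^ 0 and does not change the
   infimum. *)
Definition hausdorff_dim {R : realType} (A : set (R * R)) : \bar R :=
  ereal_inf [set s%:E | s in
    [set s | (0 < s)%R /\ hausdorff_measure s A = 0]].

(* The least number of sets of diameter at most delta needed to cover A; +oo
   when there is no finite cover. *)
Definition covering_number {R : realType} (A : set (R * R)) (delta : R) :
    \bar R :=
  ereal_inf [set n%:R%:E | n in
    [set n : nat | exists E : 'I_n -> set (R * R),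
      A `<=` \bigcup_i E i /\ forall i, diam (E i) <= delta%:E]].

Definition has_minkowski_dim {R : realType} (A : set (R * R)) (d : R) : Prop :=
  (fun delta : R => lne (covering_number A delta) * ((ln delta^-1)^-1)%:E)
    @ 0^'+ --> d%:E.

End HausdorffDimension.

Definition gaussian_increments {d} {T : measurableType d} {R : realType}
    (P : probability T R) (B : R -> {RV P >-> R}) : Prop :=
  forall s t : R, 0 <= s -> s < t -> forall U : set R, measurable U ->
    P [set w | U (B t w - B s w)] = normal_prob 0 (Num.sqrt (t - s)) U.

(* As some of the U i may be setT, the product rule for the whole family of
   increments includes the product rule for its subfamilies. *)
Definition independent_increments {d} {T : measurableType d} {R : realType}
    (P : probability T R) (B : R -> {RV P >-> R}) : Prop :=
  forall (n : nat) (t : nat -> R), 0 <= t 0%N ->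
    (forall i, (i < n)%N -> t i <= t i.+1) ->
  forall U : 'I_n -> set R, (forall i, measurable (U i)) ->
    P (\bigcap_(i : 'I_n) [set w | U i (B (t i.+1) w - B (t i) w)]) =
    (\prod_(i < n) P [set w | U i (B (t i.+1) w - B (t i) w)%R])%E.

(* A Brownian motion indexed by [0, +oo[; the values of B at negative times
   play no role. *)
Record standard_brownian_motion {d} {T : measurableType d} {R : realType}
    (P : probability T R) (B : R -> {RV P >-> R}) : Prop := {
  bm_start : {ae P, forall w, B 0 w = 0};
  bm_gaussian : gaussian_increments B;
  bm_independent : independent_increments B;
  bm_continuous :
    {ae P, forall w, {within `[0, +oo[, continuous (fun t : R => B t w)}}
}.

Inductive label := LA | LB.

Definition pattern (l : label) : seq (seq nat) :=
  match l with
  | LA => [:: [:: 0; 0; 0; 0; 0; 1];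
              [:: 1; 1; 1; 1; 1; 0]]
  | LB => [:: [:: 1; 0; 0; 0; 0; 0];
              [:: 0; 1; 1; 1; 1; 1]]
  end%N.

(* The row r = 0 is the lower half of a rectangle and is listed last in the
   pattern. *)
Definition kept (l : label) (c : 'I_6) (r : 'I_2) : bool :=
  nth 0%N (nth [::] (pattern l) (1 - r)) c == 1%N.

(* Each column of a pattern has exactly one kept cell, so numbering the kept
   rectangles from left to right is numbering them by column. *)
Definition child_label (l : label) (c : 'I_6) : label :=
  match l with
  | LA => nth LA [:: LA; LB; LA; LB; LA; LA] c
  | LB => nth LA [:: LB; LB; LA; LB; LA; LB] c
  end.

(* (l, i, k) in labelled_rects j stands for the rectangle rect j i k below, in
   column i and row k of the grid of mesh 6^-j by 2^-j, with label l. *)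
Fixpoint labelled_rects (j : nat) : set (label * nat * nat) :=
  if j is j'.+1 then
    [set q | exists l i k (c : 'I_6) (r : 'I_2),
      [/\ labelled_rects j' (l, i, k), kept l c r &
          q = (child_label l c, 6 * i + c, 2 * k + r)%N]]
  else [set (LA, 0%N, 0%N)].

Definition rect {R : realType} (j i k : nat) : set (R * R) :=
  [set p | i%:R / 6 ^+ j <= p.1 <= i.+1%:R / 6 ^+ j /\
           k%:R / 2 ^+ j <= p.2 <= k.+1%:R / 2 ^+ j].

Definition K {R : realType} : set (R * R) :=
  \bigcap_(j : nat) \bigcup_(q in labelled_rects j) rect j q.1.2 q.2.

(* Main.v *)
(* Every column of either pattern has one kept cell, and adjacent strips meet at
   a common corner, so K is the graph of a continuous function f. Put
   tau = theta for f and tau = 2 theta for B + f, and Z = 5 ^ tau + 1: an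
   approximate square whose height has m row digits fixes only about tau m
   column digits.

   Upper bounds. A row with z zero digits among n contains 5 ^ z columns. For
   infinitely many m the proportion of zeros in the first tau m row digits of a
   point does not exceed by more than eps that in the first m; the approximate
   squares with this property number at most (5 ^ eps Z) ^ m. For B + f, each
   is covered by squares of side 6 ^ (- tau m) with the help of a Hoelder
   modulus of B of order almost 1/2.

   Lower bounds. A measure uniform on the columns whose row digits have, in each
   block of L digits, exactly b zeros satisfies a Frostman condition; for the
   best b its exponent tends to that of Z as L grows. The energy of its image on
   the graph of f is bounded, and so is the expected energy of its image on the
   graph of B + f, by the explicit Gaussian density of a single increment;
   Fatou's lemma then gives an almost sure bound along a subsequence.

   Minkowski dimension. Each column of width 6 ^ (-n) contains a full strip of
   height 2 ^ (-n), hence about 6 ^ n 2 ^ (m - n) squares of side 2 ^ (-m) are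
   needed, for 2 ^ m comparable with 6 ^ n. *)

Require Import Defs.
From mathcomp Require Import all_boot all_order all_algebra.
From mathcomp Require Import all_classical all_reals all_analysis.
From mathcomp Require Import measurable_realfun.
From mathcomp Require Import zify ring lra.

Set Implicit Arguments.
Unset Strict Implicit.
Unset Printing Implicit Defensive.

Import Order.TTheory GRing.Theory Num.Theory.
Import numFieldNormedType.Exports.

Local Open Scope classical_set_scope.
Local Open Scope ring_scope.

(** * The construction in coordinates *)

Section Combinatorics.
Local Open Scope nat_scope.

(** Five of the six kept cells of either pattern lie in the lower row, so the number of columns in a
    row depends only on its zero digits; the labels serve the continuity of f alone. Over a time 4 ^
    (- m) = 6 ^ (- 2 theta m) the motion B varies by about 2 ^ (- m), the height of a row; hence tau
    = 2 theta. There are in effect Z ^ m such parabolic boxes, each made of 2 ^ m squares of side 4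
    ^ (- m), and (2 Z) ^ m = 4 ^ (m D) gives D = (1 + log_2 Z) / 2. The obstacle above is that
    counting all approximate squares of one scale yields the larger Minkowski dimension: too many
    columns belong to rows whose zeros crowd into the first tau m digits. The scale is therefore
    chosen for each point separately. Below, no limit measure is built. The graphs are compact,
    finite covers involve finitely many scales, and discrete measures on the left ends of columns
    suffice, with an energy bounded along a sequence of levels. The comparison of dimensions rests
    on sqrt 8 < 5 ^ theta + 1 and on strict convexity of the square. *)

Definition cell_row (l : label) (c : nat) : nat :=
  match l with LA => c == 5 | LB => c == 0 end.

Definition cell_label (l : label) (c : nat) : label :=
  match l with
  | LA => nth LA [:: LA; LB; LA; LB; LA; LA] c
  | LB => nth LA [:: LB; LB; LA; LB; LA; LB] c
  end.

(* The kept rectangle in column [i] of level [j] is unique; [lab] is its label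
   and [rowof] its row, when the initial square is labelled [l]. *)
Fixpoint lab (l : label) (j i : nat) : label :=
  if j is j'.+1 then cell_label (lab l j' (i %/ 6)) (i %% 6) else l.

Fixpoint rowof (l : label) (j i : nat) : nat :=
  if j is j'.+1
  then 2 * rowof l j' (i %/ 6) + cell_row (lab l j' (i %/ 6)) (i %% 6) else 0.

(** [k] is read with exactly [j] binary digits, so leading zeros count. *)
Fixpoint zeros (j k : nat) : nat :=
  if j is j'.+1 then zeros j' (k %/ 2) + (k %% 2 == 0) else 0.

Lemma cell_row_lt l c : cell_row l c < 2.
Proof. by case: l => /=; case: eqP. Qed.

Lemma row_lt l j i : rowof l j i < 2 ^ j.
Proof.
elim: j i => [|j IH] i //=; rewrite expnS.
by have := IH (i %/ 6); have := cell_row_lt (lab l j (i %/ 6)) (i %% 6); lia.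
Qed.

Lemma divn_modn_mul d m i : (i %% (d * m)) %/ d = (i %/ d) %% m.
Proof. by rewrite modn_divl mulnC. Qed.

Lemma modn_mul_modn d m i : (i %% (d * m)) %% d = i %% d.
Proof. by rewrite modn_dvdm// dvdn_mulr. Qed.

Lemma lab_cat l n j i :
  lab l (n + j) i = lab (lab l n (i %/ 6 ^ j)) j (i %% 6 ^ j).
Proof.
elim: j i => [|j IH] i; first by rewrite addn0 expn0 divn1.
by rewrite addnS /= IH expnS divnMA modn_mul_modn divn_modn_mul.
Qed.

(** Self-similarity: below a column of level [n] the construction starts afresh from the label of
    that column, which is why [lab] and [rowof] carry an initial label. *)
Lemma row_cat l n j i : rowof l (n + j) i =
  rowof l n (i %/ 6 ^ j) * 2 ^ j + rowof (lab l n (i %/ 6 ^ j)) j (i %% 6 ^ j).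
Proof.
elim: j i => [|j IH] i; first by rewrite addn0 expn0 divn1 muln1 addn0.
rewrite addnS /= IH lab_cat !expnS divnMA modn_mul_modn divn_modn_mul.
by rewrite mulnDr mulnCA addnA.
Qed.

Lemma row_div l n j i : rowof l (n + j) i %/ 2 ^ j = rowof l n (i %/ 6 ^ j).
Proof.
by rewrite row_cat divnMDl ?expn_gt0// (divn_small (row_lt _ _ _)) addn0.
Qed.

Lemma row_mod l n j i :
  rowof l (n + j) i %% 2 ^ j = rowof (lab l n (i %/ 6 ^ j)) j (i %% 6 ^ j).
Proof. by rewrite row_cat modnMDl (modn_small (row_lt _ _ _)). Qed.

Lemma zeros_le j k : zeros j k <= j.
Proof. by elim: j k => [|j IH] k //=; have := IH (k %/ 2); case: eqP; lia. Qed.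

Definition up (l : label) : nat := if l is LA then 1 else 0.

(* The strip of a column labelled A is crossed upwards, one labelled B
   downwards, and consecutive columns meet at the same corner. *)
Lemma row_adjacent l j i : i.+1 < 6 ^ j ->
  rowof l j i + up (lab l j i) = rowof l j i.+1 + (1 - up (lab l j i.+1)).
Proof.
elim: j i => [|j IH] i; first by rewrite expn0 ltnS ltn0.
rewrite expnS => ij /=.
have i6 : i %% 6 < 6 by rewrite ltn_mod.
have [m5|m5] := eqVneq (i %% 6) 5.
  have d1 : i.+1 %/ 6 = (i %/ 6).+1 by lia.
  have d2 : i.+1 %% 6 = 0 by lia.
  have {}IH : rowof l j (i %/ 6) + up (lab l j (i %/ 6)) =
    rowof l j (i %/ 6).+1 + (1 - up (lab l j (i %/ 6).+1)) by apply: IH; lia.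
  rewrite m5 d1 d2; move: IH.
  by case: (lab l j (i %/ 6)); case: (lab l j (i %/ 6).+1) => /=; lia.
have -> : i.+1 %/ 6 = i %/ 6 by lia.
have -> : i.+1 %% 6 = (i %% 6).+1 by lia.
move: m5 i6; move: (i %% 6) => c; clear.
by do 6?[case: c => [|c] //]; case: (lab l j _) => /=; lia.
Qed.

Lemma row_adjacentP l j i : i.+1 < 6 ^ j ->
  rowof l j i <= (rowof l j i.+1).+1 /\ rowof l j i.+1 <= (rowof l j i).+1.
Proof.
move=> /(row_adjacent l).
by case: (lab l j i); case: (lab l j i.+1) => /=; lia.
Qed.

Lemma kept_cell_row l (c : 'I_6) (r : 'I_2) :
  kept l c r = (r == cell_row l c :> nat).
Proof.
case: l; case: c => c cP; case: r => r rP; rewrite /kept /=;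
by do 6?[case: c cP => [|c] cP //=]; do 2?[case: r rP => [|r] rP //=].
Qed.

Lemma child_labelE l (c : 'I_6) : child_label l c = cell_label l c.
Proof. by case: l. Qed.

Lemma labelled_rectsP j q : labelled_rects j q <->
  exists2 i, i < 6 ^ j & q = (lab LA j i, i, rowof LA j i).
Proof.
elim: j q => [|j IH] q /=.
  split=> [->|[i]]; first by exists 0.
  by rewrite expn0 ltnS leqn0 => /eqP ->.
split=> [[l [i [k [c [r [/IH[i' i'j [-> -> ->]]]]]]]]|[i ij ->]].
  rewrite kept_cell_row => /eqP -> ->.
  have c6 := ltn_ord c; exists (6 * i' + c); first by rewrite expnS; lia.
  rewrite child_labelE.
  have -> : (6 * i' + c) %/ 6 = i' by lia.
  by have -> : (6 * i' + c) %% 6 = c by lia.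
have i6 : i %/ 6 < 6 ^ j by rewrite ltn_divLR// mulnC -expnS.
exists (lab LA j (i %/ 6)), (i %/ 6), (rowof LA j (i %/ 6)).
exists (Ordinal (ltn_pmod i (isT : 0 < 6))).
exists (Ordinal (cell_row_lt (lab LA j (i %/ 6)) (i %% 6))); split.
- by apply/IH; exists (i %/ 6).
- by rewrite kept_cell_row.
- by rewrite child_labelE /= [6 * _]mulnC -divn_eq.
Qed.

End Combinatorics.

Lemma sum_nat_mul (V : nmodType) (n k : nat) (F : nat -> V) :
  \sum_(i < n * k) F i = \sum_(i < n) \sum_(c < k) F (i * k + c)%N.
Proof.
rewrite -(big_mkord xpredT F) big_nat_mul big_mkord; apply: eq_bigr => i _.
rewrite -{1}[(i * k)%N]add0n big_addn mulSn addnK big_mkord.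
by apply: eq_bigr => c _; rewrite addnC.
Qed.

(** Under either label five kept cells have row digit 0 and one has row digit 1, so each zero digit
    of [k] multiplies the number of columns in row [k] by 5. *)
Lemma sum_row (V : nmodType) l j (g : nat -> V) :
  \sum_(c < 6 ^ j) g (rowof l j c) = \sum_(k < 2 ^ j) g k *+ 5 ^ zeros j k.
Proof.
elim: j g => [|j IH] g; first by rewrite !big_ord_recl !big_ord0.
rewrite !expnSr (sum_nat_mul _ _ (fun c => g (rowof l j.+1 c))).
transitivity (\sum_(c < 6 ^ j)
    (g (2 * rowof l j c)%N *+ 5 + g (2 * rowof l j c).+1%N)).
  apply: eq_bigr => c _; rewrite !big_ord_recr big_ord0 /= !add0r.
  have E d : (d < 6 -> (c * 6 + d) %/ 6 = c /\ (c * 6 + d) %% 6 = d)%N by lia.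
  do ![rewrite (E _ _).1// | rewrite (E _ _).2//].
  case: (lab l j c) => /=; rewrite !addn0 !addn1 !mulrS mulr0n addr0 ?addrA//.
  by rewrite -!addrA [LHS]addrC !addrA.
rewrite (IH (fun k => g (2 * k)%N *+ 5 + g (2 * k).+1%N)).
rewrite (sum_nat_mul _ _ (fun k => g k *+ 5 ^ zeros j.+1 k)).
apply: eq_bigr => k _; rewrite !big_ord_recr big_ord0 /= add0r.
have [-> ->] : ((k * 2 + 0) %/ 2 = k /\ (k * 2 + 0) %% 2 = 0)%N by lia.
have [-> ->] : ((k * 2 + 1) %/ 2 = k /\ (k * 2 + 1) %% 2 = 1)%N by lia.
by rewrite /= !addn0 !addn1 expnS [(k * 2)%N]mulnC mulrnDl -mulrnA.
Qed.

(** * The function f and its graph *)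

Section Curve.
Context {R : realType}.
Implicit Types (t s : R) (j n : nat).

(** The cap puts [t = 1] into the last column; an interior grid point belongs to the column on its
    right. *)
Definition colof j t : nat := minn (Num.truncn (t * 6 ^+ j)) (6 ^ j).-1.

Definition frow j t : nat := rowof LA j (colof j t).

Definition curve t : R :=
  sup [set (frow j t)%:R / 2 ^+ j | j in [set: nat]].

Lemma col_lt j t : (colof j t < 6 ^ j)%N.
Proof. by rewrite /colof; have := expn_gt0 6 j; lia. Qed.

Lemma col_frac n i : (i < 6 ^ n)%N -> colof n (i%:R / 6 ^+ n) = i.
Proof.
move=> ni; rewrite /colof divfK ?expf_neq0// natrK.
by apply/minn_idPl; lia.
Qed.

Lemma col_itv j t : 0 <= t <= 1 ->
  (colof j t)%:R <= t * 6 ^+ j <= (colof j t).+1%:R.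
Proof.
move=> /andP[t0 t1].
have x0 : 0 <= t * 6 ^+ j by rewrite mulr_ge0// exprn_ge0.
have x1 : t * 6 ^+ j <= (6 ^ j)%:R by rewrite natrX ler_piMl// exprn_ge0.
have /andP[lex ltx] := truncn_itv x0; apply/andP; split.
  by apply: le_trans lex; rewrite ler_nat geq_minl.
rewrite /colof; case: leqP => _; first exact: ltW.
by rewrite prednK// expn_gt0.
Qed.

Lemma truncn_mulX t n : 0 <= t ->
  (Num.truncn (t * 6 ^+ n) %/ 6 ^ n)%N = Num.truncn t.
Proof.
move=> t0; apply/esym/truncn_def.
have x0 : 0 <= t * 6 ^+ n by rewrite mulr_ge0// exprn_ge0.
have /andP[lex ltx] := truncn_itv x0.
have p : 0 < (6 : R) ^+ n by rewrite exprn_gt0.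
rewrite -(ler_pM2r p) -(ltr_pM2r p) -natrX -!natrM; apply/andP; split.
  by rewrite natrX; apply: le_trans lex; rewrite ler_nat leq_trunc_div.
rewrite natrX; apply: (lt_le_trans ltx).
by rewrite ler_nat ltn_ceil// expn_gt0.
Qed.

Lemma col_div j n t : 0 <= t -> (colof (j + n) t %/ 6 ^ n)%N = colof j t.
Proof.
move=> t0; rewrite /colof -(truncn_mulX n (_ : 0 <= t * 6 ^+ j)); last first.
  by rewrite mulr_ge0// exprn_ge0.
rewrite -mulrA -exprD; move: (Num.truncn _) => a.
have p := expn_gt0 6 n; have p' := expn_gt0 6 j.
(* The cap is compatible with dropping digits. *)
have -> : ((6 ^ j).-1 = (6 ^ (j + n)).-1 %/ 6 ^ n)%N.
  rewrite expnD; apply/eqP; rewrite eqn_leq; apply/andP; split.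
    by rewrite leq_divRL//; nia.
  by rewrite -ltnS prednK// ltn_divLR// prednK// muln_gt0 p p'.
rewrite /minn; case: ltnP => [ab|ba].
  by case: ltnP => // h; apply/eqP; rewrite eqn_leq h andbT leq_div2r// ltnW.
by case: ltnP => // h; have := leq_div2r (6 ^ n) ba; lia.
Qed.

Lemma frow_div j n t : 0 <= t -> (frow (j + n) t %/ 2 ^ n)%N = frow j t.
Proof. by move=> t0; rewrite /frow row_div col_div. Qed.

Lemma row_close l j i i' : (i < 6 ^ j -> i' < 6 ^ j -> i <= i'.+1 ->
  i' <= i.+1 -> rowof l j i <= (rowof l j i').+1)%N.
Proof.
move=> ij ij' h h'.
have [->|[e|e]] : i = i' \/ (i = i'.+1 \/ i' = i.+1) by lia.
- by [].
- by subst i; have [] := row_adjacentP l ij.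
- by subst i'; have [] := row_adjacentP l ij'.
Qed.

Lemma col_close j t s : 0 <= t <= 1 -> 0 <= s <= 1 ->
  t * 6 ^+ j <= s * 6 ^+ j + 1 -> (colof j t <= (colof j s).+1)%N.
Proof.
move=> /andP[t0 t1] /andP[s0 s1] h.
have x0 : 0 <= t * 6 ^+ j by rewrite mulr_ge0// exprn_ge0.
have y0 : 0 <= s * 6 ^+ j by rewrite mulr_ge0// exprn_ge0.
suff : (Num.truncn (t * 6 ^+ j) <= (Num.truncn (s * 6 ^+ j)).+1)%N.
  by rewrite /colof; lia.
rewrite -ltnS -(ltr_nat R).
have /andP[lex _] := truncn_itv x0; have /andP[_ ltx] := truncn_itv y0.
by apply: le_lt_trans lex _; apply: le_lt_trans h _; rewrite -[ltRHS]natr1 ltrD2r.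
Qed.

Lemma frow_le i j t : 0 <= t -> (frow i t * 2 ^ j <= (frow j t).+1 * 2 ^ i)%N.
Proof.
move=> t0; have [ij|ji] := leqP i j.
  rewrite -(subnKC ij) -(frow_div i (j - i) t0) expnD mulnCA mulnC.
  by rewrite leq_mul2r (leq_trans (leq_trunc_div _ _))// orbT.
rewrite -(subnKC (ltnW ji)) -(frow_div j (i - j) t0) expnD mulnCA.
by rewrite mulnC leq_mul2l ltnW ?orbT// ltn_ceil// expn_gt0.
Qed.

Lemma curve_itv j t : 0 <= t ->
  (frow j t)%:R <= curve t * 2 ^+ j <= (frow j t).+1%:R.
Proof.
move=> t0; have p i : 0 < (2 : R) ^+ i by rewrite exprn_gt0.
have ub i k : (frow i t)%:R / 2 ^+ i <= (frow k t).+1%:R / 2 ^+ k :> R.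
  rewrite ler_pdivrMr// mulrAC ler_pdivlMr//.
  by rewrite -!natrX -!natrM ler_nat frow_le.
have ne : [set ((frow i t)%:R / 2 ^+ i : R) | i in [set: nat]] !=set0.
  by exists ((frow 0 t)%:R / 2 ^+ 0); exists 0%N.
apply/andP; split.
  rewrite -ler_pdivrMr//; apply: ub_le_sup; last by exists j.
  by exists ((frow 0 t).+1%:R / 2 ^+ 0) => _ [i _ <-].
by rewrite -ler_pdivlMr//; apply: ge_sup => // _ [i _ <-].
Qed.

Lemma eq_of_geometric (x y C : R) :
  (forall j, `|x - y| * 2 ^+ j <= C) -> x = y.
Proof.
move=> h; apply/eqP; rewrite -subr_eq0 -normr_le0 leNgt; apply/negP => z0.
have := h (Num.truncn (C / `|x - y|)).+1.
apply/negP; rewrite -ltNge mulrC -ltr_pdivrMr//.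
apply: lt_trans (truncnS_gt _) _.
by rewrite -natrX ltr_nat ltn_expl.
Qed.

(** Columns at most one apart have rows at most one apart by [row_close], and each value lies in its
    closed row; hence the constant 2. *)
Lemma curve_close j t s : 0 <= t <= 1 -> 0 <= s <= 1 ->
  `|t - s| * 6 ^+ j <= 1 -> `|curve t - curve s| * 2 ^+ j <= 2.
Proof.
move=> ht hs; have p6 : 0 < (6 : R) ^+ j by rewrite exprn_gt0.
have p2 : 0 < (2 : R) ^+ j by rewrite exprn_gt0.
rewrite -{1}(gtr0_norm p6) -normrM ler_norml mulrBl => /andP[h1 h2].
have c1 : (colof j t <= (colof j s).+1)%N by apply: col_close => //; lra.
have c2 : (colof j s <= (colof j t).+1)%N by apply: col_close => //; lra.
have := row_close LA (col_lt j t) (col_lt j s) c1 c2.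
have := row_close LA (col_lt j s) (col_lt j t) c2 c1.
rewrite -!(ler_nat R) -!(@natr1 R (rowof _ _ _)).
have := @curve_itv j t; have := @curve_itv j s; rewrite /frow -!(@natr1 R (rowof _ _ _)).
case/andP: ht => -> _; case/andP: hs => -> _ => /(_ isT)/andP[a1 a2] /(_ isT)/andP[b1 b2] d1 d2.
rewrite -{1}(gtr0_norm p2) -normrM ler_norml mulrBl.
by apply/andP; split; lra.
Qed.

Lemma in_itv01 t : (t \in `[0, 1]) = (0 <= t <= 1).
Proof. by rewrite in_itv. Qed.

Lemma curve01 t : 0 <= t <= 1 -> 0 <= curve t <= 1.
Proof.
move=> /andP[t0 _]; have := curve_itv 0 t0; rewrite expr0 mulr1.
by rewrite /frow /=.
Qed.

Lemma graph_curve : graph curve = K :> set (R * R).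
Proof.
apply/seteqP; split=> [p [t ht <-] j _|[t y] Kty].
  move: ht; rewrite /= in_itv01 => ht; exists (lab LA j (colof j t), colof j t, frow j t).
    by apply/labelled_rectsP; exists (colof j t); first exact: col_lt.
  have /andP[t0 _] := ht.
  have p6 : 0 < (6 : R) ^+ j by rewrite exprn_gt0.
  have p2 : 0 < (2 : R) ^+ j by rewrite exprn_gt0.
  rewrite /rect /= !ler_pdivrMr// !ler_pdivlMr//.
  by rewrite col_itv// curve_itv.
have K' j : exists i, [/\ (i < 6 ^ j)%N, i%:R <= t * 6 ^+ j <= i.+1%:R &
    (rowof LA j i)%:R <= y * 2 ^+ j <= (rowof LA j i).+1%:R].
  have [q /labelled_rectsP[i ij ->]] := Kty j I.
  have p6 : 0 < (6 : R) ^+ j by rewrite exprn_gt0.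
  have p2 : 0 < (2 : R) ^+ j by rewrite exprn_gt0.
  rewrite /rect /= !ler_pdivrMr// !ler_pdivlMr// => -[h1 h2].
  by exists i.
have ht : 0 <= t <= 1.
  by have [[|i] []//] := K' 0%N; rewrite expr0 mulr1.
exists t; first by rewrite /= in_itv01.
(* At a grid point the column provided by [K] may be a neighbour of [colof j t]. Its row is still at
   most one away, so the two ordinates differ by at most two row heights at every level. *)
congr (_, _); apply: (@eq_of_geometric _ _ 2) => j.
have p2 : 0 < (2 : R) ^+ j by rewrite exprn_gt0.
have [i [ij /andP[i1 i2] /andP[y1 y2]]] := K' j.
have /andP[c1 c2] := col_itv j ht.
have n1 : (i <= (colof j t).+1)%N by rewrite -(ler_nat R); exact: le_trans c2.
have n2 : (colof j t <= i.+1)%N by rewrite -(ler_nat R); exact: le_trans i2.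
have := row_close LA ij (col_lt j t) n1 n2.
have := row_close LA (col_lt j t) ij n2 n1.
rewrite -!(ler_nat R).
have /andP[t0 _] := ht; have := curve_itv j t0; rewrite /frow.
move: y1 y2; rewrite -!(@natr1 R (rowof _ _ _)) => y1 y2 /andP[b1 b2] d1 d2.
rewrite -{1}(gtr0_norm p2) -normrM ler_norml mulrBl.
by apply/andP; split; lra.
Qed.

Lemma ln2_gt0 : 0 < ln (2 : R). Proof. by rewrite ln_gt0// ltr1n. Qed.
Lemma ln6_gt0 : 0 < ln (6 : R). Proof. by rewrite ln_gt0// ltr1n. Qed.

Lemma theta_gt0 : 0 < theta R.
Proof. by rewrite divr_gt0 ?ln2_gt0 ?ln6_gt0. Qed.

Lemma powR6_theta : 6 `^ theta R = 2.
Proof.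
rewrite /powR /theta; case: ifPn => [/eqP|_]; first by lra.
by rewrite divfK ?lnK ?posrE// gt_eqF ?ln6_gt0.
Qed.

Lemma powR_exprn (x a : R) n : 0 <= x -> (x ^+ n) `^ a = (x `^ a) ^+ n.
Proof. by move=> x0; rewrite -(powR_mulrn n x0) -(powR_mulrn n (powR_ge0 x a)) -!powRrM mulrC. Qed.

Lemma power_scale (rho x : R) : 0 < rho < 1 -> 0 < x <= 1 ->
  exists k, rho ^+ k.+1 < x <= rho ^+ k.
Proof.
move=> /andP[r0 r1] /andP[x0 x1].
have ex : exists k, rho ^+ k.+1 < x.
  have : (fun k => rho ^+ k) @ \oo --> (0 : R) by apply: cvg_expr; rewrite gtr0_norm.
  move/cvgrPdist_lt => /(_ _ x0)[N _ /(_ N.+1 (leqnSn _))].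
  by rewrite sub0r normrN gtr0_norm ?exprn_gt0// => h; exists N.
case: (ex_minnP ex) => -[|k] hk hmin; first by exists 0%N; rewrite hk expr0.
by exists k.+1; rewrite hk leNgt; apply/negP => /hmin; rewrite ltnn.
Qed.

Lemma curve_holder : holder (theta R) curve.
Proof.
(* One factor 2 comes from [curve_close], the other from passing from level [j] to [j.+1]. *)
exists 4 => s t; rewrite !in_itv01 => hs ht.
have [->|st] := eqVneq s t; first by rewrite !subrr !normr0 mulr_ge0// powR_ge0.
have x0 : 0 < `|s - t| by rewrite normr_gt0 subr_eq0.
have x1 : 0 < `|s - t| <= 1.
  by rewrite x0 /= ler_norml; case/andP: hs; case/andP: ht => *; lra.
have [|j /andP[j1 j2]] := power_scale (rho := 6^-1) _ x1.
  by apply/andP; split; lra.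
rewrite exprVn in j1; rewrite exprVn -[leRHS]div1r ler_pdivlMr ?exprn_gt0// in j2.
have p2 : 0 < (2 : R) ^+ j by rewrite exprn_gt0.
have := curve_close hs ht j2; rewrite -ler_pdivlMr// => /le_trans; apply.
have -> : 2 / 2 ^+ j = 4 * (2 ^+ j.+1)^-1 :> R.
  by rewrite exprS; field; rewrite gt_eqF.
have V (x : R) : 0 <= x -> (x `^ theta R)^-1 = (x^-1) `^ theta R.
  by move=> x_ge0; rewrite -(powR_inv1 (powR_ge0 x _)) -(powR_inv1 x_ge0) powRAC.
rewrite ler_pM2l// -[in leLHS]powR6_theta -powR_exprn// V ?exprn_ge0//.
by apply: ge0_ler_powR; rewrite ?nnegrE ?invr_ge0 ?exprn_ge0// ltW// theta_gt0.
Qed.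

End Curve.

(** * Upper bounds for the Hausdorff dimension *)

Section HausdorffUpper.
Context {R : realType}.
Implicit Types (E A : set (R * R)) (p q : R * R).

Lemma edist_le p q : Defs.edist p q <= `|p.1 - q.1| + `|p.2 - q.2|.
Proof.
rewrite /Defs.edist -[leRHS]ger0_norm ?addr_ge0// -sqrtr_sqr ler_wsqrtr//.
rewrite -(real_normK (num_real (p.1 - q.1))) -(real_normK (num_real (p.2 - q.2))).
by rewrite sqrrD addrAC lerDl mulrn_wge0// mulr_ge0.
Qed.

Lemma diam_ge0 E : (0 <= diam E)%E.
Proof. by apply: ereal_sup_ubound; left. Qed.

Lemma diam_le E (c : R) : 0 <= c ->
  (forall p q, E p -> E q -> Defs.edist p q <= c) -> (diam E <= c%:E)%E.
Proof.
move=> c0 h; apply: ge_ereal_sup => _ [->|[p Ep [q Eq <-]]]; rewrite lee_fin//.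
exact: h.
Qed.

Lemma le_diam E p q : E p -> E q -> ((Defs.edist p q)%:E <= diam E)%E.
Proof. by move=> Ep Eq; apply: ereal_sup_ubound; right; exists p => //; exists q. Qed.

Lemma edist_ge p q :
  `|p.1 - q.1| <= Defs.edist p q /\ `|p.2 - q.2| <= Defs.edist p q.
Proof.
by split; rewrite -sqrtr_sqr ler_wsqrtr// ?lerDl ?lerDr sqr_ge0.
Qed.

Lemma diam_set0 : diam (set0 : set (R * R)) = 0%E.
Proof.
by apply/eqP; rewrite eq_le diam_ge0 andbT; apply: diam_le.
Qed.

Lemma nneseries_le_ub (u : nat -> \bar R) (b : \bar R) :
  (forall k, (0 <= u k)%E) -> (forall k, (\sum_(0 <= i < k) u i <= b)%E) ->
  (\sum_(0 <= i <oo) u i <= b)%E.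
Proof.
by move=> u0 h; apply: lime_le; [exact: is_cvg_nneseries|exact: nearW].
Qed.

Lemma sum_geometric_le (c x : R) N k : 0 <= c -> 0 <= x < 1 ->
  \sum_(0 <= i < k) c * x ^+ (N + i) <= c * x ^+ N / (1 - x).
Proof.
move=> c0 /andP[x0 x1].
rewrite ler_pdivlMr ?subr_gt0// mulr_suml.
rewrite (eq_bigr (fun i => c * x ^+ (N + i) - c * x ^+ (N + i.+1))); last first.
  by move=> i _; rewrite addnS exprS; ring.
rewrite (@telescope_sumr_eq _ 0 k (fun i => - (c * x ^+ (N + i))))//; last first.
  by move=> i _; rewrite opprK addrC.
by rewrite opprK addn0 addrC gerBl mulr_ge0// exprn_ge0.
Qed.

Lemma sum_lt_le (c : R) N k : 0 <= c ->
  \sum_(0 <= i < k) (if (i < N)%N then c else 0) <= N%:R * c.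
Proof.
move=> c0; suff -> : \sum_(0 <= i < k) (if (i < N)%N then c else 0) =
    (minn k N)%:R * c by rewrite ler_wpM2r// ler_nat geq_minr.
elim: k => [|k IH]; first by rewrite big_geq// min0n mul0r.
rewrite big_nat_recr//= IH; case: ltnP => kN.
  have -> : minn k.+1 N = k.+1 by lia.
  by rewrite -[in RHS]natr1 mulrDl mul1r.
by rewrite addr0; congr (_%:R * _); lia.
Qed.

(** A point need be covered at infinitely many levels only: for every [N] the families of level at
    least [N] form a cover, and its sum is the tail of a geometric series. *)
Lemma hausdorff_null A (s C x : R) (n : nat -> nat)
    (F : nat -> nat -> set (R * R)) (d : nat -> R) :
  0 < s -> 0 <= C -> 0 <= x < 1 ->
  (forall m i, (diam (F m i) <= (d m)%:E)%E) ->
  d @ \oo --> 0 ->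
  (forall m, (n m)%:R * d m `^ s <= C * x ^+ m) ->
  (forall N p, A p -> exists m i, [/\ (N <= m)%N, (i < n m)%N & F m i p]) ->
  hausdorff_measure s A = 0%E.
Proof.
move=> s0 C0 x01 Fd d0 nd cov.
have dge0 m : 0 <= d m by rewrite -lee_fin (le_trans (diam_ge0 _) (Fd m 0%N)).
apply/eqP; rewrite eq_le; apply/andP; split; last first.
  apply: (@le_trans _ _ (hausdorff_premeasure s 1 A)); last first.
    by apply: ereal_sup_ubound; exists 1 => //=.
  by apply: le_ereal_inf_tmp => _ [E _ <-]; apply: nneseries_ge0 => k _ _; exact: poweR_ge0.
apply: ge_ereal_sup => _ [delta /= delta0 <-].
apply/lee_addgt0Pr => e e0; rewrite add0e.
have [x0 x1] := andP x01.
have [N [Nd Ne]] : exists N, (forall m, (N <= m)%N -> d m <= delta) /\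
    C * x ^+ N / (1 - x) <= e.
  have /cvgrPdist_le /(_ _ delta0) [N1 _ h1] := d0.
  have : (fun k => C / (1 - x) * x ^+ k) @ \oo --> C / (1 - x) * 0.
    by apply: cvgMr; apply: cvg_expr; rewrite ger0_norm.
  rewrite mulr0 => /cvgrPdist_le /(_ _ e0) [N2 _ h2].
  exists (maxn N1 N2); split.
    move=> m; rewrite geq_max => /andP[m1 _].
    have := h1 m m1; rewrite sub0r normrN /=; exact: le_trans (ler_norm _).
  have := h2 (maxn N1 N2) (leq_maxr _ _); rewrite /= sub0r normrN mulrAC.
  exact: le_trans (ler_norm _).
(* Each level is padded with [set0], which costs nothing as [s > 0]; a bijection of [nat] with the
   pairs then makes one sequence of the double family. *)
pose E m i := if (i < n (N + m))%N then F (N + m)%N i else set0.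
have Ed m i : (diam (E m i) <= (d (N + m))%:E)%E.
  by rewrite /E; case: ifP => // _; rewrite diam_set0 lee_fin.
have /card_esym/ppcard_eqP[f] := card_nat2.
pose g (k : nat * nat) := (diam (E k.1 k.2) `^ s)%E.
have g0 k : (0 <= g k)%E by exact: poweR_ge0.
apply: (@le_trans _ _ (\sum_(0 <= k <oo) g (f k))%E).
  apply: ereal_inf_lbound; exists (fun k => E (f k).1 (f k).2) => //; split.
    move=> p /(cov N)[m [i [Nm im Fp]]].
    exists (f^-1%FUN ((m - N)%N, i)) => //=; rewrite invK ?inE//=.
    by rewrite /E subnKC// im.
  by move=> k; apply: le_trans (Ed _ _) _; rewrite lee_fin Nd// leq_addr.
rewrite nneseries_esumT//.
rewrite -(@reindex_esum R _ _ setT setT f g); last exact: 'bij_f.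
have -> : setT = setT `*`` (fun=> setT) :> set (nat * nat).
  by apply/seteqP; split.
rewrite -(@esum_esum _ _ _ setT (fun=> setT) (fun m i => g (m, i)))//.
rewrite -nneseries_esumT; last by move=> m; exact: esum_ge0.
apply: le_trans (_ : (_ <= (C * x ^+ N / (1 - x))%:E)%E) _; last by rewrite lee_fin.
apply: nneseries_le_ub => [m|k]; first exact: esum_ge0.
apply: le_trans (_ : (_ <= (\sum_(0 <= m < k) C * x ^+ (N + m))%:E)%E) _; last first.
  by rewrite lee_fin sum_geometric_le.
rewrite -sumEFin; apply: lee_sum => m _.
rewrite -nneseries_esumT//.
apply: le_trans (_ : (_ <= ((n (N + m))%:R * d (N + m) `^ s)%:E)%E) _; last first.
  by rewrite lee_fin.
apply: nneseries_le_ub => // l.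
apply: le_trans (_ : (_ <= \sum_(0 <= i < l) (if (i < n (N + m))%N then d (N + m) `^ s else 0)%:E)%E) _.
  apply: lee_sum => i _; rewrite /g /=; case: ifPn => h; last first.
    by rewrite /E (negbTE h) diam_set0 poweR0r// gt_eqF.
  rewrite -poweR_EFin gt0_ler_poweR// ?ltW//.
    by rewrite in_itv /= diam_ge0 leey.
  by rewrite in_itv /= lee_fin dge0 leey.
by rewrite sumEFin lee_fin sum_lt_le// powR_ge0.
Qed.

End HausdorffUpper.

(** * Counting approximate squares *)

Section GoodScales.
Context {R : realType}.

(* Otherwise [a m / m] would increase by at least [eps] each time [m] is
   replaced with [floor (tau m)]. *)
Lemma frequent_scale (a : nat -> nat) (tau eps : R) (N : nat) :
  (forall m, (a m <= m)%N) -> 0 < tau <= 1 -> 0 < eps ->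
  exists2 m, (N <= m)%N &
    (a (Num.truncn (tau * m%:R)))%:R <= tau * (a m)%:R + eps * m%:R.
Proof.
move=> am /andP[tau0 tau1] eps0; apply: contrapT => H.
have {}H m : (N <= m)%N ->
    tau * (a m)%:R + eps * m%:R < (a (Num.truncn (tau * m%:R)))%:R.
  by move=> Nm; rewrite ltNge; apply/negP => h; apply: H; exists m.
have step k : exists T, forall m, (T <= m)%N ->
    (a m)%:R <= (1 - k%:R * eps) * m%:R.
  elim: k => [|k [T IH]].
    by exists 0%N => m _; rewrite mul0r subr0 mul1r ler_nat.
  have k0 : 0 <= 1 - k%:R * eps.
    have := IH (maxn T 1) (leq_maxl _ _).
    have p : 0 < (maxn T 1)%:R :> R by rewrite ltr0n leq_max orbT.
    by move=> h; rewrite -(pmulr_lge0 _ p) (le_trans _ h).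
  exists (maxn N (Num.truncn (T%:R / tau)).+1) => m.
  rewrite geq_max => /andP[/H hm Tm].
  have m0 : 0 <= tau * m%:R by rewrite mulr_ge0// ltW.
  have /andP[l1 l2] := truncn_itv m0.
  have /IH h : (T <= Num.truncn (tau * m%:R))%N.
    rewrite truncn_ge_nat// mulrC -ler_pdivrMr// ltW//.
    by apply: lt_le_trans (truncnS_gt _) _; rewrite ler_nat.
  have : tau * (a m)%:R <= tau * ((1 - k.+1%:R * eps) * m%:R).
    rewrite -natr1.
    have m1 : 0 <= m%:R :> R by [].
    have : (1 - k%:R * eps) * (Num.truncn (tau * m%:R))%:R <=
           (1 - k%:R * eps) * (tau * m%:R) by rewrite ler_wpM2l.
    have : eps * (tau * m%:R) <= eps * m%:R.
      by rewrite ler_wpM2l ?(ltW eps0)// ler_piMl.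
    lra.
  by rewrite ler_pM2l.
have [T hT] := step (Num.truncn eps^-1).+1.
have := hT (maxn T 1) (leq_maxl _ _); apply/negP; rewrite -ltNge.
apply: (@lt_le_trans _ _ 0) => //.
rewrite nmulr_rlt0 ?ltr0n ?leq_max ?orbT//.
by rewrite subr_lt0 -ltr_pdivrMr// mul1r truncnS_gt.
Qed.

Lemma sum_zeros (x : R) m : \sum_(k < 2 ^ m) x ^+ zeros m k = (x + 1) ^+ m.
Proof.
elim: m => [|m IH]; first by rewrite big_ord_recl big_ord0 addr0 !expr0.
rewrite expnSr (sum_nat_mul _ _ (fun k => x ^+ zeros m.+1 k)) exprSr -IH.
rewrite mulr_suml; apply: eq_bigr => k _; rewrite !big_ord_recr big_ord0 /= add0r.
have [-> ->] : ((k * 2 + 0) %/ 2 = k /\ (k * 2 + 0) %% 2 = 0)%N by lia.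
have [-> ->] : ((k * 2 + 1) %/ 2 = k /\ (k * 2 + 1) %% 2 = 1)%N by lia.
by rewrite /= !addn0 addn1 exprSr mulrDr mulr1.
Qed.

Lemma count_row l n k : (k < 2 ^ n)%N ->
  \sum_(i < 6 ^ n) (rowof l n i == k)%:R = (5 ^ zeros n k)%:R :> R.
Proof.
move=> kn; rewrite (sum_row l n (fun j => (j == k)%:R : R)).
rewrite (bigD1 (Ordinal kn))//= eqxx big1 ?addr0// => j.
by rewrite -val_eqE /= => /negbTE ->; rewrite mul0rn.
Qed.

(** [c.2 %/ 2 ^ (m - n)] keeps the first [n] row digits. The first condition places the row inside
    the row of the column; the second is the one that [frequent_scale] supplies. *)
Definition good_cell (tau eps : R) (n m : nat) (c : 'I_(6 ^ n) * 'I_(2 ^ m)) :=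
  (rowof LA n c.1 == c.2 %/ 2 ^ (m - n))%N &&
  ((zeros n (c.2 %/ 2 ^ (m - n)))%:R <= tau * (zeros m c.2)%:R + eps * m%:R).

(** A row with [z] zeros, [z'] of them among its first [n] digits, goes with [5 ^ z'] columns, and
    the second condition gives [5 ^ z' <= 5 ^ (tau z + eps m)]. The sum of [5 ^ (tau z)] over the
    rows is the binomial expansion [sum_zeros]. *)
Lemma card_good_cell (tau eps : R) n m : (n <= m)%N ->
  (#|@good_cell tau eps n m|)%:R <=
    (5 `^ eps) ^+ m * (5 `^ tau + 1) ^+ m.
Proof.
move=> nm; rewrite -sum1_card natr_sum big_mkcond /=.
rewrite -(pair_bigA _ (fun i k => if (i, k) \in @good_cell tau eps n m then 1%:R else 0)) /=.
rewrite exchange_big /= -sum_zeros mulr_sumr; apply: ler_sum => k _.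
have kn : (k %/ 2 ^ (m - n) < 2 ^ n)%N.
  by rewrite ltn_divLR ?expn_gt0// -expnD subnKC.
pose z := ((zeros n (k %/ 2 ^ (m - n)))%:R <= tau * (zeros m k)%:R + eps * m%:R).
rewrite (eq_bigr (fun i : 'I_(6 ^ n) =>
    z%:R * (rowof LA n i == k %/ 2 ^ (m - n))%N%:R)); last first.
  move=> i _; rewrite unfold_in /good_cell /= -/z.
  by case: eqP => _; case: (z); rewrite /= ?mul1r ?mul0r.
rewrite -mulr_sumr count_row//; case: (boolP z) => [hz|_]; last first.
  by rewrite mul0r mulr_ge0// exprn_ge0// ?powR_ge0.
rewrite mul1r natrX -!powR_mulrn ?powR_ge0// -!powRrM -powRD ?pnatr_eq0 ?implybT//.
apply: ler_powR; first by rewrite ler1n.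
by rewrite addrC.
Qed.

End GoodScales.

Section UpperBound.
Context {R : realType}.
Variables (tau : R) (X : R -> R).
Hypothesis tau01 : 0 < tau <= 1.

Let r : R := (6 `^ tau)^-1.
Let lev (m : nat) : nat := Num.truncn (tau * m%:R).

Lemma lev_le m : (lev m <= m)%N.
Proof.
have /andP[t0 t1] := tau01.
rewrite -(ler_nat R); apply: (@le_trans _ _ (tau * m%:R)).
  by rewrite truncn_le mulr_ge0// ltW.
by rewrite ler_piMl.
Qed.

Lemma r_gt0 : 0 < r. Proof. by rewrite invr_gt0 powR_gt0. Qed.

Lemma r_lt1 : r < 1.
Proof.
have /andP[t0 t1] := tau01.
rewrite invf_lt1 ?powR_gt0//; have : 1 `^ tau < 6 `^ tau.
  by apply: gt0_ltr_powR; rewrite ?nnegrE// ltr1n.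
by rewrite powR1.
Qed.

Lemma lev_scale m : (6 ^+ lev m)^-1 <= 6 * r ^+ m.
Proof.
have /andP[t0 t1] := tau01.
rewrite /r exprVn -[_ ^+ m]powR_mulrn ?powR_ge0// -powRrM -ler_pdivrMl// -invfM -exprS.
rewrite lef_pV2 ?posrE ?powR_gt0 ?exprn_gt0// -powR_mulrn//.
by apply: ler_powR; rewrite ?ler1n// ltW// truncnS_gt.
Qed.

(** [X] varies by order [g ^ m] over a cell whose width is of order [r ^ m], so the cell is cut into
    about [(g / r) ^ m] boxes of height [r ^ m]. For f itself [g = r = 1 / 2]; for the Brownian
    graph [r = 1 / 4] and [g] is slightly above [1 / 2]. *)
Lemma hausdorff_upper (C g eps s : R) : 0 < s -> 0 < eps -> 0 <= C ->
  r <= g ->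
  (forall m t t', 0 <= t <= 1 -> 0 <= t' <= 1 ->
     colof (lev m) t = colof (lev m) t' -> frow m t = frow m t' ->
     `|X t - X t'| <= C * g ^+ m) ->
  5 `^ eps * (5 `^ tau + 1) * (g / r) * r `^ s < 1 ->
  hausdorff_measure s (graph X) = 0%E.
Proof.
move=> s0 eps0 C0 rg hX hx.
have r0 := r_gt0; have r1 := r_lt1; have g0 := lt_le_trans r0 rg.
have gr : 1 <= g / r by rewrite ler_pdivlMr// mul1r.
pose p m : nat := (Num.truncn (2 * C * (g / r) ^+ m)).+1.
have pE m : (p m)%:R <= (2 * C + 1) * (g / r) ^+ m.
  rewrite /p -[leLHS]natr1 [leRHS]mulrDl mul1r lerD ?exprn_ege1//.
  by rewrite truncn_le ?mulr_ge0// exprn_ge0// ltW// divr_gt0.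
pose cell m (c : 'I_(6 ^ lev m) * 'I_(2 ^ m)) :=
  [set t : R | [/\ 0 <= t <= 1, colof (lev m) t = c.1 & frow m t = c.2]].
(* All values over a cell lie within [C g ^ m] of the value at one reference point, hence in an
   interval of length [2 C g ^ m] starting at [base]. *)
pose base m c := X (xget 0 (@cell m c)) - C * g ^+ m.
pose J m := ({c | @good_cell R tau eps (lev m) m c} * 'I_(p m))%type.
pose box m (c : J m) := [set q : R * R | exists t, [/\ cell m (val c.1) t, q = (t, X t) &
   base m (val c.1) + c.2%:R * r ^+ m <= X t <= base m (val c.1) + c.2.+1%:R * r ^+ m]].
pose F m i := if insub i is Some j then @box m (enum_val (j : 'I_(#|{: J m}|))) else set0.
apply: (@hausdorff_null _ _ s ((2 * C + 1) * 7 `^ s)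
  (5 `^ eps * (5 `^ tau + 1) * (g / r) * r `^ s)
  (fun m => #|{: J m}|) F (fun m => 7 * r ^+ m)) => //.
- by rewrite mulr_ge0 ?powR_ge0// addr_ge0// mulr_ge0.
- by rewrite hx andbT !mulr_ge0 ?addr_ge0 ?powR_ge0 ?invr_ge0 ?powR_ge0 ?(ltW g0).
- move=> m i; rewrite /F; case: insubP => [j _ _|_]; last first.
    by rewrite diam_set0 lee_fin mulr_ge0// exprn_ge0// ltW.
  apply: diam_le; first by rewrite mulr_ge0// exprn_ge0// ltW.
  move=> _ _ [t [[ht t1 _] -> /andP[a1 a2]]] [t' [[ht' t1' _] -> /andP[b1 b2]]].
  apply: le_trans (edist_le _ _) _ => /=.
  (* By rounding down, a column of level [lev m] may be up to 6 times wider than [r ^ m]; the height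
     of the box adds [r ^ m]. *)
  have -> : 7 * r ^+ m = 6 * r ^+ m + r ^+ m by ring.
  apply: lerD.
    apply: le_trans (lev_scale m).
    have := col_itv (lev m) ht; have := col_itv (lev m) ht'.
    rewrite t1 t1'; move: (nat_of_ord (val (enum_val j).1).1) => v.
    rewrite -(@natr1 R v) => /andP[d1 d2] /andP[e1 e2].
    have p6 : 0 < (6 : R) ^+ lev m by rewrite exprn_gt0.
    rewrite -[leRHS]mul1r ler_pdivlMr// -{1}(gtr0_norm p6) -normrM ler_norml mulrBl.
    by apply/andP; split; lra.
  move: a1 a2 b1 b2; rewrite -natr1 mulrDl mul1r => a1 a2 b1 b2.
  by rewrite ler_norml; apply/andP; split; lra.
- have : (fun m => 7 * r ^+ m) @ \oo --> (7 * 0 : R).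
    by apply: cvgMr; apply: cvg_expr; rewrite gtr0_norm.
  by rewrite mulr0.
- move=> m; rewrite card_prod card_ord natrM card_sig.
  rewrite powRM ?exprn_ge0 ?(ltW r0)// powR_exprn ?(ltW r0)//.
  have h1 := card_good_cell tau eps (lev_le m).
  have h2 := pE m.
  rewrite !exprMn.
  set a := _%:R in h1 *; set b := (p m)%:R in h2 *.
  set u := _ * _ in h1; set v := _ * _ in h2.
  have -> : (2 * C + 1) * 7 `^ s * ((5 `^ eps) ^+ m * (5 `^ tau + 1) ^+ m *
    (g ^+ m * r^-1 ^+ m) * (r `^ s) ^+ m) = u * v * (7 `^ s * (r `^ s) ^+ m).
    by rewrite /u /v exprMn; ring.
  rewrite ler_wpM2r//; first by rewrite mulr_ge0 ?exprn_ge0 ?powR_ge0.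
  by apply: ler_pM.
- move=> N q [t]; rewrite /= in_itv01 => ht <-.
  have t0 : 0 <= t by case/andP: ht.
  have am m : (zeros m (frow m t) <= m)%N by exact: zeros_le.
  (* The scale depends on the point: its zero digits must not be overrepresented among its first
     [lev m] row digits. *)
  have [m Nm hm] := frequent_scale N am tau01 eps0.
  pose c : 'I_(6 ^ lev m) * 'I_(2 ^ m) :=
    (Ordinal (col_lt (lev m) t), Ordinal (row_lt LA m (colof m t))).
  have fd : (frow m t %/ 2 ^ (m - lev m))%N = frow (lev m) t.
    by rewrite -{1}(subnKC (lev_le m)) frow_div.
  have cg : @good_cell R tau eps (lev m) m c.
    by rewrite /good_cell /= -/(frow m t) fd eqxx.
  have ct : cell m c t by split.
  have cx : cell m c (xget 0 (cell m c)) by apply: xgetPex; exists t.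
  case: cx => hx' x1 x2; have := hX m _ _ ht hx'.
  rewrite x1 x2 => /(_ erefl erefl).
  rewrite ler_norml => /andP[y1 y2].
  pose y := (X t - base m c) / r ^+ m.
  have rm : 0 < r ^+ m by rewrite exprn_gt0.
  have y0 : 0 <= y by rewrite /y divr_ge0 ?(ltW rm)// /base; lra.
  have yp : (Num.truncn y < p m)%N.
    rewrite /p ltnS; apply: le_truncn; rewrite /y ler_pdivrMr//.
    by rewrite expr_div_n mulrA divfK ?gt_eqF// /base; lra.
  exists m, (enum_rank ((exist _ c cg, Ordinal yp) : J m)); split=> //.
  rewrite /F insubT//= => hlt.
  rewrite (_ : Sub _ _ = enum_rank ((exist _ c cg, Ordinal yp) : J m)); last exact: val_inj.
  rewrite enum_rankK; exists t; split=> //=.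
  have /andP[z1 z2] := truncn_itv y0.
  move: z1 z2; move: (Num.truncn y) => k.
  rewrite /y ler_pdivlMr// ltr_pdivrMr// => z1 z2.
  by apply/andP; split; lra.
Qed.

End UpperBound.

(** * Lower bounds by the energy method *)

Section LowerBound.
Context {R : realType}.

(** Compactness leaves finitely many scales, so that a discrete measure of a fine enough level can
    stand in for a limit measure. *)
Lemma finite_box_cover (X : R -> R) (p : nat -> R * R) (rho : nat -> R) :
  {within `[0, 1], continuous X} ->
  (forall t : R, 0 <= t <= 1 ->
     exists k, `|(p k).1 - t| < rho k /\ `|(p k).2 - X t| < rho k) ->
  exists M, forall t : R, 0 <= t <= 1 -> exists k,
    [/\ (k < M)%N, `|(p k).1 - t| < rho k & `|(p k).2 - X t| < rho k].
Proof.
move=> cX cov.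
have oX (k : nat) : exists U : set R, open U /\
    U `&` `[0, 1] = (X @^-1` ball (p k).2 (rho k)) `&` `[0, 1].
  move/continuousP: cX => /(_ _ (ball_open (p k).2 (rho k))).
  by move=> /open_subspaceP[U oU UX]; exists U.
have [U UX] := choice oX.
have := @segment_compact R 0 1; rewrite compact_cover.
move=> /(_ nat setT (fun k => ball (p k).1 (rho k) `&` U k)).
case=> [k _|t t01|D _ Dcov].
- by apply: openI; [exact: ball_open|have [] := UX k].
- have [|k [k1 k2]] := cov t; first by rewrite -in_itv01.
  exists k => //; split=> //; have [_] := UX k.
  by move/seteqP => [_ /(_ t)] /(_ (conj k2 t01)) [].
exists (\max_(k <- finmap.enum_fset D) k).+1 => t; rewrite -in_itv01 => t01.
have [k /= kD [k1 k2]] := Dcov t t01; exists k; split=> //.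
  by rewrite ltnS; apply: (@leq_bigmax_seq _ (finmap.enum_fset D) xpredT id k).
have [_] := UX k.
by move/seteqP => [/(_ t)] /(_ (conj k2 t01)) [].
Qed.

(* A discrete [gam]-energy of the measure with mass [wt i] at [pt i], lifted to
   the graph of [X] and truncated at the scale [rho ^ kap]. *)
Definition energy (X : R -> R) (gam rho : R) (n kap : nat) (pt wt : nat -> R) : R :=
  \sum_(k < kap.+1) (rho ^+ k) `^ (- gam) *
    \sum_(i < n) \sum_(j < n) wt i * wt j *
      ((`|pt i - pt j| <= rho ^+ k) && (`|X (pt i) - X (pt j)| <= rho ^+ k))%:R.

(** Each node is given to one box near it, and [m k] is the mass received by box [k]. Two nodes of
    one box are within [rho ^+ sc k] in both coordinates, so the energy dominates the sum of
    [m k ^ 2 / t k]. As the total mass is 1, Cauchy-Schwarz bounds the sum of the [t k] from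
    below. *)
Lemma energy_cover (X : R -> R) (gam rho C : R) (n kap M : nat)
    (pt wt : nat -> R) (p : nat -> R * R) (rad : nat -> R) (sc : nat -> nat) :
  0 < rho -> 0 < C -> (forall i, 0 <= wt i) -> \sum_(i < n) wt i = 1 ->
  (forall i, (i < n)%N -> exists k, [/\ (k < M)%N,
     `|(p k).1 - pt i| < rad k & `|(p k).2 - X (pt i)| < rad k]) ->
  (forall k, (k < M)%N -> 2 * rad k <= rho ^+ sc k /\ (sc k <= kap)%N) ->
  energy X gam rho n kap pt wt <= C ->
  1 <= C * \sum_(k < M) (rho ^+ sc k) `^ gam.
Proof.
move=> rho0 C0 wt0 wt1 cov hsc hE.
have ha (i : 'I_n) : exists k : 'I_M,
    `|(p k).1 - pt i| < rad k /\ `|(p k).2 - X (pt i)| < rad k.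
  by have [k [kM k1 k2]] := cov i (ltn_ord i); exists (Ordinal kM).
have [a aP] := choice ha.
pose t (k : 'I_M) := (rho ^+ sc k) `^ gam.
have t0 k : 0 < t k by rewrite powR_gt0// exprn_gt0.
pose m k := \sum_(i < n) wt i * (a i == k)%:R.
have m1 : \sum_k m k = 1.
  rewrite exchange_big -[RHS]wt1; apply: eq_bigr => i _ /=.
  rewrite -mulr_sumr (bigD1 (a i))//= eqxx big1 ?addr0 ?mulr1// => k.
  by rewrite eq_sym => /negbTE ->.
have mE : \sum_k m k ^+ 2 / t k <= C.
  apply: le_trans hE; rewrite /energy.
  have -> : \sum_k m k ^+ 2 / t k = \sum_(i < n) \sum_(j < n) wt i * wt j *
      \sum_k (t k)^-1 * ((a i == k) && (a j == k))%:R.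
    rewrite (eq_bigr (fun k => \sum_(i < n) \sum_(j < n) wt i * wt j *
        ((t k)^-1 * ((a i == k) && (a j == k))%:R))).
      rewrite exchange_big; apply: eq_bigr => i _; rewrite exchange_big.
      by apply: eq_bigr => j _; rewrite mulr_sumr.
    move=> k _; rewrite expr2 /m mulr_suml mulr_suml; apply: eq_bigr => i _.
    rewrite mulr_sumr mulr_suml; apply: eq_bigr => j _.
    by rewrite -mulnb natrM; ring.
  have -> : \sum_(k < kap.+1) (rho ^+ k) `^ (- gam) *
    (\sum_(i < n) \sum_(j < n) wt i * wt j *
      ((`|pt i - pt j| <= rho ^+ k) && (`|X (pt i) - X (pt j)| <= rho ^+ k))%:R) =
    \sum_(i < n) \sum_(j < n) wt i * wt j * \sum_(k < kap.+1) (rho ^+ k) `^ (- gam) *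
      ((`|pt i - pt j| <= rho ^+ k) && (`|X (pt i) - X (pt j)| <= rho ^+ k))%:R.
    rewrite (eq_bigr (fun k : 'I_kap.+1 => \sum_(i < n) \sum_(j < n) wt i * wt j *
        ((rho ^+ k) `^ (- gam) * ((`|pt i - pt j| <= rho ^+ k) &&
           (`|X (pt i) - X (pt j)| <= rho ^+ k))%:R))).
      rewrite exchange_big; apply: eq_bigr => i _; rewrite exchange_big.
      by apply: eq_bigr => j _; rewrite mulr_sumr.
    move=> k _; rewrite mulr_sumr; apply: eq_bigr => i _.
    by rewrite mulr_sumr; apply: eq_bigr => j _; ring.
  apply: ler_sum => i _; apply: ler_sum => j _.
  apply: ler_wpM2l; first by rewrite mulr_ge0.
  have nn : 0 <= \sum_(k < kap.+1) (rho ^+ k) `^ (- gam) *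
      ((`|pt i - pt j| <= rho ^+ k) && (`|X (pt i) - X (pt j)| <= rho ^+ k))%:R.
    by apply: sumr_ge0 => k _; rewrite mulr_ge0// powR_ge0.
  have [aij|aij] := eqVneq (a i) (a j); last first.
    rewrite big1// => k _; case: eqP => [<-|_]; last by rewrite mulr0.
    by rewrite eq_sym (negbTE aij) mulr0.
  rewrite (bigD1 (a i))//= -aij eqxx mulr1 big1 ?addr0; last first.
    by move=> k /negbTE; rewrite eq_sym => ->; rewrite mulr0.
  have [h1 h2] := hsc _ (ltn_ord (a i)).
  (* Of the energy, only the term at the scale of the common box is kept. *)
  rewrite (bigD1 (Ordinal (h2 : sc (a i) < kap.+1)%N))//= /t powRN.
  have [i1 i2] := aP i; have [j1 j2] := aP j; rewrite -aij in j1 j2.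
  have -> : `|pt i - pt j| <= rho ^+ sc (a i).
    by move: i1 j1; rewrite !ltr_norml ler_norml => /andP[? ?] /andP[? ?]; apply/andP; split; lra.
  have -> : `|X (pt i) - X (pt j)| <= rho ^+ sc (a i).
    by move: i2 j2; rewrite !ltr_norml ler_norml => /andP[? ?] /andP[? ?]; apply/andP; split; lra.
  by rewrite mulr1 lerDl; apply: sumr_ge0 => k _; rewrite mulr_ge0// powR_ge0.
(* AM-GM for [C * t k] and [m k ^+ 2 / (C * t k)]. *)
have key k : m k <= C / 2 * t k + (2 * C)^-1 * (m k ^+ 2 / t k).
  rewrite -subr_ge0.
  have -> : C / 2 * t k + (2 * C)^-1 * (m k ^+ 2 / t k) - m k =
      (C * t k - m k) ^+ 2 * (2 * C * t k)^-1.
    by field; rewrite !gt_eqF.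
  by rewrite mulr_ge0 ?sqr_ge0// invr_ge0 !mulr_ge0// ltW.
have : 1 <= C / 2 * (\sum_k t k) + (2 * C)^-1 * C.
  rewrite -[leLHS]m1.
  apply: le_trans (_ : _ <= C / 2 * (\sum_k t k) + (2 * C)^-1 * (\sum_k m k ^+ 2 / t k)) _.
    by rewrite !mulr_sumr -big_split /=; apply: ler_sum => k _; exact: key.
  by rewrite lerD2l ler_wpM2l// invr_ge0 mulr_ge0// ltW.
have -> : (2 * C)^-1 * C = 2^-1 by field; rewrite gt_eqF.
rewrite -/t; lra.
Qed.

(** A cover with a small sum of [diam ^ s] could be enlarged to finitely many boxes that contradict
    [energy_cover]. Infinitely many [N] are enough, which is all that Fatou's lemma will provide. *)
Lemma hausdorff_energy (X : R -> R) (gam rho C s : R) (n kap : nat -> nat)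
    (pt wt : nat -> nat -> R) :
  {within `[0, 1], continuous X} -> 0 < rho < 1 -> 0 < s <= gam ->
  (forall N i, (i < n N)%N -> 0 <= pt N i <= 1) ->
  (forall N i, 0 <= wt N i) -> (forall N, \sum_(i < n N) wt N i = 1) ->
  (forall K, exists2 N, (K <= kap N)%N &
     energy X gam rho (n N) (kap N) (pt N) (wt N) <= C) ->
  hausdorff_measure s (graph X) <> 0%E.
Proof.
move=> cX rho01 /andP[s0 sgam] pt01 wt0 wt1 hE H0.
have gam0 : 0 < gam by exact: lt_le_trans sgam.
have [rho0 rho1] := andP rho01.
pose C' := `|C| + 1.
have C'0 : 0 < C' by rewrite ltr_wpDl.
pose B := C' * (2 / rho) `^ gam * 2 `^ s.
have B0 : 0 < B by rewrite !mulr_gt0// powR_gt0// divr_gt0.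
(* The bound [(4 * B)^-1] makes the final sum at most [1 / 2]; the other one keeps [q k <= 1 / 8],
   hence [2 * rad k < 1] as [power_scale] requires. *)
pose e := Num.min ((4 * B)^-1) (8^-1 `^ s).
have e0 : 0 < e by rewrite lt_min invr_gt0 mulr_gt0//= powR_gt0// invr_gt0.
have e1 : e <= (4 * B)^-1 by rewrite ge_min lexx.
have e2 : e <= 8^-1 `^ s by rewrite ge_min lexx orbT.
have : (hausdorff_premeasure s 8^-1 (graph X) < e%:E)%E.
  apply: (@le_lt_trans _ _ 0%E); last by rewrite lte_fin.
  rewrite -H0; apply: ereal_sup_ubound; exists 8^-1 => //=.
move=> /ereal_inf_lt[_ [E [EX Ed] <-] Ee].
pose d k := fine (diam (E k)).
have dE k : diam (E k) = (d k)%:E.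
  rewrite fineK// ge0_fin_numE ?diam_ge0//.
  by apply: le_lt_trans (Ed k) _; rewrite ltry.
have d0 k : 0 <= d k by rewrite -lee_fin -dE diam_ge0.
have d1 k : d k <= 8^-1 by rewrite -lee_fin -dE.
(* Sets of diameter 0 need a positive radius; [q k] supplies it, and the powers of exponent [s] add
   up to at most [e]. *)
pose q k := (e / (2 ^ k.+1)%:R) `^ s^-1.
have q0 k : 0 < q k by rewrite powR_gt0// divr_gt0// ltr0n expn_gt0.
have q1 k : q k <= 8^-1.
  have -> : 8^-1 = (8^-1 `^ s) `^ s^-1 :> R.
    by rewrite -powRrM divff ?gt_eqF// powRr1// invr_ge0.
  apply: ge0_ler_powR; rewrite ?nnegrE ?powR_ge0 ?invr_ge0 ?(ltW s0)//.
    by rewrite divr_ge0// ltW.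
  apply: le_trans e2; rewrite ler_pdivrMr ?ltr0n ?expn_gt0//.
  by rewrite ler_peMr ?(ltW e0)// ler1n expn_gt0.
pose rad k := 2 * Num.max (d k) (q k).
have rad0 k : 0 < rad k by rewrite mulr_gt0// lt_max q0 orbT.
have rad1 k : rad k <= 4^-1.
  have : Num.max (d k) (q k) <= 8^-1 by rewrite ge_max d1 q1.
  by rewrite /rad; lra.
have rads k : rad k `^ s <= 2 `^ s * (d k `^ s + e / (2 ^ k.+1)%:R).
  rewrite powRM// ?le_max ?d0// ler_wpM2l ?powR_ge0//.
  have qs : q k `^ s = e / (2 ^ k.+1)%:R.
    by rewrite -powRrM mulVf ?gt_eqF// powRr1// divr_ge0// ltW.
  rewrite -qs; case: (leP (d k) (q k)) => _.
    by rewrite lerDr powR_ge0.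
  by rewrite lerDl powR_ge0.
pose p k := xget (0, 0) (E k).
have [t t01|M cov] := @finite_box_cover X p rad cX _.
  have [k _ Ek] := EX (t, X t) (ex_intro2 _ _ t (etrans (in_itv01 t) t01) erefl).
  have pE : E k (p k) by apply: xgetPex; exists (t, X t).
  have := le_diam pE Ek; rewrite dE lee_fin => ed.
  have [ed1 ed2] := edist_ge (p k) (t, X t).
  have dr : d k < rad k.
    have : d k <= Num.max (d k) (q k) by rewrite le_max lexx.
    have : q k <= Num.max (d k) (q k) by rewrite le_max lexx orbT.
    by have := q0 k; rewrite /rad; lra.
  by exists k; split; [apply: le_lt_trans (le_trans ed1 ed) dr|
    apply: le_lt_trans (le_trans ed2 ed) dr].
have hsc k : exists l, rho ^+ l.+1 < 2 * rad k <= rho ^+ l.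
  apply: power_scale => //; rewrite mulr_gt0//=.
  by have := rad1 k; lra.
have [sc scP] := choice hsc.
have [N KN EN] := hE (\max_(k < M) sc k).
have h : 1 <= C' * \sum_(k < M) (rho ^+ sc k) `^ gam.
  apply: (@energy_cover X gam rho C' (n N) (kap N) M (pt N) (wt N) p rad sc) => //.
  - by move=> i /(pt01 N) /cov.
  - move=> k kM; have /andP[_ ->] := scP k; split=> //.
    by apply: leq_trans KN; exact: (@leq_bigmax _ (fun k : 'I_M => sc k) (Ordinal kM)).
  - by rewrite /C'; apply: le_trans EN _; apply: le_trans (ler_norm _) _; rewrite lerDl.
have tk k : (rho ^+ sc k) `^ gam <= (2 / rho) `^ gam * 2 `^ s * (d k `^ s + e / (2 ^ k.+1)%:R).
  have /andP[l1 _] := scP k.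
  apply: (@le_trans _ _ ((2 / rho * rad k) `^ gam)).
    apply: ge0_ler_powR; rewrite ?nnegrE ?(ltW gam0) ?exprn_ge0 ?(ltW rho0)//.
      by rewrite mulr_ge0 ?(ltW (rad0 k))// divr_ge0// ltW.
    rewrite mulrAC ler_pdivlMr// -exprSr; exact: ltW.
  rewrite powRM ?divr_ge0 ?(ltW rho0) ?(ltW (rad0 k))// -mulrA ler_wpM2l ?powR_ge0//.
  apply: le_trans (rads k); apply: ger_powR => //.
  by rewrite rad0 /=; have := rad1 k; lra.
have : 1 <= B * \sum_(k < M) (d k `^ s + e / (2 ^ k.+1)%:R).
  apply: le_trans h _; rewrite /B -!mulrA ler_wpM2l ?(ltW C'0)// !mulrA.
  by rewrite mulr_sumr; apply: ler_sum => k _; exact: tk.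
have sd : \sum_(k < M) d k `^ s <= e.
  rewrite -lee_fin -(big_mkord xpredT (fun k => d k `^ s)) -sumEFin.
  apply: le_trans (ltW Ee); rewrite (eq_bigr (fun k => (diam (E k) `^ s)%E)).
    by apply: nneseries_lim_ge => k _ _; exact: poweR_ge0.
  by move=> k _; rewrite dE.
have se : \sum_(k < M) e / (2 ^ k.+1)%:R <= e.
  rewrite -lee_fin -(big_mkord xpredT (fun k => e / (2 ^ k.+1)%:R)) -sumEFin.
  apply: le_trans (@epsilon_trick0 R e xpredT (ltW e0)).
  by apply: nneseries_lim_ge => k _ _; rewrite lee_fin divr_ge0// ltW.
rewrite big_split /=; apply/negP; rewrite -ltNge.
apply: (@le_lt_trans _ _ (B * ((4 * B)^-1 + (4 * B)^-1))).
  by rewrite ler_wpM2l ?(ltW B0)// lerD// (le_trans _ e1).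
have -> : B * ((4 * B)^-1 + (4 * B)^-1) = 2^-1 by field; rewrite gt_eqF.
by rewrite invf_lt1// ltr1n.
Qed.

End LowerBound.

(** * Measures with prescribed frequencies of row digits *)

Section BlockMeasure.
Context {R : realType}.
Variables (L b : nat).

(* Levels are grouped in blocks of length [L], and a block is admissible when
   exactly [b] of its [L] row digits are 0. Each admissible pattern of row
   digits gets the mass [types^-1], shared by the [5 ^ b] columns in it. *)
Definition types : nat := \sum_(k < 2 ^ L) (zeros L k == b).

Definition block_weight (k : nat) : R :=
  (zeros L k == b)%:R / (types * 5 ^ b)%:R.

Fixpoint weight (B i : nat) : R :=
  if B is B'.+1 then
    weight B' (i %/ 6 ^ L) * block_weight (rowof LA (B * L) i %% 2 ^ L)
  else 1.

Hypothesis types_gt0 : (0 < types)%N.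

Lemma block_weight_ge0 k : 0 <= block_weight k.
Proof. by rewrite divr_ge0. Qed.

Lemma weight_ge0 B i : 0 <= weight B i.
Proof. by elim: B i => [|B IH] i //=; rewrite mulr_ge0 ?block_weight_ge0. Qed.

Lemma block_weight_le k : block_weight k <= (types * 5 ^ b)%:R^-1.
Proof.
by rewrite ler_piMl ?invr_ge0// lern1 leq_b1.
Qed.

Lemma block_weightXE k :
  block_weight k *+ 5 ^ zeros L k = (zeros L k == b)%:R / types%:R.
Proof.
rewrite /block_weight; case: eqP => [->|_]; last by rewrite !mul0r mul0rn.
have b0 : (5 ^ b)%:R != 0 :> R by rewrite pnatr_eq0 -lt0n expn_gt0.
by rewrite -[LHS]mulr_natr natrM invfM !mul1r divfK.
Qed.

Lemma block_weightX k : block_weight k *+ 5 ^ zeros L k <= types%:R^-1.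
Proof. by rewrite block_weightXE ler_piMl ?invr_ge0// lern1 leq_b1. Qed.

Lemma sum_block_weight : \sum_(k < 2 ^ L) block_weight k *+ 5 ^ zeros L k = 1.
Proof.
under eq_bigr do rewrite block_weightXE.
by rewrite -mulr_suml -natr_sum divff// pnatr_eq0 -lt0n; exact: types_gt0.
Qed.

(** Given the earlier blocks, the last block of row digits is [k] with probability
    [block_weight k *+ 5 ^ zeros L k], by [sum_row] whatever the label; so the blocks are
    independent. *)
Lemma weight_step B (G : nat -> nat -> R) :
  \sum_(i < 6 ^ (B.+1 * L)) weight B.+1 i *
    G (i %/ 6 ^ L)%N (rowof LA (B.+1 * L) i %% 2 ^ L)%N =
  \sum_(i < 6 ^ (B * L)) weight B i *
    \sum_(k < 2 ^ L) (block_weight k *+ 5 ^ zeros L k) * G i k.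
Proof.
pose H i := weight B.+1 i * G (i %/ 6 ^ L)%N (rowof LA (B.+1 * L) i %% 2 ^ L)%N.
change (\sum_(i < 6 ^ (B.+1 * L)) H i = \sum_(i < 6 ^ (B * L)) weight B i *
  \sum_(k < 2 ^ L) (block_weight k *+ 5 ^ zeros L k) * G i k).
have -> : (6 ^ (B.+1 * L) = 6 ^ (B * L) * 6 ^ L)%N by rewrite mulSnr expnD.
rewrite (sum_nat_mul _ _ H); apply: eq_bigr => i _.
transitivity (\sum_(c < 6 ^ L) weight B i * (block_weight (rowof (lab LA (B * L) i) L c) *
    G i (rowof (lab LA (B * L) i) L c))).
  apply: eq_bigr => c _; rewrite /H /= mulSnr row_mod.
  rewrite divnMDl ?expn_gt0// (divn_small (ltn_ord c)) addn0 modnMDl.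
  by rewrite (modn_small (ltn_ord c)) mulrA.
rewrite -mulr_sumr (sum_row _ _ (fun k => block_weight k * G i k)).
by congr (_ * _); apply: eq_bigr => k _; rewrite mulrnAl.
Qed.

Lemma sum_weight B : \sum_(i < 6 ^ (B * L)) weight B i = 1.
Proof.
elim: B => [|B IH]; first by rewrite big_ord_recl big_ord0 addr0.
have := weight_step B (fun _ _ => 1).
rewrite (eq_bigr (weight B.+1 \o val)); last by move=> i _; rewrite mulr1.
move=> ->; rewrite -[RHS]IH; apply: eq_bigr => i _.
by rewrite -mulr_suml sum_block_weight !mulr1.
Qed.

Lemma weight_le B i : weight B i <= (types * 5 ^ b)%:R^-1 ^+ B.
Proof.
elim: B i => [|B IH] i /=; first by rewrite expr0.
rewrite exprSr; apply: ler_pM; rewrite ?weight_ge0 ?block_weight_ge0//.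
exact: block_weight_le.
Qed.

(** Each of the first [x] blocks prescribes columns and costs [types^-1 * (5 ^ b)^-1]; the blocks
    from [x] to [y] prescribe row digits only and cost [types^-1]; later blocks are free. The cases
    of the induction ask of which kind the last block is. *)
Lemma mass_cell B x y (i0 k0 : nat) : (x <= y <= B)%N ->
  \sum_(i < 6 ^ (B * L)) weight B i * ((i %/ 6 ^ ((B - x) * L) == i0) &&
     (rowof LA (B * L) i %/ 2 ^ ((B - y) * L) == k0))%N%:R <=
  types%:R^-1 ^+ y * (5 ^+ b)^-1 ^+ x.
Proof.
elim: B x y i0 k0 => [|B IH] x y i0 k0 /andP[xy yB].
  have -> : y = 0%N by lia.
  have -> : x = 0%N by lia.
  by rewrite !expr0 mulr1 big_ord_recl big_ord0 addr0 /= mul1r lern1 leq_b1.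
have iE z i : (z <= B)%N -> (i %/ 6 ^ ((B.+1 - z) * L) =
    (i %/ 6 ^ L) %/ 6 ^ ((B - z) * L))%N.
  by move=> zB; rewrite subSn// mulSn expnD divnMA.
have rE i : (rowof LA (B.+1 * L) i = rowof LA (B * L) (i %/ 6 ^ L) * 2 ^ L +
    rowof LA (B.+1 * L) i %% 2 ^ L)%N.
  rewrite {1}(divn_eq (rowof LA (B.+1 * L) i) (2 ^ L)); congr (_ * _ + _)%N.
  by rewrite mulSnr row_div.
have [yB'|yB'] := leqP y B.
  have xB : (x <= B)%N by lia.
  have := IH x y i0 k0; rewrite xy yB' => /(_ isT); apply: le_trans.
  pose G (i k : nat) := ((i %/ 6 ^ ((B - x) * L) == i0) &&
     (rowof LA (B * L) i %/ 2 ^ ((B - y) * L) == k0))%N%:R : R.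
  rewrite (eq_bigr (fun i : 'I_(6 ^ (B.+1 * L)) => weight B.+1 i *
      G (i %/ 6 ^ L)%N (rowof LA (B.+1 * L) i %% 2 ^ L)%N)).
    rewrite weight_step; apply: ler_sum => i _.
    by rewrite -mulr_suml sum_block_weight mul1r.
  move=> i _; rewrite /G iE//; congr (_ * (_ && _)%:R).
  move: (nat_of_ord i) => {}i; rewrite subSn// [((B - y).+1 * L)%N]mulSn expnD divnMA.
  by rewrite mulSnr row_div.
have {yB yB'} yE : y = B.+1 by lia.
have [xB|xB] := leqP x B; last first.
  have -> : x = B.+1 by lia.
  rewrite yE subnn mul0n !expn0 -exprMn -invfM -natrX -natrM.
  have [i0B|i0B] := ltnP i0 (6 ^ (B.+1 * L)); last first.
    rewrite big1 ?exprn_ge0 ?invr_ge0// => i _; rewrite divn1.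
    by case: eqP => [E|_]; [have := ltn_ord i; lia|rewrite mulr0].
  rewrite (bigD1 (Ordinal i0B))//= big1 ?addr0.
    apply: le_trans (weight_le B.+1 i0); rewrite ler_piMr ?(weight_ge0 B.+1)//.
    by rewrite lern1 leq_b1.
  by move=> i; rewrite -val_eqE /= divn1 => /negbTE ->; rewrite mulr0.
pose G (i k : nat) := ((i %/ 6 ^ ((B - x) * L) == i0) &&
     (rowof LA (B * L) i == k0 %/ 2 ^ L) && (k == k0 %% 2 ^ L))%N%:R : R.
rewrite (eq_bigr (fun i : 'I_(6 ^ (B.+1 * L)) => weight B.+1 i *
      G (i %/ 6 ^ L)%N (rowof LA (B.+1 * L) i %% 2 ^ L)%N)); last first.
  move=> i _; rewrite /G iE// yE subnn mul0n expn0 divn1 -andbA.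
  congr (_ * (_ && _)%:R); rewrite {1}rE.
  set u := rowof _ _ _; set v := (_ %% _)%N.
  have v2 : (v < 2 ^ L)%N by rewrite ltn_pmod// expn_gt0.
  apply/eqP/andP => [<-|[/eqP-> /eqP->]]; last by rewrite -divn_eq.
  by rewrite divnMDl ?expn_gt0// (divn_small v2) addn0 modnMDl (modn_small v2).
rewrite weight_step yE exprS -mulrA.
have := IH x B i0 (k0 %/ 2 ^ L)%N; rewrite xB leqnn subnn => /(_ isT) h.
apply: le_trans (_ : _ <= types%:R^-1 * _) _; last first.
  by apply: ler_wpM2l h; rewrite invr_ge0.
rewrite mulr_sumr; apply: ler_sum => i _; rewrite mulrCA ler_wpM2l ?weight_ge0//.
rewrite mul0n expn0 divn1 /G; set u := (_ && _).
have [k0B|k0B] := boolP u; last first.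
  by rewrite mulr0 big1// => k _; rewrite mulr0.
have k2 : (k0 %% 2 ^ L < 2 ^ L)%N by rewrite ltn_pmod// expn_gt0.
rewrite (bigD1 (Ordinal k2))//= eqxx !mulr1 big1 ?addr0.
  exact: block_weightX.
by move=> k; rewrite -val_eqE /= => /negbTE ->; rewrite mulr0.
Qed.

Definition node (B i : nat) : R := i%:R / 6 ^+ (B * L).

Lemma node01 B i : (i < 6 ^ (B * L))%N -> 0 <= node B i <= 1.
Proof.
move=> iB; rewrite divr_ge0//= ler_pdivrMr ?exprn_gt0// mul1r -natrX ler_nat.
exact: ltnW.
Qed.

(** The factor 15 is 3 columns times 5 rows: the columns are equal or adjacent, and values at most
    one row height apart lie in rows whose indices differ by at most 2, as a value may be on the
    edge of its closed row. *)
Lemma mass_ball B x y i0 : (x <= y <= B)%N -> (i0 < 6 ^ (B * L))%N ->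
  \sum_(i < 6 ^ (B * L)) weight B i *
    ((`|node B i0 - node B i| * 6 ^+ (x * L) <= 1) &&
     (`|curve (node B i0) - curve (node B i)| * 2 ^+ (y * L) <= 1))%:R <=
  15 * (types%:R^-1 ^+ y * (5 ^+ b)^-1 ^+ x).
Proof.
move=> xyB i0B; have [xy yB] := andP xyB.
pose cx i := (i %/ 6 ^ ((B - x) * L))%N.
pose ry i := (rowof LA (B * L) i %/ 2 ^ ((B - y) * L))%N.
apply: (@le_trans _ _ (\sum_(i < 6 ^ (B * L)) weight B i *
   \sum_(a < 3) \sum_(e < 5) ((cx i == cx i0 + a - 1) && (ry i == ry i0 + e - 2))%N%:R)).
  apply: ler_sum => i _; rewrite ler_wpM2l ?weight_ge0//.
  have nn a e : 0 <= ((cx i == cx i0 + a - 1) && (ry i == ry i0 + e - 2))%N%:R :> R by [].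
  case: andP => [[h1 h2]|_]; last by apply: sumr_ge0 => a _; apply: sumr_ge0.
  have t01 := node01 i0B; have s01 := node01 (ltn_ord i).
  have cE j : (j < 6 ^ (B * L))%N -> colof (x * L) (node B j) = cx j.
    move=> jB; have := col_div (x * L) ((B - x) * L) (_ : 0 <= node B j).
    rewrite -mulnDl subnKC; last by lia.
    by rewrite col_frac// => <-//; case/andP: (node01 jB).
  have rE j : (j < 6 ^ (B * L))%N -> frow (y * L) (node B j) = ry j.
    move=> jB; have := frow_div (y * L) ((B - y) * L) (_ : 0 <= node B j).
    rewrite -mulnDl subnKC; last by lia.
    by rewrite /frow col_frac// => <-//; case/andP: (node01 jB).
  have [c1 c2] : (cx i <= (cx i0).+1 /\ cx i0 <= (cx i).+1)%N.
    have p6 : 0 < (6 : R) ^+ (x * L) by rewrite exprn_gt0.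
    move: h1; rewrite -{1}(gtr0_norm p6) -normrM ler_norml mulrBl => /andP[g1 g2].
    by rewrite -!cE//; split; apply: col_close => //; lra.
  have [r1 r2] : (ry i <= (ry i0).+2 /\ ry i0 <= (ry i).+2)%N.
    have p2 : 0 < (2 : R) ^+ (y * L) by rewrite exprn_gt0.
    move: h2; rewrite -{1}(gtr0_norm p2) -normrM ler_norml mulrBl => /andP[g1 g2].
    have /andP[s0 _] := s01; have /andP[t0 _] := t01.
    have := curve_itv (y * L) s0; have := curve_itv (y * L) t0.
    rewrite !rE// => /andP[e1 e2] /andP[e3 e4].
    rewrite -!(ler_nat R); move: e2 e4.
    by rewrite -!(@natr1 R (ry _).+1) -!(@natr1 R (ry _)); split; lra.
  have a3 : (cx i + 1 - cx i0 < 3)%N by lia.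
  have e5 : (ry i + 2 - ry i0 < 5)%N by lia.
  rewrite (bigD1 (Ordinal a3))//= (bigD1 (Ordinal e5))//=.
  have -> : (cx i == cx i0 + (cx i + 1 - cx i0) - 1)%N by apply/eqP; lia.
  have -> : (ry i == ry i0 + (ry i + 2 - ry i0) - 2)%N by apply/eqP; lia.
  rewrite -addrA lerDl addr_ge0// sumr_ge0// => a _.
  by apply: sumr_ge0.
rewrite (eq_bigr (fun i : 'I_(6 ^ (B * L)) => \sum_(a < 3) \sum_(e < 5) weight B i *
    ((cx i == cx i0 + a - 1) && (ry i == ry i0 + e - 2))%N%:R)); last first.
  by move=> i _; rewrite mulr_sumr; apply: eq_bigr => a _; rewrite mulr_sumr.
rewrite exchange_big; set M := _ ^+ y * _.
have -> : 15 * M = \sum_(a < 3) \sum_(e < 5) M.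
  by rewrite !sumr_const !card_ord -mulrnA mulr_natl.
apply: ler_sum => a _; rewrite exchange_big; apply: ler_sum => e _.
exact: mass_cell.
Qed.

End BlockMeasure.

(** The binomial expansion of [(5 ^ tau + 1) ^ L] has [L + 1] terms, indexed by the number [b] of
    zeros; the largest is at least their average. *)
Lemma exists_type (R : realType) (tau : R) (L : nat) : exists b,
  (0 < types L b)%N /\
  (5 `^ tau + 1) ^+ L <= L.+1%:R * ((types L b)%:R * (5 `^ tau) ^+ b).
Proof.
apply: contrapT => H.
have Z0 : 0 < (5 `^ tau + 1) ^+ L by rewrite exprn_gt0// ltr_wpDl// powR_ge0.
have lt b : L.+1%:R * ((types L b)%:R * (5 `^ tau) ^+ b) < (5 `^ tau + 1) ^+ L.
  rewrite ltNge; apply/negP => h; apply: H; exists b; split=> //.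
  rewrite lt0n; apply/eqP => P0; move: h; rewrite P0 mul0r mulr0.
  by apply/negP; rewrite -ltNge.
have : (5 `^ tau + 1) ^+ L = \sum_(b < L.+1) (types L b)%:R * (5 `^ tau) ^+ b.
  rewrite -sum_zeros /types.
  rewrite (eq_bigr (fun b : 'I_L.+1 => \sum_(k < 2 ^ L) (zeros L k == b)%:R * (5 `^ tau) ^+ b)).
    rewrite exchange_big; apply: eq_bigr => k _ /=.
    rewrite (bigD1 (Ordinal (zeros_le L k : (_ < L.+1)%N)))//= eqxx mul1r.
    rewrite big1 ?addr0// => b.
    by rewrite -val_eqE /= eq_sym => /negbTE ->; rewrite mul0r.
  by move=> b _; rewrite natr_sum mulr_suml.
move=> /(congr1 ( *%R L.+1%:R)); rewrite mulr_sumr => /eqP.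
apply/negP; rewrite gt_eqF//.
have -> : L.+1%:R * (5 `^ tau + 1) ^+ L = \sum_(b < L.+1) (5 `^ tau + 1) ^+ L.
  by rewrite sumr_const card_ord mulr_natl.
apply: ltr_sum => //; first by apply/hasP; exists ord0; rewrite ?mem_index_enum.
Qed.

(** * Expected energy on the Brownian graph *)

Section Gaussian.
Context {R : realType}.
Implicit Types (sigma x c r M : R).

Lemma normal_pdf0E sigma x : 0 < sigma -> normal_pdf 0 sigma x =
  normal_peak sigma * expR (- (x ^+ 2 / (sigma ^+ 2 *+ 2))).
Proof.
by move=> s0; rewrite normal_pdfE ?gt_eqF// /normal_fun subr0 mulNr.
Qed.

Lemma normal_peak_le sigma : 0 < sigma -> normal_peak sigma <= sigma^-1.
Proof.
move=> s0; rewrite /normal_peak lef_pV2 ?posrE//; last first.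
  by rewrite sqrtr_gt0 mulrn_wgt0// mulr_gt0 ?pi_gt0// exprn_gt0.
rewrite -[leLHS](gtr0_norm s0) -sqrtr_sqr ler_wsqrtr// -mulrnAr.
rewrite ler_peMr ?sqr_ge0// -mulr_natr.
by have := pi_ge2 R; lra.
Qed.

Lemma normal_peak2 sigma : 0 < sigma ->
  normal_peak sigma = 2 * normal_peak (2 * sigma).
Proof.
move=> s0; rewrite /normal_peak.
have -> : (2 * sigma) ^+ 2 * pi *+ 2 = 2 ^+ 2 * (sigma ^+ 2 * pi *+ 2).
  by rewrite exprMn -mulrnAr -mulrA -mulrnAr.
by rewrite sqrtrM ?sqr_ge0// sqrtr_sqr ger0_norm// invfM mulVKf.
Qed.

Lemma normal_pdf_le1 sigma x : 0 < sigma -> normal_pdf 0 sigma x <= sigma^-1.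
Proof.
move=> s0; rewrite normal_pdf0E//; apply: le_trans (normal_peak_le s0).
by rewrite ler_piMr ?normal_peak_ge0// expR_le1 oppr_le0 divr_ge0 ?sqr_ge0 ?mulrn_wge0 ?sqr_ge0.
Qed.

Lemma normal_pdf_le2 sigma x : 0 < sigma -> x != 0 ->
  normal_pdf 0 sigma x <= `|x|^-1.
Proof.
move=> s0 x0; rewrite normal_pdf0E//; set u := x ^+ 2 / _.
have x0' : 0 < `|x| by rewrite normr_gt0.
have E : 1 + u <= expR u := expR_ge1Dx u.
have uE : u = (`|x| / sigma) ^+ 2 / 2.
  by rewrite /u expr_div_n (real_normK (num_real x)) -mulr_natr; field; rewrite gt_eqF.
set y := `|x| / sigma in uE.
have y0 : 0 < y by rewrite divr_gt0.
have u0 : 0 < expR u by rewrite expR_gt0.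
apply: (@le_trans _ _ (sigma^-1 * expR (- u))).
  by rewrite ler_wpM2r ?expR_ge0// normal_peak_le.
rewrite expRN -invfM lef_pV2 ?posrE ?mulr_gt0//.
have -> : `|x| = sigma * y by rewrite /y mulrC divfK// gt_eqF.
rewrite ler_pM2l//; apply: le_trans E; rewrite uE.
have := sqr_ge0 (y - 1); nra.
Qed.

(** [expR u] is at least [(1 + u / 2) ^ 2], of degree four in the quotient of [|x|] by [sigma],
    which beats the cube. *)
Lemma normal_pdf_le3 sigma x : 0 < sigma -> x != 0 ->
  normal_pdf 0 sigma x <= 3 * sigma ^+ 2 / `|x| ^+ 3.
Proof.
move=> s0 x0; rewrite normal_pdf0E//; set u := x ^+ 2 / _.
have x0' : 0 < `|x| by rewrite normr_gt0.
have E : 1 + u / 2 <= expR (u / 2) := expR_ge1Dx (u / 2).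
have uE : u = (`|x| / sigma) ^+ 2 / 2.
  by rewrite /u expr_div_n (real_normK (num_real x)) -mulr_natr; field; rewrite gt_eqF.
set y := `|x| / sigma in uE.
have y0 : 0 < y by rewrite divr_gt0.
have u0 : 0 < expR u by rewrite expR_gt0.
apply: (@le_trans _ _ (sigma^-1 * expR (- u))).
  by rewrite ler_wpM2r ?expR_ge0// normal_peak_le.
have -> : `|x| = sigma * y by rewrite /y mulrC divfK// gt_eqF.
have -> : 3 * sigma ^+ 2 / (sigma * y) ^+ 3 = sigma^-1 * (3 / y ^+ 3).
  by field; rewrite !gt_eqF.
rewrite ler_pM2l ?invr_gt0// expRN ler_pdivlMr ?exprn_gt0// mulrC.
rewrite ler_pdivrMr//.
have -> : expR u = expR (u / 2) ^+ 2 by rewrite -expRM_natl; congr expR; field.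
have E2 : (1 + u / 2) ^+ 2 <= expR (u / 2) ^+ 2.
  rewrite ler_pXn2r ?nnegrE ?expR_ge0//.
  by rewrite addr_ge0// uE divr_ge0// divr_ge0// sqr_ge0.
apply: (@le_trans _ _ (3 * (1 + u / 2) ^+ 2)); last by rewrite ler_pM2l.
rewrite uE.
have h : 0 <= (y ^+ 2 / 4 - y) ^+ 2 by exact: sqr_ge0.
have h2 : 0 <= (y ^+ 2 / 4 - 1) ^+ 2 by exact: sqr_ge0.
have h3 : 0 <= y ^+ 3 by rewrite exprn_ge0// ltW.
have h4 : 0 <= y ^+ 4 by rewrite exprn_ge0// ltW.
have h5 : 0 <= y ^+ 2 by rewrite exprn_ge0// ltW.
move: h h2; rewrite !sqrrB !exprMn => h h2; nra.
Qed.

Lemma measurable_shift_ball c r : measurable [set x | `|x + c| <= r].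
Proof.
have -> : [set x | `|x + c| <= r] = `[- c - r, - c + r]%classic.
  apply/seteqP; split=> x /=; rewrite in_itv /= ler_norml => /andP[? ?];
    by apply/andP; split; lra.
exact: measurable_itv.
Qed.

Lemma normal_prob_ball sigma c r M : 0 < sigma -> 0 <= r -> 0 <= M ->
  (forall x, `|x + c| <= r -> normal_pdf 0 sigma x <= M) ->
  (normal_prob 0 sigma [set x | `|x + c| <= r]%R <= (2 * r * M)%:E)%E.
Proof.
move=> s0 r0 M0 h; rewrite /normal_prob.
have mD := measurable_shift_ball c r.
apply: (@le_trans _ _ (\int[lebesgue_measure]_(x in [set x | (`|x + c| <= r)%R]) (cst M%:E) x)%E).
  apply: ge0_le_integral => //= [x _|]; first by rewrite lee_fin normal_pdf_ge0.
  by apply/measurable_EFinP; apply: measurable_funTS; exact: measurable_normal_pdf.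
rewrite integral_cst//.
have -> : [set x | `|x + c| <= r] = `[- c - r, - c + r]%classic.
  apply/seteqP; split=> x /=; rewrite in_itv /= ler_norml => /andP[? ?];
    by apply/andP; split; lra.
rewrite /= lebesgue_measure_itv /= lte_fin; case: ifPn => [_|].
  by rewrite -EFinB -EFinM lee_fin; lra.
by rewrite mule0 lee_fin !mulr_ge0.
Qed.

(** The density is compared with that of standard deviation [2 * sigma]: on the tail their quotient
    is at most the right-hand side, and the wider law has mass at most 1 there. *)
Lemma normal_prob_tail sigma (a : R) : 0 < sigma -> 0 <= a ->
  (normal_prob 0 sigma [set x | a <= `|x|]%R <=
    (2 * expR (- (a ^+ 2 / (sigma ^+ 2 * 4))))%:E)%E.
Proof.
move=> s0 a0.
have mD : measurable [set x : R | a <= `|x|].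
  have mn : measurable_fun [set: R] (fun x : R => `|x|) by exact: normr_measurable.
  have := mn measurableT _ (measurable_itv `[a, +oo[%R); rewrite setTI.
  by congr measurable; apply/seteqP; split=> x /=; rewrite in_itv /= andbT.
have s20 : 0 < 2 * sigma by rewrite mulr_gt0.
set k := 2 * expR _.
apply: (@le_trans _ _ (k%:E * normal_prob 0 (2 * sigma) [set x | a <= `|x|]%R)%E); last first.
  rewrite -[leRHS]mule1 lee_wpmul2l ?lee_fin ?mulr_ge0 ?expR_ge0//.
  exact: probability_le1.
rewrite /normal_prob -ge0_integralZl_EFin//; first last.
- by rewrite mulr_ge0 ?expR_ge0.
- by apply/measurable_EFinP; apply: measurable_funTS; exact: measurable_normal_pdf.
- by move=> x _; rewrite lee_fin normal_pdf_ge0.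
apply: ge0_le_integral => //=.
- by move=> x _; rewrite lee_fin normal_pdf_ge0.
- by apply/measurable_EFinP; apply: measurable_funTS; exact: measurable_normal_pdf.
- apply/measurable_EFinP; apply: measurable_funTS; apply: measurable_funM => //.
  exact: measurable_normal_pdf.
move=> x ax; rewrite lee_fin !normal_pdf0E// (normal_peak2 s0) -mulrA.
have -> : k * (normal_peak (2 * sigma) * expR (- (x ^+ 2 / ((2 * sigma) ^+ 2 *+ 2)))) =
  2 * (normal_peak (2 * sigma) * expR (- (a ^+ 2 / (sigma ^+ 2 * 4)) - x ^+ 2 / ((2 * sigma) ^+ 2 *+ 2))).
  by rewrite expRD /k; ring.
rewrite ler_wpM2l// ler_wpM2l ?normal_peak_ge0// ler_expR.
have ax2 : a ^+ 2 <= x ^+ 2 by rewrite -(real_normK (num_real x)) ler_pXn2r ?nnegrE.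
have -> : x ^+ 2 / ((2 * sigma) ^+ 2 *+ 2) = x ^+ 2 / sigma ^+ 2 / 8.
  by rewrite -mulr_natr; field; rewrite gt_eqF.
have -> : x ^+ 2 / (sigma ^+ 2 *+ 2) = x ^+ 2 / sigma ^+ 2 / 2.
  by rewrite -mulr_natr; field; rewrite gt_eqF.
have -> : a ^+ 2 / (sigma ^+ 2 * 4) = a ^+ 2 / sigma ^+ 2 / 4.
  by field; rewrite gt_eqF.
have : a ^+ 2 / sigma ^+ 2 <= x ^+ 2 / sigma ^+ 2.
  by rewrite ler_wpM2r// invr_ge0 sqr_ge0.
have : 0 <= a ^+ 2 / sigma ^+ 2 by rewrite divr_ge0 ?sqr_ge0.
lra.
Qed.

End Gaussian.

(** * Mass of close pairs at geometric scales *)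

Section Scales.
Context {R : realType}.

Lemma powRVN (x a : R) : 0 <= x -> x^-1 `^ (- a) = x `^ a.
Proof. by move=> x0; rewrite -powR_inv1// -powRrM mulN1r opprK. Qed.

(** Bernoulli's inequality for [Num.sqrt x], once squared, grows quadratically in [L]. *)
Lemma exists_expr_gt (x : R) : 1 < x -> exists L, L.+1%:R < x ^+ L.
Proof.
move=> x1; pose y := Num.sqrt x.
have y1 : 1 < y by rewrite -sqrtr1 ltr_sqrt// (lt_trans _ x1).
have x0 : 0 <= x by rewrite ltW// (lt_trans _ x1).
pose h := y - 1; have h0 : 0 < h by rewrite subr_gt0.
have ber L : 1 + L%:R * h <= y ^+ L.
  elim: L => [|L IH]; first by rewrite mul0r addr0.
  rewrite exprSr; apply: (@le_trans _ _ ((1 + L%:R * h) * y)).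
    have -> : y = 1 + h by rewrite /h; ring.
    by rewrite -natr1; have : 0 <= L%:R * h ^+ 2 :> R by [rewrite mulr_ge0// sqr_ge0]; lra.
  by rewrite ler_wpM2r// ltW// (lt_trans _ y1).
pose L := (Num.truncn (h ^- 2)).+1; exists L.
have Lh : 1 < L%:R * h ^+ 2.
  by rewrite -ltr_pdivrMr ?exprn_gt0// mul1r truncnS_gt.
rewrite -(sqr_sqrtr x0) -/y -exprM mulnC exprM.
apply: (@lt_le_trans _ _ ((1 + L%:R * h) ^+ 2)).
  have L1 : 1 <= L%:R :> R by rewrite ler1n.
  have : L%:R * 1 < L%:R * (L%:R * h ^+ 2) by rewrite ltr_pM2l// (lt_le_trans _ L1).
  have : 0 <= L%:R * h by rewrite mulr_ge0// ltW.
  by rewrite -natr1; lra.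
rewrite ler_pXn2r ?nnegrE//; first by rewrite addr_ge0// mulr_ge0// ltW.
by rewrite exprn_ge0// ltW// (lt_trans _ y1).
Qed.

Variables (tau : R) (L b : nat).
Hypothesis tau01 : 0 < tau <= 1.
Hypothesis types_gt0 : (0 < types L b)%N.

Let u : R := 6 `^ tau.
Let q : R := (types L b)%:R * (5 `^ tau) ^+ b.

(** Scale [y] counts blocks: the nodes are within [6 ^ (- tau L y)] in time and [2 ^ (- L y)] in
    space. For tau = 2 theta the first is the square of the second. *)
Definition close_pair (B y i j : nat) : bool :=
  (`|node L B i - node L B j| * (u ^+ L) ^+ y <= 1) &&
  (`|curve (node L B i : R) - curve (node L B j : R)| * (2 ^+ L) ^+ y <= 1).

Lemma q_gt0 : 0 < q.
Proof. by rewrite mulr_gt0 ?ltr0n// exprn_gt0// powR_gt0. Qed.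

(** [mass_ball] is applied with [floor (tau y)] blocks of columns; rounding loses less than one
    block, which costs the factor [5 ^ b]. *)
Lemma mass_scale B y i0 : (y <= B)%N -> (i0 < 6 ^ (B * L))%N ->
  \sum_(i < 6 ^ (B * L)) weight L b B i * (close_pair B y i0 i)%:R <=
  15 * 5 ^+ b * q^-1 ^+ y.
Proof.
move=> yB i0B; have /andP[t0 t1] := tau01.
pose x := Num.truncn (tau * y%:R).
have xy : (x <= y)%N.
  rewrite -(ler_nat R) (@le_trans _ _ (tau * y%:R))//.
    by rewrite truncn_le mulr_ge0// ltW.
  by rewrite ler_piMl.
have ty0 : 0 <= tau * y%:R by rewrite mulr_ge0// ltW.
have /andP[x1 x2] := truncn_itv ty0.
have ux : 6 ^+ (x * L) <= (u ^+ L) ^+ y.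
  rewrite exprM [leRHS]exprAC lerXn2r ?nnegrE ?exprn_ge0 ?powR_ge0//.
  rewrite -!powR_mulrn ?powR_ge0// -powRrM; apply: ler_powR => //.
  by rewrite ler1n.
apply: (@le_trans _ _ (15 * ((types L b)%:R^-1 ^+ y * (5 ^+ b)^-1 ^+ x))).
  apply: le_trans (mass_ball types_gt0 _ i0B); last by rewrite xy.
  apply: ler_sum => i _; rewrite ler_wpM2l ?weight_ge0// ler_nat.
  rewrite /close_pair; case: andP => [[h1 h2]|//]; case: andP => //; case; split.
    by apply: le_trans h1; rewrite ler_wpM2l.
  by rewrite exprM exprAC.
rewrite -mulrA ler_pM2l// /q invfM exprMn mulrCA ler_wpM2l ?exprn_ge0 ?invr_ge0//.
rewrite !exprVn -exprM -(exprM (5 `^ tau)) mulnC (mulnC b) !exprM -exprVn.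
rewrite -ler_pdivrMl ?exprn_gt0// -!exprVn -exprMn.
apply: lerXn2r; rewrite ?nnegrE ?mulr_ge0 ?invr_ge0 ?exprn_ge0 ?invr_ge0 ?powR_ge0//.
rewrite !exprVn -invfM lef_pV2 ?posrE ?mulr_gt0 ?exprn_gt0 ?powR_gt0//.
rewrite -exprS -!powR_mulrn ?powR_ge0// -powRrM; apply: ler_powR; first by rewrite ler1n.
exact: ltW.
Qed.

Lemma pair_scale B y : (y <= B)%N ->
  \sum_(i < 6 ^ (B * L)) \sum_(j < 6 ^ (B * L))
    weight L b B i * weight L b B j * (close_pair B y i j)%:R <=
  15 * 5 ^+ b * q^-1 ^+ y.
Proof.
move=> yB; rewrite -[leRHS]mul1r -[X in X * _](sum_weight types_gt0 B) mulr_suml.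
apply: ler_sum => i _.
rewrite (eq_bigr (fun j : 'I_(6 ^ (B * L)) => weight L b B i *
   (weight L b B j * (close_pair B y i j)%:R))); last by move=> j _; rewrite mulrA.
by rewrite -mulr_sumr ler_wpM2l ?weight_ge0// mass_scale.
Qed.

Lemma sum_geometric_le1 (x : R) k : 0 <= x < 1 ->
  \sum_(i < k) x ^+ i <= (1 - x)^-1.
Proof.
move=> x01; have := sum_geometric_le 0 k (ler01 : 0 <= 1 :> R) x01.
rewrite big_mkord expr0 !mul1r; apply: le_trans.
by apply: ler_sum => i _; rewrite mul1r.
Qed.

End Scales.

(** * Lower bound for the graph of f *)

Section CurveLower.
Context {R : realType}.

Lemma theta_lt : theta R < 2^-1.
Proof.
rewrite /theta ltr_pdivrMr ?ln6_gt0//.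
have : ln (2 ^+ 2 : R) < ln 6 by rewrite ltr_ln ?posrE//; lra.
by rewrite lnXn// -mulr_natr; lra.
Qed.

Lemma curve_continuous : {within `[0, 1], continuous (@curve R)}.
Proof.
apply/subspace_continuousP => x; rewrite /= in_itv01 => x01.
apply/cvgrPdist_lt => e e0.
have [j je] : exists j, 2 / 2 ^+ j < e.
  exists (Num.truncn (2 / e)).+1.
  rewrite ltr_pdivrMr ?exprn_gt0// mulrC -ltr_pdivrMr//.
  by apply: lt_trans (truncnS_gt _) _; rewrite -natrX ltr_nat ltn_expl.
have p : 0 < ((6 : R) ^+ j)^-1 by rewrite invr_gt0 exprn_gt0.
have : \forall y \near x, `|x - y| < ((6 : R) ^+ j)^-1.
  by have /cvgrPdist_lt/(_ _ p) := @cvg_id R (nbhs x).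
rewrite near_withinE; apply: filterS => y xy; rewrite /= in_itv01 => y01.
apply: le_lt_trans je; rewrite ler_pdivlMr ?exprn_gt0//.
by apply: curve_close => //; rewrite -ler_pdivlMr ?exprn_gt0// mul1r ltW.
Qed.

(* Blocks of [L] levels whose row digits have a prescribed number of zeros
   give a measure with the optimal exponent up to a factor [L + 1]. *)
Lemma block_choice (tau h : R) : 0 < h < 5 `^ tau + 1 ->
  exists L b, [/\ (0 < L)%N, (0 < types L b)%N &
    h ^+ L < (types L b)%:R * (5 `^ tau) ^+ b].
Proof.
move=> /andP[h0 hZ]; have /exists_expr_gt[L LZ] : 1 < (5 `^ tau + 1) / h.
  by rewrite ltr_pdivlMr// mul1r.
have [b [tb hb]] := exists_type tau L; exists L, b; split=> //.
  by case: L LZ {tb hb} => //; rewrite expr0 ltxx.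
have L0 : 0 < L.+1%:R :> R by [].
rewrite -(ltr_pM2l L0); apply: lt_le_trans hb.
by move: LZ; rewrite expr_div_n ltr_pdivlMr// exprn_gt0.
Qed.

Lemma curve_hausdorff_lower (gam s : R) : 2 `^ gam < 5 `^ theta R + 1 ->
  0 < s <= gam -> hausdorff_measure s (graph (@curve R)) <> 0%E.
Proof.
move=> hg s01; have th01 : 0 < theta R <= 1.
  by rewrite theta_gt0; have := theta_lt; lra.
have [|L [b [L0 tb hq]]] := @block_choice (theta R) (2 `^ gam).
  by rewrite powR_gt0.
set q := (X in _ < X) in hq.
have q0 : 0 < q := q_gt0 (theta R) tb.
(* The ratio of the geometric series that bounds the energy over the scales [2 ^ (- L k)]. *)
pose x := (2 `^ gam) ^+ L / q.
have x01 : 0 <= x < 1.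
  by rewrite divr_ge0 ?exprn_ge0 ?powR_ge0 ?(ltW q0)//= ltr_pdivrMr// mul1r.
have H1 : 1 < (2 : R) ^+ L by rewrite exprn_egt1// ?ltr1n// -lt0n.
have H0 : 0 < (2 : R) ^+ L by rewrite exprn_gt0.
apply: (@hausdorff_energy _ _ gam (2 ^+ L)^-1 (15 * 5 ^+ b * (1 - x)^-1) s
  (fun N => 6 ^ (N * L))%N id (node L) (weight L b)) => //.
- exact: curve_continuous.
- by rewrite invr_gt0 H0 invf_lt1.
- by move=> N i; exact: node01.
- by move=> N i; exact: weight_ge0.
- by move=> N; exact: sum_weight.
move=> K; exists K => //; rewrite /energy.
apply: (@le_trans _ _ (\sum_(k < K.+1) 15 * 5 ^+ b * x ^+ k)); last first.
  by rewrite -mulr_sumr ler_wpM2l ?mulr_ge0 ?exprn_ge0// sum_geometric_le1.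
apply: ler_sum => k _.
have -> : ((2 ^+ L)^-1 ^+ k) `^ (- gam) = ((2 `^ gam) ^+ L) ^+ k :> R.
  by rewrite exprVn powRVN ?exprn_ge0// !powR_exprn// exprn_ge0.
rewrite /x expr_div_n mulrCA ler_wpM2l ?exprn_ge0 ?powR_ge0//.
have kK : (k <= K)%N by rewrite -ltnS.
apply: le_trans (_ : _ <= 15 * 5 ^+ b * q^-1 ^+ k) _; last by rewrite exprVn.
apply: le_trans (pair_scale th01 tb kK).
apply: ler_sum => i _; apply: ler_sum => j _.
rewrite ler_wpM2l ?mulr_ge0 ?weight_ge0// /close_pair powR6_theta.
have p k' : 0 < ((2 : R) ^+ L) ^+ k' by rewrite !exprn_gt0.
by rewrite exprVn -!(ler_pdivlMr _ _ (p k)) !div1r.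
Qed.

End CurveLower.

Section Expectation.
Context {d} {T : measurableType d} {R : realType} (P : probability T R).

Lemma ae_frequently_bounded (g : nat -> T -> R) (C : R) :
  (forall N, measurable_fun setT (g N)) -> (forall N w, 0 <= g N w) ->
  (forall N, (\int[P]_w (g N w)%:E <= C%:E)%E) ->
  {ae P, forall w, exists C', forall K, exists2 N, (K <= N)%N & g N w <= C'}.
Proof.
move=> mg g0 gC; pose f N w := (g N w)%:E.
have mf N : measurable_fun setT (f N) by apply/measurable_EFinP.
have f0 N w : setT w -> (0 <= f N w)%E by rewrite lee_fin.
have lf : (\int[P]_w limn_einf (f^~ w) <= C%:E)%E.
  apply: le_trans (fatou P measurableT mf f0) _.
  rewrite limn_einf_lim; apply: lime_le; first exact: is_cvg_einfs.
  apply: nearW => n; apply: le_trans (gC n).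
  by apply: ereal_inf_lbound; exists n => //=.
have l0 w : (0 <= limn_einf (f^~ w))%E.
  rewrite limn_einf_lim; apply: lime_ge; first exact: is_cvg_einfs.
  apply: nearW => n; apply: le_ereal_inf_tmp => _ [k _ <-]; exact: f0.
have fint : P.-integrable setT (fun w => limn_einf (f^~ w)).
  apply/integrableP; split.
    apply: (@measurableT_comp _ _ _ _ _ _ -%E _ (fun w => limn_esup (fun n => - f n w)%E)) => //.
    by apply: (@measurable_fun_limn_esup _ _ _ _ (fun n w => - f n w)%E) => n; exact: measurableT_comp.
  under eq_integral do rewrite gee0_abs//.
  by apply: le_lt_trans lf _; rewrite ltry.
have := integrable_ae measurableT fint.
apply: filterS => w /(_ I) fw.
(* The lower limit is almost surely finite; if the claim failed, all late terms would exceed it by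
   1. *)
exists (fine (limn_einf (f^~ w)) + 1); apply: contrapT => /existsNP[K hK].
have : ((fine (limn_einf (f^~ w)) + 1)%:E <= limn_einf (f^~ w))%E.
  rewrite {2}limn_einf_lim; apply: lime_ge; first exact: is_cvg_einfs.
  near=> n; apply: le_ereal_inf_tmp => _ [k /= nk <-].
  rewrite /f lee_fin leNgt; apply/negP => /ltW h; apply: hK; exists k => //.
  by apply: leq_trans nk; near: n; exists K.
by rewrite -{2}(fineK fw) lee_fin gerDl leNgt ltr01.
Unshelve. all: by end_near. Qed.

Lemma integral_indic_sum (I : finType) (c v : I -> R) (E : I -> set T) :
  (forall i, 0 <= c i) -> (forall i, measurable (E i)) ->
  (forall i, ((c i)%:E * P (E i) <= (v i)%:E)%E) ->
  (\int[P]_w (\sum_i c i * \1_(E i) w)%:E <= (\sum_i v i)%:E)%E.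
Proof.
move=> c0 mE cv.
have m1 i : measurable_fun setT (fun w => (\1_(E i) w : R)%:E).
  by apply/measurable_EFinP; exact: measurable_indic.
under eq_integral do rewrite -sumEFin.
rewrite ge0_integral_sum//=.
- rewrite -sumEFin; apply: lee_sum => i _.
  under eq_integral do rewrite EFinM.
  by rewrite ge0_integralZl_EFin// integral_indic// setIT.
- by move=> i; apply/measurable_EFinP; apply: measurable_funM => //; exact: measurable_indic.
- by move=> i w _; rewrite lee_fin mulr_ge0.
Qed.

End Expectation.

(** * Probability that two nodes are close on the Brownian graph *)

Section BrownianPairs.
Context {d} {T : measurableType d} {R : realType} (P : probability T R).
Variable B : R -> {RV P >-> R}.
Hypothesis gB : gaussian_increments B.

(** The Gaussian law is given for increasing times only; reversing a pair changes the sign of the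
    shift. *)
Lemma increment_prob (s t c r : R) : 0 <= s -> 0 <= t -> s != t ->
  exists2 c', `|c'| = `|c| &
  P [set w | `|B s w - B t w + c| <= r] =
  normal_prob 0 (Num.sqrt `|s - t|) [set x | `|x + c'| <= r].
Proof.
move=> s0 t0 st; have [ts|st'] := ltP t s.
  exists c => //; rewrite (gtr0_norm (_ : 0 < s - t)) ?subr_gt0//.
  by rewrite -gB//; exact: measurable_shift_ball.
have {st st'} st : s < t by rewrite lt_neqAle st.
exists (- c); first by rewrite normrN.
rewrite (ltr0_norm (_ : s - t < 0)) ?subr_lt0// opprB.
rewrite -gB//; last exact: measurable_shift_ball.
by congr (P _); apply/seteqP; split=> w /=; rewrite -normrN; congr (`|_| <= _); ring.
Qed.

Lemma increment_prob_le1 (s t c r : R) : 0 <= s -> 0 <= t -> s != t -> 0 <= r ->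
  (P [set w | `|B s w - B t w + c| <= r]%R <=
    (2 * r * (Num.sqrt `|s - t|)^-1)%:E)%E.
Proof.
move=> s0 t0 st r0; have [c' _ ->] := increment_prob c r s0 t0 st.
have sg : 0 < Num.sqrt `|s - t| by rewrite sqrtr_gt0 normr_gt0 subr_eq0.
apply: normal_prob_ball => //.
by move=> x _; exact: normal_pdf_le1.
Qed.

Lemma far_from_0 (c x r : R) : 0 < `|c| -> 2 * r <= `|c| -> `|x + c| <= r ->
  x != 0 /\ `|x|^-1 <= 2 / `|c|.
Proof.
move=> c0 cr xr.
have h : `|c| / 2 <= `|x|.
  by have := ler_normB (x + c) x; rewrite addrAC subrr add0r; lra.
have x0 : 0 < `|x| by apply: lt_le_trans h; rewrite divr_gt0.
split; first by rewrite -normr_gt0.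
by rewrite -[leRHS]invrK lef_pV2 ?posrE ?invr_gt0 ?divr_gt0// invf_div.
Qed.

Lemma increment_prob_le2 (s t c r : R) : 0 <= s -> 0 <= t -> s != t -> 0 <= r ->
  0 < `|c| -> 2 * r <= `|c| ->
  (P [set w | `|B s w - B t w + c| <= r]%R <= (4 * r / `|c|)%:E)%E.
Proof.
move=> s0 t0 st r0 c0 cr; have [c' c'E ->] := increment_prob c r s0 t0 st.
rewrite -c'E in c0 cr *.
have sg : 0 < Num.sqrt `|s - t| by rewrite sqrtr_gt0 normr_gt0 subr_eq0.
have -> : 4 * r / `|c'| = 2 * r * (2 / `|c'|) by field; rewrite gt_eqF.
apply: normal_prob_ball => //.
move=> x /(far_from_0 c0 cr)[x0 xc]; apply: le_trans xc.
exact: normal_pdf_le2.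
Qed.

Lemma increment_prob_le3 (s t c r : R) : 0 <= s -> 0 <= t -> s != t -> 0 <= r ->
  0 < `|c| -> 2 * r <= `|c| ->
  (P [set w | `|B s w - B t w + c| <= r]%R <=
     (48 * r * `|s - t| / `|c| ^+ 3)%:E)%E.
Proof.
move=> s0 t0 st r0 c0 cr; have [c' c'E ->] := increment_prob c r s0 t0 st.
rewrite -c'E in c0 cr *.
have sg : 0 < Num.sqrt `|s - t| by rewrite sqrtr_gt0 normr_gt0 subr_eq0.
have -> : 48 * r * `|s - t| / `|c'| ^+ 3 = 2 * r * (3 * `|s - t| * (2 / `|c'|) ^+ 3).
  by field; rewrite gt_eqF.
apply: normal_prob_ball => //.
move=> x /(far_from_0 c0 cr)[x0 xc]; apply: le_trans (normal_pdf_le3 sg x0) _.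
rewrite sqr_sqrtr// ler_wpM2l ?mulr_ge0// -exprVn lerXn2r ?nnegrE ?invr_ge0//.
Qed.

End BrownianPairs.

Lemma sum_two_sided (R : realType) (m : R) (k n : nat) : 0 <= m < 1 ->
  \sum_(y < n) (if (k <= y)%N then m ^+ (y - k) else m ^+ (k - y)) <=
  2 / (1 - m).
Proof.
move=> /andP[m0 m1]; have d0 : 0 < 1 - m by rewrite subr_gt0.
(* The induction needs a bound that follows [n]: the first summand accounts for the rising terms
   before [k], the second for the falling ones from [k] on. *)
suff H : \sum_(y < n) (if (k <= y)%N then m ^+ (y - k) else m ^+ (k - y)) <=
    (m ^+ (k - n).+1 + (if (k <= n)%N then 1 - m ^+ (n - k) else 0)) / (1 - m).
  apply: le_trans H _; rewrite ler_wpM2r ?invr_ge0 ?(ltW d0)//.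
  have : m ^+ (k - n).+1 <= 1 by rewrite exprn_ile1 ?(ltW m1).
  have : 0 <= m ^+ (n - k) by rewrite exprn_ge0.
  by case: ifP; lra.
elim: n => [|n IH].
  rewrite big_ord0 divr_ge0 ?(ltW d0)// addr_ge0 ?exprn_ge0//.
  by case: ifP => //; rewrite subr_ge0 exprn_ile1 ?(ltW m1).
rewrite big_ord_recr /=; apply: le_trans (lerD IH (lexx _)) _.
rewrite ler_pdivlMr// mulrDl divfK ?gt_eqF//.
have [kn|nk] := leqP k n.
  rewrite (leq_trans kn (leqnSn n)) subSn// !exprS.
  have -> : (k - n = 0)%N by lia. have -> : (k - n.+1 = 0)%N by lia.
  by lra.
have [kn1|kn1] := leqP k n.+1.
  have -> : (k - n = 1)%N by lia. have -> : (k - n.+1 = 0)%N by lia.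
  have -> : (n.+1 - k = 0)%N by lia.
  by rewrite !exprS !expr0; lra.
have -> : (k - n = (k - n.+1).+1)%N by lia.
by rewrite !exprS addr0 addr0; have := sqr_ge0 m; lra.
Qed.

Section BrownianEnergy.
Context {d} {T : measurableType d} {R : realType} (P : probability T R).
Variable B : R -> {RV P >-> R}.
Hypothesis gB : gaussian_increments B.
Variables (L b : nat).
Hypothesis L_gt0 : (0 < L)%N.
Hypothesis types_gt0 : (0 < types L b)%N.

Let tau : R := 2 * theta R.
Let H : R := 2 ^+ L.
Let q : R := (types L b)%:R * (5 `^ tau) ^+ b.
Let rho : R := (H ^+ 2)^-1.

Lemma powR6_2theta : 6 `^ tau = 4 :> R.
Proof.
rewrite /tau mulrC powRrM powR6_theta.
by rewrite powR_mulrn//; lra.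
Qed.

Lemma tau01 : 0 < tau <= 1.
Proof. by have := @theta_gt0 R; have := @theta_lt R; rewrite /tau; lra. Qed.

Lemma expr2L_ge2 : 2 <= H.
Proof. by rewrite /H -[leLHS]expr1 ler_weXn2l// ler1n. Qed.

Lemma types_le (x : R) : 0 <= x -> (types L b)%:R * x ^+ b <= (x + 1) ^+ L.
Proof.
move=> x0; rewrite -sum_zeros /types natr_sum mulr_suml; apply: ler_sum => k _.
by case: eqP => [->|_]; rewrite ?mul1r// mul0r exprn_ge0.
Qed.

(** Here [5 ^ tau + 1 <= 6 < 8]. It makes the scales [y < k] summable in [sum_scale_prob]. *)
Lemma q_lt_H3 : q < H ^+ 3.
Proof.
apply: le_lt_trans (types_le (powR_ge0 _ _)) _.
rewrite /H exprAC ltrXn2r ?nnegrE ?addr_ge0 ?powR_ge0 ?exprn_ge0//.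
  by rewrite -lt0n.
have : 5 `^ tau <= 5 `^ 1 :> R.
  by apply: ler_powR; [rewrite ler1n|case/andP: tau01].
by rewrite powRr1//; lra.
Qed.

(* For nodes separated in time by [H ^ (- 2 (y + 1))] or in space by
   [H ^ (- (y + 1))], the density of the path difference near 0 is at most
   [1 / sigma] or [1 / D], which gives the first bound; when [y < k] only a
   separation in space is possible, and the Gaussian tail
   [sigma ^ 2 / D ^ 3] gives the second. *)
Definition scale_prob (N k y : nat) : R :=
  if y == N then 1 else
  if (k <= y)%N then 4 * rho ^+ k * H ^+ y.+1
  else 48 * (rho ^+ k) ^+ 2 * (H ^+ y.+1) ^+ 3.

Lemma scale_prob_ge0 N k y : 0 <= scale_prob N k y.
Proof.
have := expr2L_ge2 => H2; have H0 : 0 <= H by lra.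
have r0 : 0 <= rho by rewrite invr_ge0 exprn_ge0.
by rewrite /scale_prob; do 2 case: ifP => _ //; rewrite !mulr_ge0// ?exprn_ge0// ?exprn_ge0.
Qed.

Lemma last_scale (p : pred nat) N : p 0%N ->
  exists y, [/\ (y <= N)%N, p y & (y == N) || ~~ p y.+1].
Proof.
move=> p0; elim: N => [|N [y [yN py /orP[/eqP yE|npy]]]]; first by exists 0%N.
  subst y; case: (boolP (p N.+1)) => h; first by exists N.+1; rewrite eqxx.
  by exists N; rewrite h orbT.
by exists y; rewrite npy orbT (leq_trans yN).
Qed.

(** At some [y] the pair is close but no longer so at [y + 1], and that separation bounds the
    probability by [scale_prob N k y]; if [y = N], the bound is 1. Summing over all [y] leaves
    products of a number and an indicator, to which [pair_scale] applies. *)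
Lemma pair_prob N k i j : (i < 6 ^ (N * L))%N -> (j < 6 ^ (N * L))%N ->
  `|node L N i - node L N j| <= rho ^+ k ->
  (P [set w | `|B (node L N i) w - B (node L N j) w +
        (curve (node L N i) - curve (node L N j))| <= rho ^+ k]%R <=
   (\sum_(y < N.+1) scale_prob N k y * (close_pair tau L N y i j)%:R)%:E)%E.
Proof.
move=> iN jN dk; have H2 := expr2L_ge2; have H0 : 0 < H by lra.
have /andP[i0 i1] := @node01 R L N i iN; have /andP[j0 j1] := @node01 R L N j jN.
set s := node L N i in dk i0 i1 *; set t := node L N j in dk j0 j1 *.
have r0 : 0 < rho by rewrite invr_gt0 exprn_gt0.
have rk : 0 < rho ^+ k by rewrite exprn_gt0.
set ev := P _.
have ev1 : (ev <= 1)%E.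
  apply: probability_le1; rewrite -[X in measurable X]setTI.
  have m : measurable_fun setT (fun w => B s w - B t w).
    exact: measurable_funB.
  exact: (m measurableT _ (measurable_shift_ball (curve s - curve t) (rho ^+ k))).
have c0 : close_pair tau L N 0 i j.
  rewrite /close_pair !expr0 !mulr1 -/s -/t.
  have /andP[a1 a2] := @curve01 R s (introT andP (conj i0 i1)).
  have /andP[b1 b2] := @curve01 R t (introT andP (conj j0 j1)).
  by rewrite !ler_norml; apply/andP; split; apply/andP; split; lra.
have [y [yN cy far]] := last_scale N (p := fun y => close_pair tau L N y i j) c0.
apply: le_trans (_ : (_ <= (scale_prob N k y)%:E)%E) _; last first.
  rewrite lee_fin (bigD1 (Ordinal (yN : y < N.+1)%N))//= cy mulr1 lerDl.
  by apply: sumr_ge0 => z _; rewrite mulr_ge0// scale_prob_ge0.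
rewrite /scale_prob; have [//|yneN] := eqVneq y N.
move: far; rewrite (negbTE yneN) /= /close_pair -/s -/t powR6_2theta => far.
have st : s != t.
  by apply/eqP => st; move: far; rewrite st !subrr !normr0 !mul0r ler01.
have dst : 0 < `|s - t| by rewrite normr_gt0 subr_eq0.
set Hy := H ^+ y.+1.
have Hy0 : 0 < Hy by rewrite exprn_gt0.
have E4 : (4 ^+ L) ^+ y.+1 = Hy ^+ 2.
  have -> : 4 = 2 ^+ 2 :> R by rewrite expr2; lra.
  rewrite /Hy /H -(exprM 2 2 L) -(exprM 2 _ y.+1) -(exprM 2 L) -(exprM 2 _ 2).
  by rewrite -mulnA [(2 * (_ * _))%N]mulnC.
rewrite E4 -/H -/Hy negb_and -!ltNge in far.
set D := `|curve s - curve t| in far *.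
have D0 : 0 <= D by exact: normr_ge0.
have [ky|yk] := leqP k y.
  have [far1|] := orP far.
    apply: le_trans (increment_prob_le1 gB _ i0 j0 st (ltW rk)) _.
    rewrite lee_fin.
    have sH : (Num.sqrt `|s - t|)^-1 <= Hy.
      rewrite -[leRHS]invrK lef_pV2 ?posrE ?invr_gt0 ?sqrtr_gt0//.
      rewrite -[leLHS](gtr0_norm (_ : 0 < Hy^-1)) ?invr_gt0// -sqrtr_sqr.
      rewrite ler_wsqrtr// exprVn -[leLHS]mul1r ler_pdivrMr ?exprn_gt0//.
      exact: ltW.
    apply: (@le_trans _ _ (2 * rho ^+ k * Hy)).
      by rewrite ler_wpM2l ?mulr_ge0 ?(ltW rk).
    by rewrite ler_wpM2r ?(ltW Hy0)// ler_wpM2r ?(ltW rk)//; lra.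
  move=> far2; have Dp : 0 < D by rewrite lt_neqAle D0 andbT; apply/eqP => E; move: far2; rewrite -E mul0r ltr10.
  have DH : D^-1 <= Hy by rewrite -[leLHS]mul1r ler_pdivrMr// mulrC ltW.
  have [cr|cr] := leP (2 * rho ^+ k) D.
    apply: le_trans (increment_prob_le2 gB i0 j0 st (ltW rk) Dp cr) _.
    by rewrite lee_fin ler_wpM2l ?mulr_ge0 ?(ltW rk).
  (* When [D] is below [2 * rho ^+ k] the claimed bound exceeds 1. *)
  apply: le_trans ev1 _; rewrite lee_fin.
  apply: (@le_trans _ _ (D * Hy)); first exact: ltW.
  by rewrite ler_wpM2r ?(ltW Hy0)//; lra.
have k0 : (0 < k)%N by case: (k) yk.
have HyHk : Hy <= H ^+ k by rewrite /Hy ler_weXn2l//; lra.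
have rkE : rho ^+ k = (H ^+ k) ^- 2 by rewrite /rho exprVn exprAC.
have Hk0 : 0 < H ^+ k by rewrite exprn_gt0.
have far2 : 1 < D * Hy.
  have [far1|//] := orP far; exfalso; move: far1; apply/negP; rewrite -leNgt.
  apply: le_trans (_ : rho ^+ k * (H ^+ k) ^+ 2 <= 1); last first.
    by rewrite rkE mulVf// gt_eqF// exprn_gt0.
  apply: ler_pM => //; first by rewrite exprn_ge0// ltW.
  by rewrite lerXn2r ?nnegrE ?(ltW Hy0) ?(ltW Hk0).
have Dp : 0 < D by rewrite lt_neqAle D0 andbT; apply/eqP => E; move: far2; rewrite -E mul0r ltr10.
have DH : D^-1 <= Hy by rewrite -[leLHS]mul1r ler_pdivrMr// mulrC ltW.
have cr : 2 * rho ^+ k <= D.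
  apply: (@le_trans _ _ Hy^-1); last first.
    by rewrite -[leRHS]invrK lef_pV2 ?posrE ?invr_gt0.
  apply: (@le_trans _ _ (H ^+ k)^-1); last by rewrite lef_pV2.
  rewrite rkE ler_pdivrMr ?exprn_gt0// [X in _ * X]expr2 mulrA mulVf ?gt_eqF//.
  by rewrite mul1r; apply: (le_trans H2); rewrite -[leLHS]expr1 ler_weXn2l//; lra.
apply: le_trans (increment_prob_le3 gB i0 j0 st (ltW rk) Dp cr) _.
rewrite lee_fin -/D -exprVn; apply: ler_pM.
- by rewrite !mulr_ge0 ?(ltW rk).
- by rewrite exprn_ge0 ?invr_ge0.
- by rewrite expr2 mulrA ler_wpM2l ?mulr_ge0 ?(ltW rk).
- by rewrite lerXn2r ?nnegrE ?invr_ge0 ?(ltW Hy0).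
Qed.

End BrownianEnergy.

Lemma sum_triple (R : nmodType) (I J K : finType) (F : I -> J -> K -> R) :
  \sum_i \sum_j \sum_k F i j k = \sum_(p : I * J * K) F p.1.1 p.1.2 p.2.
Proof.
rewrite (pair_bigA _ (fun i j => \sum_k F i j k)) /=.
by rewrite (pair_bigA _ (fun p k => F p.1 p.2 k)).
Qed.

Section BrownianEnergyBound.
Context {d} {T : measurableType d} {R : realType} (P : probability T R).
Variable B : R -> {RV P >-> R}.
Hypothesis gB : gaussian_increments B.
Variables (L b : nat) (gam : R).
Hypothesis L_gt0 : (0 < L)%N.
Hypothesis types_gt0 : (0 < types L b)%N.

Let tau : R := 2 * theta R.
Let H : R := 2 ^+ L.
Let q : R := (types L b)%:R * (5 `^ tau) ^+ b.
Let rho : R := (H ^+ 2)^-1.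

Hypothesis H_lt_q : H < q.
Hypothesis gam_lt : (H ^+ 2) `^ gam < H * q.

Let H2 : 2 <= H := expr2L_ge2 L_gt0.
Let H0 : 0 < H. Proof. by have := H2; lra. Qed.
Let q0 : 0 < q. Proof. exact: lt_trans H_lt_q. Qed.
Let m : R := Num.max (H / q) (q / H ^+ 3).

Let m01 : 0 <= m < 1.
Proof.
rewrite /m le_max divr_ge0 ?(ltW H0) ?(ltW q0)//= gt_max.
rewrite !ltr_pdivrMr ?exprn_gt0// !mul1r H_lt_q /=.
exact: q_lt_H3.
Qed.

Let C1 : R := 1 + 48 * H ^+ 3 * (2 / (1 - m)).

(** At [y = k] both formulas of [scale_prob], times [q ^ (- y)], are a constant times
    [(H q) ^ (- k)]; away from [k] they decay with ratio [H / q] upwards and [q / H ^ 3] downwards.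
    The term [y = N] comes with the trivial probability bound and is absorbed by [q ^ (- N) <= q ^
    (- 2 k) <= (H q) ^ (- k)]; hence the truncation of the energy at [N./2]. *)
Lemma sum_scale_prob N k : (k.*2 <= N)%N ->
  \sum_(y < N.+1) scale_prob L N k y * q^-1 ^+ y <= C1 * ((H * q)^-1) ^+ k.
Proof.
move=> kN; have /andP[m0 m1] := m01; clearbody q.
have rE z : rho ^+ z = (H ^+ z) ^- 2 by rewrite /rho exprVn exprAC.
have Hz z : H ^+ z != 0 by rewrite expf_neq0// gt_eqF.
have qz z : q ^+ z != 0 by rewrite expf_neq0// gt_eqF.
rewrite big_ord_recr /= addrC [leRHS]mulrDl; apply: lerD.
  rewrite /scale_prob eqxx !mul1r !exprVn lef_pV2 ?posrE ?exprn_gt0 ?mulr_gt0//.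
  apply: (@le_trans _ _ (q ^+ k.*2)).
    rewrite -addnn exprD exprMn ler_wpM2r ?exprn_ge0 ?(ltW q0)//.
    by rewrite lerXn2r ?nnegrE ?(ltW H0) ?(ltW q0) ?(ltW H_lt_q).
  by rewrite ler_weXn2l// (le_trans _ (ltW H_lt_q))//; have := H2; lra.
have E : 48 * H ^+ 3 * (2 / (1 - m)) * (H * q)^-1 ^+ k =
  (48 * H ^+ 3 * (H * q)^-1 ^+ k) * (2 / (1 - m)) by ring.
rewrite E; apply: le_trans (_ : _ <= 48 * H ^+ 3 * (H * q)^-1 ^+ k *
   \sum_(y < N) (if (k <= y)%N then m ^+ (y - k) else m ^+ (k - y))) _; last first.
  rewrite ler_wpM2l ?sum_two_sided ?m01// !mulr_ge0 ?exprn_ge0 ?(ltW H0)//.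
  by rewrite invr_ge0 mulr_ge0 ?(ltW H0) ?(ltW q0).
rewrite mulr_sumr; apply: ler_sum => y _; rewrite /scale_prob -/H -/rho (ltn_eqF (ltn_ord y)).
have [ky|yk] := leqP k y.
  have -> : 4 * rho ^+ k * H ^+ y.+1 * q^-1 ^+ y =
      4 * H * (H * q)^-1 ^+ k * (H / q) ^+ (y - k).
    rewrite -[in LHS](subnKC ky) exprS !exprD rE !exprVn exprMn expr_div_n.
    by field; rewrite Hz !qz.
  apply: ler_pM.
  - by rewrite !mulr_ge0 ?exprn_ge0 ?invr_ge0 ?mulr_ge0 ?(ltW H0) ?(ltW q0).
  - by rewrite exprn_ge0// divr_ge0 ?(ltW H0) ?(ltW q0).
  - rewrite ler_wpM2r ?exprn_ge0 ?invr_ge0 ?mulr_ge0 ?(ltW H0) ?(ltW q0)//.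
    have : H <= H ^+ 3 by rewrite -[leLHS]expr1 ler_weXn2l//; have := H2; lra.
    by have := H2; lra.
  - rewrite lerXn2r ?nnegrE ?divr_ge0 ?(ltW H0) ?(ltW q0)//.
    by rewrite /m le_max lexx.
have -> : 48 * (rho ^+ k) ^+ 2 * (H ^+ y.+1) ^+ 3 * q^-1 ^+ y =
    48 * H ^+ 3 * (H * q)^-1 ^+ k * (q / H ^+ 3) ^+ (k - y).
  rewrite -[in LHS](subnKC (ltnW yk)) -[X in (H * q)^-1 ^+ X](subnKC (ltnW yk)).
  move: (k - y)%N => z; rewrite rE [H ^+ y.+1]exprS !exprVn [(H * q) ^+ _]exprMn expr_div_n.
  rewrite (exprAC H 3 z) (exprD H y z) (exprD q y z).
  move: (H ^+ y) (H ^+ z) (q ^+ y) (q ^+ z) (Hz y) (Hz z) (qz y) (qz z).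
  by move=> a1 a2 a3 a4 h1 h2 h3 h4; field; rewrite h1 h2 h3 h4.
rewrite ler_wpM2l ?mulr_ge0 ?exprn_ge0 ?invr_ge0 ?mulr_ge0 ?(ltW H0) ?(ltW q0)//.
rewrite lerXn2r ?nnegrE ?divr_ge0 ?exprn_ge0 ?(ltW H0) ?(ltW q0)//.
by rewrite /m le_max lexx orbT.
Qed.

Definition path_energy N (w : T) : R :=
  energy (fun t => B t w + curve t) gam rho (6 ^ (N * L)) N./2 (node L N)
    (weight L b N).

Let I N := ('I_(N./2).+1 * 'I_(6 ^ (N * L)) * 'I_(6 ^ (N * L)))%type.

Let c N (p : I N) : R := (rho ^+ p.1.1) `^ (- gam) *
  (weight L b N p.1.2 * weight L b N p.2 *
   (`|node L N p.1.2 - node L N p.2| <= rho ^+ p.1.1)%R%:R).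

Let E N (p : I N) : set T := [set w | `|B (node L N p.1.2) w - B (node L N p.2) w +
        (curve (node L N p.1.2) - curve (node L N p.2))| <= rho ^+ p.1.1].

Let mE N (p : I N) : measurable (E p).
Proof.
have mB : measurable_fun setT (fun w => B (node L N p.1.2) w - B (node L N p.2) w).
  exact: measurable_funB.
rewrite -[X in measurable X]setTI.
exact: (mB measurableT _ (measurable_shift_ball
  (curve (node L N p.1.2) - curve (node L N p.2)) (rho ^+ p.1.1))).
Qed.

Let path_energyE N w : path_energy N w = \sum_(p : I N) c p * \1_(E p) w.
Proof.
rewrite /path_energy /energy.
under eq_bigr do rewrite mulr_sumr.
under eq_bigr do under eq_bigr do rewrite mulr_sumr.
rewrite sum_triple; apply: eq_bigr => p _.
rewrite /c -!mulrA; congr (_ * (_ * (_ * _))).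
rewrite -mulnb natrM; congr (_ * _); rewrite indicE; congr (_%:R).
rewrite /E mem_setE; congr (nat_of_bool (`|_| <= _)); ring.
Qed.

Lemma measurable_path_energy N : measurable_fun setT (path_energy N).
Proof.
rewrite (_ : path_energy N = fun w => \sum_(p : I N) c p * \1_(E p) w); last first.
  by apply/funext => w; exact: path_energyE.
apply: measurable_sum => p; apply: measurable_funM => //.
Qed.

Lemma path_energy_ge0 N w : 0 <= path_energy N w.
Proof.
rewrite path_energyE; apply: sumr_ge0 => p _.
by rewrite !mulr_ge0 ?powR_ge0 ?weight_ge0.
Qed.

(** Exchanging sums puts the pair masses innermost; [pair_scale] and [sum_scale_prob] then bound the
    term of index [k] by a constant times [z ^ k], and [gam_lt] says that [z < 1]. *)
Lemma path_energy_bounded : exists C : R, forall N,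
  (\int[P]_w (path_energy N w)%:E <= C%:E)%E.
Proof.
pose z := (H ^+ 2) `^ gam / (H * q).
have qH : 0 < H * q := mulr_gt0 H0 q0.
have z01 : 0 <= z < 1.
  rewrite divr_ge0 ?powR_ge0 ?(ltW qH)//=.
  by rewrite ltr_pdivrMr ?qH// mul1r.
pose A : R := 15 * 5 ^+ b.
have C10 : 0 <= C1.
  have /andP[m0 m1] := m01.
  by rewrite /C1 addr_ge0// !mulr_ge0 ?exprn_ge0 ?(ltW H0)// invr_ge0 subr_ge0 ltW.
exists (A * C1 * (1 - z)^-1) => N.
pose v (p : I N) : R := (rho ^+ p.1.1) `^ (- gam) *
  (weight L b N p.1.2 * weight L b N p.2 *
   \sum_(y < N.+1) scale_prob L N p.1.1 y * (close_pair tau L N y p.1.2 p.2)%:R).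
under eq_integral do rewrite path_energyE.
apply: le_trans (integral_indic_sum (v := v) _ (@mE N) _) _.
- by move=> p; rewrite /c !mulr_ge0 ?powR_ge0 ?weight_ge0.
- move=> p; rewrite /c /v.
  case: (boolP (_ <= _)) => dk; last first.
    rewrite mulr0 mulr0 mul0e lee_fin !mulr_ge0 ?powR_ge0 ?weight_ge0//.
    by apply: sumr_ge0 => y _; rewrite mulr_ge0// scale_prob_ge0.
  rewrite mulr1 [in leRHS]mulrA [X in (_ <= X)%E]EFinM.
  rewrite lee_wpmul2l ?lee_fin ?mulr_ge0 ?powR_ge0 ?weight_ge0//.
  exact: pair_prob.
rewrite lee_fin /v.
have -> : \sum_(p : I N) (rho ^+ p.1.1) `^ (- gam) *
  (weight L b N p.1.2 * weight L b N p.2 *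
   \sum_(y < N.+1) scale_prob L N p.1.1 y * (close_pair tau L N y p.1.2 p.2)%:R) =
  \sum_(k < (N./2).+1) (rho ^+ k) `^ (- gam) * \sum_(y < N.+1) scale_prob L N k y *
    \sum_(i < 6 ^ (N * L)) \sum_(j < 6 ^ (N * L))
       weight L b N i * weight L b N j * (close_pair tau L N y i j)%:R.
  rewrite -(sum_triple (fun (k : 'I_(N./2).+1) (i j : 'I_(6 ^ (N * L))) => (rho ^+ nat_of_ord k) `^ (- gam) *
    (weight L b N i * weight L b N j *
     \sum_(y < N.+1) scale_prob L N k y * (close_pair tau L N y i j)%:R))).
  apply: eq_bigr => k _; under eq_bigr do rewrite -mulr_sumr.
  rewrite -mulr_sumr; congr (_ * _).
  under eq_bigr do under eq_bigr do rewrite mulr_sumr.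
  under eq_bigr do rewrite exchange_big.
  rewrite exchange_big; apply: eq_bigr => y _.
  rewrite mulr_sumr; apply: eq_bigr => i _.
  by rewrite mulr_sumr; apply: eq_bigr => j _; ring.
apply: (@le_trans _ _ (\sum_(k < (N./2).+1) A * C1 * z ^+ k)); last first.
  by rewrite -mulr_sumr ler_wpM2l ?mulr_ge0 ?exprn_ge0// sum_geometric_le1.
apply: ler_sum => k _.
have -> : (rho ^+ k) `^ (- gam) = ((H ^+ 2) `^ gam) ^+ k.
  have Hk j : 0 <= H ^+ j by rewrite exprn_ge0// ltW.
  by rewrite /rho exprVn powRVN ?exprn_ge0// (powR_exprn gam k (Hk 2)).
rewrite /z expr_div_n mulrCA ler_wpM2l ?exprn_ge0 ?powR_ge0//.
have kN : (k.*2 <= N)%N by rewrite -geq_half_double -ltnS.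
rewrite -exprVn -mulrA; apply: le_trans (_ : _ <= A * \sum_(y < N.+1) scale_prob L N k y * q^-1 ^+ y) _; last first.
  by rewrite ler_wpM2l ?mulr_ge0 ?exprn_ge0// sum_scale_prob.
rewrite mulr_sumr; apply: ler_sum => y _.
rewrite mulrCA ler_wpM2l ?scale_prob_ge0//.
by apply: pair_scale => //; [exact: tau01|rewrite -ltnS].
Qed.

End BrownianEnergyBound.

(** * Modulus of continuity of Brownian motion *)

Section Chaining.
Context {R : realType}.

Let left6 n (t : R) : R := (colof n t)%:R / 6 ^+ n.

Let left6_itv n t : 0 <= t <= 1 -> 0 <= left6 n t <= 1 /\ `|t - left6 n t| * 6 ^+ n <= 1.
Proof.
move=> t01; have p : 0 < (6 : R) ^+ n by rewrite exprn_gt0.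
have /andP[c1 c2] := col_itv n t01; split.
  rewrite divr_ge0//= ler_pdivrMr// mul1r -natrX ler_nat.
  exact: ltnW (col_lt n t).
rewrite -{1}(gtr0_norm p) -normrM mulrBl /left6 divfK ?gt_eqF//.
by move: c2; rewrite -(@natr1 R (colof n t)) ler_norml => c2; apply/andP; split; lra.
Qed.

(** At most 5 grid steps of level [k.+1] lead from [left6 k t] to [left6 k.+1 t]. They are summed
    from level [n] on, and continuity passes from the grid points to [t]. *)
Lemma chaining (beta : R -> R) (C x : R) :
  {within `[0, +oo[, continuous beta} -> 0 <= C -> 0 <= x < 1 ->
  (forall n i, (i < 6 ^ n)%N ->
    `|beta (i.+1%:R / 6 ^+ n) - beta (i%:R / 6 ^+ n)| <= C * x ^+ n) ->
  forall n t, 0 <= t <= 1 ->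
    `|beta t - beta (left6 n t)| <= 5 * C * (x ^+ n / (1 - x)).
Proof.
move=> cb C0 /andP[x0 x1] inc n t t01.
have t0 : 0 <= t by case/andP: t01.
have step k : `|beta (left6 k.+1 t) - beta (left6 k t)| <= 5 * C * x ^+ k.+1.
  have e : left6 k t = (6 * colof k t)%:R / 6 ^+ k.+1.
    by rewrite /left6 natrM exprS invfM mulrACA divff// mul1r.
  have cE : colof k t = (colof k.+1 t %/ 6)%N.
    by rewrite -[k.+1]addn1 -(col_div k 1 t0) expn1.
  have c6 := divn_eq (colof k.+1 t) 6.
  have lt6 : (colof k.+1 t %% 6 < 6)%N by rewrite ltn_mod.
  have cl := col_lt k.+1 t.
  rewrite e /left6 cE; move: c6 lt6 cl.
  set a := colof _ _; set r := (a %% 6)%N; rewrite (mulnC _ 6); set p := (6 * _)%N.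
  move=> ->; move: (r) => {}r.
  have gen r' : (r' <= 5)%N -> (p + r' < 6 ^ k.+1)%N ->
     `|beta ((p + r')%:R / 6 ^+ k.+1) - beta (p%:R / 6 ^+ k.+1)| <= r'%:R * (C * x ^+ k.+1).
    elim: r' => [|r' IH] r5 rl; first by rewrite addn0 subrr normr0 mul0r.
    apply: le_trans (ler_distD (beta ((p + r')%:R / 6 ^+ k.+1)) _ _) _.
    rewrite -(@natr1 R r') mulrDl mul1r addrC; apply: lerD.
      by apply: IH; lia.
    by rewrite addnS; apply: inc; lia.
  move=> r6 /(gen r (r6 : (r <= 5)%N)) /le_trans; apply.
  rewrite -mulrA ler_wpM2r ?mulr_ge0 ?exprn_ge0//.
  by rewrite ler_nat.
have sum k : `|beta (left6 (n + k) t) - beta (left6 n t)| <=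
    5 * C * \sum_(0 <= i < k) 1 * x ^+ (n + i).+1.
  elim: k => [|k IH]; first by rewrite addn0 subrr normr0 big_geq// mulr0.
  apply: le_trans (ler_distD (beta (left6 (n + k) t)) _ _) _.
  rewrite big_nat_recr//= mulrDr addrC; apply: lerD => //.
  by rewrite addnS mul1r; exact: step.
have C5 : 0 <= 5 * C by rewrite mulr_ge0.
have bound k : `|beta (left6 (n + k) t) - beta (left6 n t)| <= 5 * C * (x ^+ n / (1 - x)).
  apply: le_trans (sum k) _; rewrite ler_wpM2l//.
  have := @sum_geometric_le R 1 x n.+1 k ler01 (introT andP (conj x0 x1)).
  rewrite (eq_bigr (fun i => 1 * x ^+ (n + i).+1)); last by move=> i _; rewrite addSn.
  move=> /le_trans; apply; rewrite mul1r ler_wpM2r ?invr_ge0 ?subr_ge0 ?(ltW x1)//.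
  by rewrite exprS ler_piMl ?exprn_ge0// ltW.
apply/ler_addgt0Pr => e e0.
have /subspace_continuousP/(_ t) := cb; rewrite /= in_itv /= andbT => /(_ t0).
move=> /cvgrPdist_lt/(_ _ e0); rewrite near_withinE.
move=> /nbhs_ballP[del /= del0 hdel].
pose k := (Num.truncn del^-1).+1.
have pk : 0 < (6 : R) ^+ (n + k) by rewrite exprn_gt0.
have [/andP[l0 l1] lt] := left6_itv (n + k) t01.
have near : `|t - left6 (n + k) t| < del.
  rewrite -[ltRHS]invrK; apply: le_lt_trans (_ : (6 ^+ (n + k))^-1 < _).
    by rewrite -[leRHS]mul1r ler_pdivlMr.
  rewrite ltf_pV2 ?posrE ?invr_gt0//.
  apply: (@lt_trans _ _ k%:R); first exact: truncnS_gt.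
  rewrite -natrX ltr_nat (@leq_trans (6 ^ k))//; first exact: ltn_expl.
  by rewrite leq_exp2l// leq_addl.
have := hdel (left6 (n + k) t) near; rewrite /= in_itv /= andbT => /(_ l0) be.
apply: le_trans (ler_distD (beta (left6 (n + k) t)) _ _) _.
by rewrite addrC; apply: lerD; [exact: bound|exact: ltW].
Qed.

End Chaining.

Section Modulus.
Context {d} {T : measurableType d} {R : realType} (P : probability T R).
Variable B : R -> {RV P >-> R}.
Hypothesis gB : gaussian_increments B.
Hypothesis cB : {ae P, forall w, {within `[0, +oo[, continuous (fun t : R => B t w)}}.
Variable x : R.
Hypothesis x01 : 0 < x < 1.
Hypothesis x6 : 1 < 6 * x ^+ 2.

(** As [6 * x ^+ 2 > 1], the threshold [x ^ n] exceeds the standard deviation [6 ^ (- n / 2)] of the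
    increment by a factor exponential in [n]. *)
Let jump n i : set T :=
  [set w | x ^+ n <= `|B (i.+1%:R / 6 ^+ n) w - B (i%:R / 6 ^+ n) w|].

Let p6 n : 0 < (6 : R) ^+ n. Proof. by rewrite exprn_gt0. Qed.

Let measurable_jump n i : measurable (jump n i).
Proof.
have mB : measurable_fun setT (fun w => `|B (i.+1%:R / 6 ^+ n) w - B (i%:R / 6 ^+ n) w|).
  by apply: measurableT_comp => //; exact: measurable_funB.
have := mB measurableT _ (measurable_itv `[x ^+ n, +oo[%R); rewrite setTI.
by congr measurable; apply/seteqP; split=> w; rewrite /jump /= in_itv /= andbT.
Qed.

Let prob_jump n i :
  (P (jump n i) <= (2 * expR (- ((6 * x ^+ 2) ^+ n / 4)))%:E)%E.
Proof.
have /andP[x0 x1] := x01.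
have lt : i%:R / 6 ^+ n < i.+1%:R / 6 ^+ n :> R.
  by rewrite ltr_pM2r ?invr_gt0// ltr_nat.
have dE : i.+1%:R / 6 ^+ n - i%:R / 6 ^+ n = (6 ^+ n)^-1 :> R.
  by rewrite -mulrBl -natr1 addrAC subrr add0r mul1r.
have m : measurable [set y : R | x ^+ n <= `|y|].
  have mn : measurable_fun [set: R] (fun x : R => `|x|) by exact: normr_measurable.
  have := mn measurableT _ (measurable_itv `[x ^+ n, +oo[%R); rewrite setTI.
  by congr measurable; apply/seteqP; split=> y /=; rewrite in_itv /= andbT.
rewrite [X in P X](_ : _ = [set w | [set y : R | x ^+ n <= `|y|]
   (B (i.+1%:R / 6 ^+ n) w - B (i%:R / 6 ^+ n) w)])// gB//.
have s0 : 0 < Num.sqrt (i.+1%:R / 6 ^+ n - i%:R / 6 ^+ n) :> R.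
  by rewrite sqrtr_gt0 subr_gt0.
apply: le_trans (normal_prob_tail s0 _) _; first by rewrite exprn_ge0// ltW.
rewrite lee_fin sqr_sqrtr ?subr_ge0 ?(ltW lt)// dE.
rewrite ler_pM2l// ler_expR lerN2 le_eqVlt; apply/orP; left; apply/eqP.
by rewrite exprMn exprAC; field; rewrite gt_eqF.
Qed.

Let jumps n : set T := \big[setU/set0]_(i < 6 ^ n) jump n i.

Let measurable_jumps n : measurable (jumps n).
Proof. by apply: bigsetU_measurable => i _. Qed.

Let prob_jumps : exists C : R, 0 <= C /\
  forall n, (P (jumps n) <= (C * 2^-1 ^+ n)%:E)%E.
Proof.
have /andP[x0 x1] := x01.
(* There are [6 ^ n] increments of level [n]. The bound of [expR (- u)] by [(p + 1)! / u ^ (p + 1)]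
   gains [12 ^ (- n)] up to a constant, which leaves [2 ^ (- n)]. *)
have [p yp] : exists p, 12 <= (6 * x ^+ 2) ^+ p.+1.
  have [[|l] hl] := exists_expr_gt x6; first by rewrite expr0 ltxx in hl.
  exists (l.+1 * 4).-1; rewrite prednK// exprM.
  have : 2 <= (6 * x ^+ 2) ^+ l.+1 by apply: le_trans (ltW hl); rewrite ler_nat.
  move: (_ ^+ l.+1) => y y2; have : (2 : R) ^+ 4 <= y ^+ 4.
    by rewrite lerXn2r ?nnegrE//; lra.
  by rewrite !exprS expr0; lra.
pose C : R := 2 * (p.+1`!%:R * 4 ^+ p.+1); exists C; split.
  by rewrite !mulr_ge0// exprn_ge0.
move=> n; apply: le_trans (Boole_inequality P (fun i _ => measurable_jump n i)) _.
apply: (@le_trans _ _ (\sum_(i < 6 ^ n) (2 * expR (- ((6 * x ^+ 2) ^+ n / 4)))%:E)%E).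
  by apply: lee_sum => i _; exact: prob_jump.
rewrite sumEFin lee_fin sumr_const card_ord -[_ *+ (6 ^ n)]mulr_natl natrX.
set u := (6 * x ^+ 2) ^+ n / 4.
have u0 : 0 < u by rewrite divr_gt0// exprn_gt0// (lt_trans _ x6).
have e1 : expR (- u) <= p.+1`!%:R / u ^+ p.+1.
  have f0 : 0 < p.+1`!%:R :> R by rewrite ltr0n fact_gt0.
  have up : 0 < u ^+ p.+1 by rewrite exprn_gt0.
  rewrite expRN -[leRHS]invrK lef_pV2 ?posrE ?expR_gt0 ?invr_gt0 ?divr_gt0//.
  rewrite invf_div; have := expR_ge1Dxn p (ltW u0); lra.
apply: (@le_trans _ _ (6 ^+ n * (2 * (p.+1`!%:R / u ^+ p.+1)))).
  by rewrite ler_wpM2l ?(ltW (p6 n))// ler_wpM2l.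
have uE : u ^+ p.+1 = ((6 * x ^+ 2) ^+ p.+1) ^+ n / 4 ^+ p.+1.
  by rewrite /u expr_div_n exprAC.
have u12 : 12 ^+ n / 4 ^+ p.+1 <= u ^+ p.+1.
  rewrite uE ler_wpM2r ?invr_ge0 ?exprn_ge0// lerXn2r ?nnegrE//.
  by rewrite exprn_ge0// ltW// (lt_trans _ x6).
have -> : C * 2^-1 ^+ n = 6 ^+ n * (2 * (p.+1`!%:R / (12 ^+ n / 4 ^+ p.+1))).
  have -> : (12 : R) = 6 * 2 by lra.
  rewrite exprMn exprVn /C; field.
  by rewrite !expf_neq0// gt_eqF.
rewrite ler_wpM2l ?(ltW (p6 n))// ler_wpM2l// ler_wpM2l//.
rewrite lef_pV2 ?posrE ?exprn_gt0//.
Qed.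

Let eventually_no_jump :
  {ae P, forall w, exists n0, forall n, (n0 <= n)%N -> ~ jumps n w}.
Proof.
have [C [C0 hC]] := prob_jumps.
(* The probabilities are summable, so Borel-Cantelli applies. *)
have P0 : P (lim_sup_set jumps) = 0%E.
  apply: lim_sup_set_cvg0 => //.
  apply: (@le_lt_trans _ _ (C * 2^-1 ^+ 0 / (1 - 2^-1))%:E); last by rewrite ltry.
  apply: nneseries_le_ub => // k.
  apply: (@le_trans _ _ (\sum_(0 <= i < k) C * 2^-1 ^+ (0 + i))%:E).
    by rewrite -sumEFin; apply: lee_sum => i _; rewrite add0n; exact: hC.
  by rewrite lee_fin sum_geometric_le//; lra.
exists (lim_sup_set jumps); split => //.
  apply: bigcap_measurable => // n _; apply: bigcup_measurable => // k _.
move=> w /= hw n _; apply: contrapT => hn; apply: hw; exists n => k nk jk.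
by apply: hn; exists k.
Qed.

Lemma brownian_modulus : {ae P, forall w, exists2 C, 0 <= C &
  forall n t t', 0 <= t <= 1 -> 0 <= t' <= 1 -> colof n t = colof n t' ->
    `|B t w - B t' w| <= C * x ^+ n}.
Proof.
have /andP[x0 x1] := x01.
near=> w.
have [n0 hn0] : exists n0, forall n, (n0 <= n)%N -> ~ jumps n w.
  by near: w; exact: eventually_no_jump.
have cw : {within `[0, +oo[, continuous (fun t : R => B t w)}.
  by near: w; exact: cB.
pose inc n i := `|B (i.+1%:R / 6 ^+ n) w - B (i%:R / 6 ^+ n) w|.
(* The finitely many levels below [n0] are absorbed into the constant. *)
pose C := 1 + \sum_(n < n0) \sum_(i < 6 ^ n) inc n i / x ^+ n.
have C1 : 1 <= C.
  rewrite lerDl; apply: sumr_ge0 => n _; apply: sumr_ge0 => i _.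
  by rewrite divr_ge0 ?exprn_ge0 ?(ltW x0)// normr_ge0.
have C0 : 0 <= C by lra.
have hinc n i : (i < 6 ^ n)%N -> inc n i <= C * x ^+ n.
  move=> i6; have xn : 0 < x ^+ n by rewrite exprn_gt0.
  have [nn0|nn0] := leqP n0 n.
    have : ~ jump n i w.
      by move=> ji; apply: (hn0 n nn0); rewrite /jumps -bigcup_mkord; exists i.
    move/negP; rewrite -ltNge => /ltW h; apply: le_trans h _.
    by rewrite ler_peMl ?(ltW xn).
  rewrite -ler_pdivrMr// /C (bigD1 (Ordinal nn0))//= (bigD1 (Ordinal i6))//=.
  rewrite [leRHS]addrC -!addrA lerDl !addr_ge0//.
    by apply: sumr_ge0 => j _; rewrite divr_ge0 ?exprn_ge0 ?(ltW x0)// normr_ge0.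
  apply: sumr_ge0 => j _; apply: sumr_ge0 => l _.
  by rewrite divr_ge0 ?exprn_ge0 ?(ltW x0)// normr_ge0.
have x01' : 0 <= x < 1 by rewrite ltW.
have chain := chaining cw C0 x01' hinc.
exists (2 * (5 * C / (1 - x))).
  by rewrite mulr_ge0// divr_ge0 ?mulr_ge0// subr_ge0 ltW.
move=> n t t' ht ht' tt'.
have h1 := chain n t ht; have h2 := chain n t' ht'.
apply: le_trans (ler_distD (B ((colof n t)%:R / 6 ^+ n) w) _ _) _.
rewrite -tt' distrC in h2.
apply: le_trans (lerD h1 h2) _.
by rewrite le_eqVlt; apply/orP; left; apply/eqP; field; lra.
Unshelve. all: by end_near. Qed.

End Modulus.

(** * Dimensions of the two graphs *)

Section Dimensions.
Context {R : realType}.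

Lemma hausdorff_dim_eq (A : set (R * R)) (D : R) : 0 < D ->
  (forall s, D < s -> hausdorff_measure s A = 0%E) ->
  (forall s, 0 < s < D -> hausdorff_measure s A <> 0%E) ->
  hausdorff_dim A = D%:E.
Proof.
move=> D0 up lo; apply/eqP; rewrite eq_le; apply/andP; split.
  apply/lee_addgt0Pr => e e0; rewrite -EFinD; apply: ereal_inf_lbound.
  have De : D < D + e by rewrite ltrDl.
  by exists (D + e) => //=; split; [exact: lt_trans De|exact: up].
apply: le_ereal_inf_tmp => _ [s /= [s0 Hs] <-]; rewrite lee_fin leNgt.
by apply/negP => sD; apply: (lo s) => //; rewrite s0.
Qed.

Lemma exists_powR_lt (y : R) : 1 < y -> exists2 e, 0 < e & 5 `^ e < y.
Proof.
move=> y1; have y0 : 0 < y by exact: lt_trans y1.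
have l5 : 0 < ln (5 : R) by rewrite ln_gt0// ltr1n.
have ly : 0 < ln y by rewrite ln_gt0.
exists (ln y / (2 * ln 5)); first by rewrite divr_gt0// mulr_gt0.
rewrite -ltr_ln ?posrE ?powR_gt0// ln_powR.
have -> : ln y / (2 * ln 5) * ln 5 = ln y / 2 by field; rewrite gt_eqF.
by lra.
Qed.

Lemma log2_ltP (x s : R) : 0 < x -> (log_base 2 x < s) = (x < 2 `^ s).
Proof.
move=> x0; rewrite /log_base ltr_pdivrMr ?ln2_gt0//.
by rewrite -ltr_ln ?posrE ?powR_gt0// ln_powR.
Qed.

Lemma log2_gtP (x s : R) : 0 < x -> (s < log_base 2 x) = (2 `^ s < x).
Proof.
move=> x0; rewrite /log_base ltr_pdivlMr ?ln2_gt0//.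
by rewrite -[RHS]ltr_ln ?posrE ?powR_gt0// ln_powR.
Qed.

Lemma frow_close m (t t' : R) : 0 <= t <= 1 -> 0 <= t' <= 1 -> frow m t = frow m t' ->
  `|curve t - curve t'| <= 2^-1 ^+ m.
Proof.
move=> /andP[t0 _] /andP[t0' _] E.
have := curve_itv m t0; have := curve_itv m t0'; rewrite E.
rewrite -(@natr1 R (frow m t')) => /andP[a1 a2] /andP[b1 b2].
have p : 0 < (2 : R) ^+ m by rewrite exprn_gt0.
rewrite exprVn -[leRHS]mul1r ler_pdivlMr// -{1}(gtr0_norm p) -normrM mulrBl.
by rewrite ler_norml; apply/andP; split; lra.
Qed.

Lemma powR5_theta_gt1 : 1 < 5 `^ theta R.
Proof.
have : 1 `^ theta R < 5 `^ theta R.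
  by apply: gt0_ltr_powR; rewrite ?nnegrE ?theta_gt0// ltr1n.
by rewrite powR1.
Qed.

Lemma powR5D1_gt0 (tau : R) : 0 < 5 `^ tau + 1.
Proof. by rewrite ltr_wpDl// powR_ge0. Qed.

Lemma curve_dim : hausdorff_dim (graph (@curve R)) = (log_base 2 (5 `^ theta R + 1))%:E.
Proof.
have D0 : 0 < log_base 2 (5 `^ theta R + 1).
  by rewrite log2_gtP ?powR5D1_gt0// powRr0; have := powR5_theta_gt1; lra.
apply: hausdorff_dim_eq => // s.
  move=> Ds; have s0 : 0 < s by exact: lt_trans Ds.
  move: Ds; rewrite log2_ltP ?powR5D1_gt0// => Zs.
  have [e e0 he] : exists2 e, 0 < e & 5 `^ e < 2 `^ s / (5 `^ theta R + 1).
    by apply: exists_powR_lt; rewrite ltr_pdivlMr ?powR5D1_gt0// mul1r.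
  have th01 : 0 < theta R <= 1 by rewrite theta_gt0; have := @theta_lt R; lra.
  apply: (@hausdorff_upper _ (theta R) (@curve R) th01 1 2^-1 e s) => //.
  - by rewrite powR6_theta.
  - by move=> m t t' ht ht' _ ft; rewrite mul1r; exact: frow_close.
  rewrite powR6_theta divff// mulr1.
  rewrite -powR_inv1// -powRrM mulN1r powRN ltr_pdivrMr ?powR_gt0// mul1r.
  by rewrite -ltr_pdivlMr ?powR5D1_gt0.
move=> /andP[s0]; rewrite log2_gtP ?powR5D1_gt0// => sZ.
by apply: (curve_hausdorff_lower sZ); rewrite s0 lexx.
Qed.

(* [6 ^ 5 <= 2 ^ 13]; so [5 ^ theta >= 5 ^ (5 / 13)], which is just enough for
   [5 ^ theta + 1 > sqrt 8]. *)
Lemma theta_ge_5_13 : 5 <= 13 * theta R.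
Proof.
rewrite /theta mulrA ler_pdivlMr ?ln6_gt0//.
have l5 : 5 * ln 6 = ln (6 ^+ 5 : R) by rewrite lnXn// mulr_natl.
have l13 : 13 * ln 2 = ln (2 ^+ 13 : R) by rewrite lnXn// mulr_natl.
rewrite l5 l13 ler_ln ?posrE ?exprn_gt0//.
by rewrite !exprS !expr0; lra.
Qed.

Lemma powR5_thetaD1_sqr_gt8 : 8 < (5 `^ theta R + 1) ^+ 2.
Proof.
set a := 5 `^ theta R; have a1 : 1 < a := powR5_theta_gt1.
have a13 : 3125 <= a ^+ 13.
  rewrite /a -powR_mulrn ?powR_ge0// -powRrM.
  have -> : 3125 = 5 `^ 5 :> R by rewrite powR_mulrn// !exprS expr0; lra.
  by apply: ler_powR; [rewrite ler1n|rewrite mulrC; exact: theta_ge_5_13].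
(* [183 / 100] is just above [sqrt 8 - 1], and its 13th power is still below 3125. *)
have ha : 183 / 100 < a.
  rewrite ltNge; apply/negP => ha.
  have a0 : 0 <= a by lra.
  have h2 : a ^+ 2 <= 335 / 100 by rewrite expr2; nra.
  have p2 : 0 <= a ^+ 2 by rewrite exprn_ge0.
  have h4 : a ^+ 4 <= 1123 / 100 by rewrite (exprM a 2 2) expr2; nra.
  have p4 : 0 <= a ^+ 4 by rewrite exprn_ge0.
  have h8 : a ^+ 8 <= 1263 / 10 by rewrite (exprM a 4 2) expr2; nra.
  have p8 : 0 <= a ^+ 8 by rewrite exprn_ge0.
  have h12 : a ^+ 12 <= 1420 by rewrite (exprD a 8 4); nra.
  have p12 : 0 <= a ^+ 12 by rewrite exprn_ge0.
  have : a ^+ 13 <= 2700 by rewrite (exprD a 12 1) expr1; nra.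
  by lra.
by rewrite expr2; nra.
Qed.

Lemma curve_dim_gt : 3 / 2 < log_base 2 (5 `^ theta R + 1).
Proof.
rewrite /log_base ltr_pdivlMr ?ln2_gt0//.
have : ln (2 ^+ 3 : R) < ln ((5 `^ theta R + 1) ^+ 2).
  rewrite ltr_ln ?posrE ?exprn_gt0 ?powR5D1_gt0//.
  by apply: le_lt_trans powR5_thetaD1_sqr_gt8; rewrite !exprS expr0; lra.
rewrite lnXn// lnXn ?powR5D1_gt0// -[ln 2 *+ 3]mulr_natl -[_ *+ 2]mulr_natl.
by lra.
Qed.

(** For [a = 5 ^ theta] the claim is [(a + 1) ^ 2 < 2 (a ^ 2 + 1)], that is [0 < (a - 1) ^ 2]. *)
Lemma curve_dim_lt : log_base 2 (5 `^ theta R + 1) <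
  (log_base 2 (5 `^ (2 * theta R) + 1) + 1) / 2.
Proof.
have a1 := powR5_theta_gt1; have l2 := @ln2_gt0 R.
have -> : 5 `^ (2 * theta R) = (5 `^ theta R) ^+ 2.
  by rewrite mulrC powRrM powR_mulrn ?powR_ge0.
set a := 5 `^ theta R in a1 *.
have a0 : 0 < a + 1 by lra.
have a2 : 0 < a ^+ 2 + 1 by rewrite ltr_wpDl ?sqr_ge0.
have : ln ((a + 1) ^+ 2) < ln ((a ^+ 2 + 1) * 2).
  by rewrite ltr_ln ?posrE ?exprn_gt0 ?mulr_gt0// !expr2; nra.
rewrite lnXn// lnM ?posrE// -[ln _ *+ 2]mulr_natl => h.
rewrite /log_base ltr_pdivrMr//.
have -> : (ln (a ^+ 2 + 1) / ln 2 + 1) / 2 * ln 2 = (ln (a ^+ 2 + 1) + ln 2) / 2.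
  by field; rewrite gt_eqF.
lra.
Qed.

End Dimensions.

Section BrownianDimension.
Context {d} {T : measurableType d} {R : realType} (P : probability T R).
Variable B : R -> {RV P >-> R}.
Hypothesis hB : standard_brownian_motion B.

Let X (w : T) (t : R) : R := B t w + curve t.
Let tau : R := 2 * theta R.
Let D : R := (log_base 2 (5 `^ tau + 1) + 1) / 2.

Let tau01 : 0 < tau <= 1. Proof. exact: tau01. Qed.

Let Z2 : 2 < 5 `^ tau + 1.
Proof.
have : 1 `^ tau < 5 `^ tau.
  by apply: gt0_ltr_powR; rewrite ?nnegrE// ?ltr1n//; case/andP: tau01.
by rewrite powR1; lra.
Qed.

Let D_gt1 : 1 < D.
Proof.
have : 1 < log_base 2 (5 `^ tau + 1) by rewrite log2_gtP ?powR5D1_gt0// powRr1.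
by rewrite /D; lra.
Qed.

Lemma path_dim_upper :
  {ae P, forall w, forall s, D < s -> hausdorff_measure s (graph (X w)) = 0%E}.
Proof.
have /andP[t0 t1] := tau01.
(* Countably many [g k], decreasing to [1 / 2], give one null set for all [s]. The modulus [x k]
   satisfies [x k ^ tau = g k], and [6 * x k ^+ 2 > 1] amounts to [4 * g k ^+ 2 > 1]. *)
pose g k : R := 2^-1 + 4^-1 / k.+1%:R.
pose x k := g k `^ tau^-1.
have ik k : 0 < (k.+1%:R : R)^-1 <= 1 by rewrite invr_gt0 ltr0n invf_le1 ?ler1n.
have g01 k : 2^-1 < g k < 1.
  have := ik k; rewrite /g; move: k.+1%:R^-1 => v /andP[i0 i1].
  by apply/andP; split; lra.
have g0 k : 0 < g k by have /andP[i0 i1] := g01 k; lra.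
have x01 k : 0 < x k < 1.
  rewrite powR_gt0//=; have : g k `^ tau^-1 < 1 `^ tau^-1.
    apply: gt0_ltr_powR; rewrite ?nnegrE ?invr_gt0// ?(ltW (g0 k))//.
    by have /andP[] := g01 k.
  by rewrite powR1.
have xg k : x k `^ tau = g k.
  by rewrite /x -powRrM mulVf ?gt_eqF// powRr1// ltW.
have x6 k : 1 < 6 * x k ^+ 2.
  have /andP[xk0 _] := x01 k.
  rewrite ltNge; apply/negP => h.
  have : (6 * x k ^+ 2) `^ tau <= 1 `^ tau.
    by apply: ge0_ler_powR; rewrite ?nnegrE// ?(ltW t0)// mulr_ge0// sqr_ge0.
  rewrite powR1 powRM ?sqr_ge0// powR_exprn ?(ltW xk0)// xg powR6_2theta.
  by apply/negP; rewrite -ltNge expr2; have /andP[h1 _] := g01 k; nra.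
have := ae_foralln (fun k => brownian_modulus (bm_gaussian hB) (bm_continuous hB) (x01 k) (x6 k)).
apply: filterS => w hw s Ds.
have s0 : 0 < s by have := D_gt1; lra.
(* [D < s] means that [4 ^ s] exceeds [2 Z]; the margin [y] is then shared between [5 ^ e] and
   [2 * g k], both kept below its square root. *)
have Zs : 1 < 4 `^ s / (2 * (5 `^ tau + 1)).
  rewrite ltr_pdivlMr ?mulr_gt0 ?powR5D1_gt0// mul1r.
  have : log_base 2 (5 `^ tau + 1) < 2 * s - 1 by move: Ds; rewrite /D; lra.
  rewrite log2_ltP ?powR5D1_gt0// powRB; last by apply/implyP => _; rewrite gt_eqF.
  rewrite powRr1// ltr_pdivlMr// mulrC (powRrM 2 2 s) (@powR_mulrn R 2 2)//.
  by rewrite (_ : 2 ^+ 2 = 4 :> R)// expr2; lra.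
set y := 4 `^ s / _ in Zs.
pose z := Num.sqrt y.
have z1 : 1 < z by rewrite -sqrtr1 ltr_sqrt//; lra.
have zy : z ^+ 2 = y by rewrite sqr_sqrtr//; lra.
have [e e0 he] := exists_powR_lt z1.
pose k := Num.truncn ((z - 1)^-1).
have hk : 2 * g k < z.
  have zk : (z - 1)^-1 < k.+1%:R by exact: truncnS_gt.
  have iz : k.+1%:R^-1 < z - 1.
    by rewrite -[ltRHS]invrK ltf_pV2 ?posrE ?invr_gt0 ?subr_gt0.
  by move: iz; rewrite /g; move: k.+1%:R^-1 => v; lra.
have [C C0 hC] := hw k.
have /andP[xk0 xk1] := x01 k.
(* The summand 1 is the variation of f inside a row; the division by [x k] pays for rounding [tau m]
   down to [lev m]. *)
apply: (@hausdorff_upper _ tau (X w) tau01 (1 + C / x k) (g k) e s) => //.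
- by rewrite addr_ge0// divr_ge0// ltW.
- by rewrite powR6_2theta; have /andP[h1 _] := g01 k; lra.
- move=> m t t' ht ht' ct ft.
  have -> : X w t - X w t' = (curve t - curve t') + (B t w - B t' w) by rewrite /X; ring.
  apply: le_trans (ler_normD _ _) _; rewrite mulrDl mul1r; apply: lerD.
    apply: le_trans (frow_close ht ht' ft) _.
    by rewrite lerXn2r ?nnegrE ?(ltW (g0 k))//; have /andP[h1 _] := g01 k; lra.
  apply: le_trans (hC _ _ _ ht ht' ct) _; rewrite -[leRHS]mulrA ler_wpM2l//.
  rewrite ler_pdivlMl// -exprS -(xg k) -powR_exprn ?(ltW xk0)//.
  rewrite -[leLHS](powR_mulrn _ (ltW xk0)) -(powR_mulrn m (ltW xk0)) -powRrM; apply: ger_powR; first by rewrite xk0 ltW.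
  by rewrite mulrC ltW// truncnS_gt.
rewrite powR6_2theta invrK.
rewrite -powR_inv1// -powRrM mulN1r powRN ltr_pdivrMr ?powR_gt0// mul1r.
have Zp := powR5D1_gt0 tau.
have -> : 4 `^ s = y * (2 * (5 `^ tau + 1)) by rewrite /y divfK// gt_eqF// mulr_gt0.
rewrite -zy.
have -> : 5 `^ e * (5 `^ tau + 1) * (g k * 4) = (5 `^ e * (2 * g k)) * (2 * (5 `^ tau + 1)) by ring.
rewrite ltr_pM2r ?mulr_gt0// expr2.
by apply: ltr_pM; rewrite ?powR_ge0// mulr_ge0// ltW.
Qed.

Lemma path_dim_lower :
  {ae P, forall w, forall s, 0 < s < D -> hausdorff_measure s (graph (X w)) <> 0%E}.
Proof.
(* [gam k] starts at 1 and increases to [D], so one null set serves all [s < D]; [gam k >= 1] is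
   what gives [H_lt_q]. *)
pose gam k : R := D - (D - 1) / k.+1%:R.
have ik k : 0 < (k.+1%:R : R)^-1 <= 1 by rewrite invr_gt0 ltr0n invf_le1 ?ler1n.
have D1 := D_gt1.
have g1 k : 1 <= gam k < D.
  have := ik k; rewrite /gam; move: k.+1%:R^-1 => v /andP[i0 i1].
  by apply/andP; split; nra.
(* With [h = 2 ^ (2 gam - 1)], the condition [gam_lt] reads [h ^ L < q], and [h < Z] is
   [gam k < D]. *)
have blk k : exists L b, [/\ (0 < L)%N, (0 < types L b)%N &
    (2 `^ (2 * gam k - 1)) ^+ L < (types L b)%:R * (5 `^ tau) ^+ b].
  apply: block_choice; rewrite powR_gt0//= -log2_gtP ?powR5D1_gt0//.
  by have /andP[_] := g1 k; rewrite /D; lra.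
have one k : {ae P, forall w, {within `[0, 1], continuous (X w)} ->
    forall s, 0 < s <= gam k -> hausdorff_measure s (graph (X w)) <> 0%E}.
  have [L [b [L0 tb hq]]] := blk k.
  have /andP[gk1 gkD] := g1 k.
  have H1 : 1 < (2 : R) ^+ L by rewrite exprn_egt1// ?ltr1n// -lt0n.
  have Hq : 2 ^+ L < (types L b)%:R * (5 `^ tau) ^+ b.
    apply: le_lt_trans hq; rewrite lerXn2r ?nnegrE ?powR_ge0//.
    by rewrite -[leLHS](@powRr1 R 2)//; apply: ler_powR; [rewrite ler1n|lra].
  have gq : ((2 ^+ L) ^+ 2) `^ gam k < 2 ^+ L * ((types L b)%:R * (5 `^ tau) ^+ b).
    have -> : ((2 ^+ L) ^+ 2) `^ gam k = 2 ^+ L * (2 `^ (2 * gam k - 1)) ^+ L.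
      have e : 2 `^ (1 + (2 * gam k - 1)) = 2 `^ 1 * 2 `^ (2 * gam k - 1) :> R.
        by rewrite powRD//; apply/implyP => _; rewrite gt_eqF.
      rewrite powRr1// in e; rewrite -exprMn -e addrC subrK.
      by rewrite exprAC (powR_exprn _ L)// (powRrM 2 2 (gam k)) (@powR_mulrn R 2 2).
    by rewrite ltr_pM2l// exprn_gt0.
  have [C hC] := path_energy_bounded (bm_gaussian hB) L0 tb Hq gq.
  have := ae_frequently_bounded (measurable_path_energy B L b (gam k))
     (path_energy_ge0 B L b (gam k)) hC.
  apply: filterS => w [C' hC'] cX s sg.
  apply: (@hausdorff_energy _ (X w) (gam k) ((2 ^+ L) ^+ 2)^-1 C' s
    (fun N => 6 ^ (N * L))%N (fun N => N./2) (node L) (weight L b)) => //.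
  - by rewrite invr_gt0 !exprn_gt0//= invf_lt1 ?exprn_gt0// exprn_egt1.
  - by move=> N i; exact: node01.
  - by move=> N i; exact: weight_ge0.
  - by move=> N; exact: sum_weight.
  move=> K; have [N NK hN] := hC' K.*2; exists N => //.
  by rewrite geq_half_double.
have := ae_foralln one; have := bm_continuous hB; apply: filterS2 => w cB hw s /andP[s0 sD].
have cX : {within `[0, 1], continuous (X w)}.
  have cB1 : {within `[0, 1], continuous (fun t => B t w)}.
    apply: continuous_subspaceW cB => t /=; rewrite !in_itv /= andbT.
    by case/andP.
  by move=> t; exact: (cvgD (cB1 t) (@curve_continuous R t)).
pose k := Num.truncn ((D - 1) / (D - s)).
apply: (hw k cX s); rewrite s0 /= /gam.
have : (D - 1) / (D - s) < k.+1%:R by exact: truncnS_gt.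
rewrite ltr_pdivrMr ?subr_gt0// => h.
have : (D - 1) / k.+1%:R <= D - s by rewrite ler_pdivrMr ?ltr0n// mulrC ltW.
by move: (_ / k.+1%:R) => v; lra.
Qed.

Lemma path_dim : {ae P, forall w, hausdorff_dim (graph (X w)) = D%:E}.
Proof.
have := path_dim_upper; have := path_dim_lower; apply: filterS2 => w lo up.
by apply: hausdorff_dim_eq => //; have := D_gt1; lra.
Qed.

End BrownianDimension.

(** * Minkowski dimension *)

Section Minkowski.
Context {R : realType}.

(** Below a column of level [n] every one of the [2 ^ (m - n)] rows occurs, since by [count_row] it
    contains a power of 5 of columns, hence at least one. *)
Lemma cell_point n m i k : (n <= m)%N -> (i < 6 ^ n)%N -> (k < 2 ^ (m - n))%N ->
  exists t : R, [/\ 0 <= t <= 1, colof n t = i &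
    frow m t = (rowof LA n i * 2 ^ (m - n) + k)%N].
Proof.
move=> nm i6 k2.
have [c c6 cE] : exists2 c, (c < 6 ^ (m - n))%N & rowof (lab LA n i) (m - n) c = k.
  apply: contrapT => H; have := @count_row R (lab LA n i) (m - n) k k2.
  rewrite big1.
    by move/esym/eqP; rewrite pnatr_eq0 expn_eq0.
  move=> c _; case: eqP => // cE; exfalso; apply: H; exists c => //; exact: ltn_ord.
pose j := (i * 6 ^ (m - n) + c)%N.
have jm : (j < 6 ^ m)%N.
  have -> : (6 ^ m = 6 ^ n * 6 ^ (m - n))%N by rewrite -expnD subnKC.
  by apply: (@leq_trans (i.+1 * 6 ^ (m - n))%N); [rewrite mulSn; lia|rewrite leq_mul2r i6 orbT].
have t01 : 0 <= (j%:R / 6 ^+ m : R) <= 1.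
  rewrite divr_ge0//= ler_pdivrMr ?exprn_gt0// mul1r -natrX ler_nat.
  exact: ltnW.
have jd : (j %/ 6 ^ (m - n) = i)%N by rewrite /j divnMDl ?expn_gt0// (divn_small c6) addn0.
exists (j%:R / 6 ^+ m); split=> //.
  have /andP[t0 _] := t01.
  by rewrite -(col_div n (m - n) t0) subnKC// col_frac.
rewrite /frow col_frac// -[in rowof LA m j](subnKC nm) row_cat jd.
by rewrite /j modnMDl (modn_small c6) cE.
Qed.

Lemma covering_upper n m (delta : R) : (n <= m)%N ->
  (6 ^+ n)^-1 + (2 ^+ m)^-1 <= delta ->
  (covering_number (graph (@curve R)) delta <= (6 ^ n * 2 ^ (m - n))%:R%:E)%E.
Proof.
move=> nm hd.
pose J := ('I_(6 ^ n) * 'I_(2 ^ (m - n)))%type.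
pose E (c : J) := [set p : R * R | exists t : R, [/\ 0 <= t <= 1, colof n t = c.1,
  frow m t = (rowof LA n c.1 * 2 ^ (m - n) + c.2)%N & p = (t, curve t)]].
apply: ereal_inf_lbound; exists #|{: J}|; last first.
  by rewrite card_prod !card_ord.
exists (fun e => E (enum_val e)); split.
  move=> _ [t /= + <-]; rewrite in_itv01 => t01; have /andP[t0 _] := t01.
  have k2 : (frow m t %% 2 ^ (m - n) < 2 ^ (m - n))%N by rewrite ltn_pmod// expn_gt0.
  exists (enum_rank ((Ordinal (col_lt n t), Ordinal k2) : J)) => //.
  rewrite enum_rankK; exists t; split=> //=.
  rewrite {1}(divn_eq (frow m t) (2 ^ (m - n))); congr (_ * _ + _)%N.
  by rewrite -{1}(subnKC nm) frow_div.
move=> e; apply: diam_le.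
  by apply: le_trans hd; rewrite addr_ge0.
move=> _ _ [t [t01 tc tr ->]] [t' [t01' tc' tr' ->]].
apply: le_trans (edist_le _ _) _; apply: le_trans hd; apply: lerD => /=.
  have p : 0 < (6 : R) ^+ n by rewrite exprn_gt0.
  have := col_itv n t01; have := col_itv n t01'; rewrite tc tc'.
  move: (nat_of_ord _) => i; rewrite -(@natr1 R i) => /andP[a1 a2] /andP[b1 b2].
  rewrite -[leRHS]mul1r ler_pdivlMr// -{1}(gtr0_norm p) -normrM mulrBl.
  by rewrite ler_norml; apply/andP; split; lra.
by rewrite -exprVn; apply: frow_close => //; rewrite tr tr'.
Qed.

(** One point is chosen per cell. Those in a common covering set fall into 3 columns and 5 rows
    around any one of them, so at most 15 cells share a set; [phi] is the injection. *)
Lemma covering_lower n m (delta : R) : (n <= m)%N ->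
  delta * 6 ^+ n <= 1 -> delta * 2 ^+ m <= 1 ->
  ((6 ^ n * 2 ^ (m - n))%:R%:E <= 15%:R%:E * covering_number (graph (@curve R)) delta)%E.
Proof.
move=> nm h6 h2; rewrite -lee_pdivrMl//.
apply: le_ereal_inf_tmp => _ [N [E [cov Ed]] <-].
rewrite -EFinM lee_fin ler_pdivrMl// -natrM ler_nat.
pose J := ('I_(6 ^ n) * 'I_(2 ^ (m - n)))%type.
have hpt (c : J) : exists t : R, [/\ 0 <= t <= 1, colof n t = c.1 &
    frow m t = (rowof LA n c.1 * 2 ^ (m - n) + c.2)%N].
  by apply: cell_point => //; exact: ltn_ord.
have [t tP] := choice hpt.
have he (c : J) : exists e : 'I_N, E e (t c, curve (t c)).
  have [t01 _ _] := tP c.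
  have [|e _ Ee] := cov (t c, curve (t c)); last by exists e.
  by exists (t c) => //; rewrite /= in_itv01.
have [e eP] := choice he.
have -> : (6 ^ n * 2 ^ (m - n) = \sum_(c : J) 1)%N.
  by rewrite sum1_card card_prod !card_ord.
rewrite (partition_big e xpredT)//=.
have -> : (15 * N = \sum_(k < N) 15)%N by rewrite sum_nat_const card_ord mulnC.
apply: leq_sum => k _; rewrite sum1_card.
case: (pickP (fun c => e c == k)) => [c0 /eqP ec0|none]; last first.
  by rewrite (eq_card0 none).
have p6 : 0 < (6 : R) ^+ n by rewrite exprn_gt0.
have p2 : 0 < (2 : R) ^+ m by rewrite exprn_gt0.
have close c : e c = k ->
  [/\ (colof n (t c) <= (colof n (t c0)).+1)%N, (colof n (t c0) <= (colof n (t c)).+1)%N,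
      (frow m (t c) <= (frow m (t c0)).+2)%N & (frow m (t c0) <= (frow m (t c)).+2)%N].
  move=> ec; have [t01 _ _] := tP c; have [t01' _ _] := tP c0.
  have [d1 d2] := edist_ge (t c, curve (t c)) (t c0, curve (t c0)).
  have ed : Defs.edist (t c, curve (t c)) (t c0, curve (t c0)) <= delta.
    have E1 := eP c; have E2 := eP c0; rewrite ec in E1; rewrite ec0 in E2.
    by rewrite -lee_fin; apply: le_trans (le_diam E1 E2) _; exact: Ed.
  have g1 : `|t c - t c0| * 6 ^+ n <= 1.
    by apply: le_trans h6; rewrite ler_wpM2r ?(ltW p6)// (le_trans d1 ed).
  have g2 : `|curve (t c) - curve (t c0)| * 2 ^+ m <= 1.
    by apply: le_trans h2; rewrite ler_wpM2r ?(ltW p2)// (le_trans d2 ed).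
  rewrite -{1}(gtr0_norm p6) -normrM ler_norml mulrBl in g1.
  rewrite -{1}(gtr0_norm p2) -normrM ler_norml mulrBl in g2.
  have /andP[l1 l2] := g1; have /andP[l3 l4] := g2.
  have /andP[s0 _] := t01; have /andP[s0' _] := t01'.
  have := curve_itv m s0; have := curve_itv m s0'.
  move=> /andP[q1 q2] /andP[q3 q4].
  split; [by apply: col_close => //; lra|by apply: col_close => //; lra| |];
    rewrite -(ler_nat R); move: q2 q4;
    by rewrite -!(@natr1 R (frow _ _).+1) -!(@natr1 R (frow _ _)); lra.
pose phi (c : J) : 'I_3 * 'I_5 :=
  (inord (colof n (t c) + 1 - colof n (t c0)), inord (frow m (t c) + 2 - frow m (t c0))).
have -> : (15 = #|{: 'I_3 * 'I_5}|)%N by rewrite card_prod !card_ord.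
apply: (leq_card_in phi).
move=> c c'; rewrite !unfold_in => /eqP/val_inj ec /eqP/val_inj ec'.
have [a1 a2 a3 a4] := close c ec; have [b1 b2 b3 b4] := close c' ec'.
move=> [/(congr1 val) /= + /(congr1 val) /=].
rewrite !inordK; [|lia..] => x1 x2.
have [_ c1 c2] := tP c; have [_ c1' c2'] := tP c'.
have i1 : c.1 = c'.1 by apply: val_inj => /=; rewrite -c1 -c1'; lia.
have f1 : frow m (t c) = frow m (t c') by lia.
have i2 : c.2 = c'.2.
  by apply: val_inj; apply/eqP; move/eqP: f1; rewrite c2 c2' i1 eqn_add2l.
by rewrite [c]surjective_pairing [c']surjective_pairing i1 i2.
Qed.

Lemma ln_cells n m : (n <= m)%N ->
  ln (6 ^ n * 2 ^ (m - n))%:R = n%:R * ln 3 + m%:R * ln 2 :> R.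
Proof.
move=> nm; rewrite natrM !natrX lnM ?posrE ?exprn_gt0// !lnXn//.
have -> : (6 : R) = 2 * 3 by lra.
rewrite lnM ?posrE// -(mulr_natl (ln 2 + ln 3)) -(mulr_natl (ln 2)) natrB//.
by ring.
Qed.

(** The logarithm of the number of cells is [n ln 3 + m ln 2], and [n ln 6] and [m ln 2] agree with
    [ln delta^-1] up to one step; the error is bounded uniformly in [delta]. *)
Lemma covering_ln (delta : R) : 0 < delta < 1 -> exists x : R,
  [/\ covering_number (graph (@curve R)) delta = x%:E, 0 < x &
   `|ln x - (1 + ln 3 / ln 6) * ln delta^-1| <= ln 15 + 2 * ln 6].
Proof.
move=> /andP[d0 d1].
have i0 : 0 < (6 : R)^-1 < 1 by apply/andP; split; lra.
have j0 : 0 < (2 : R)^-1 < 1 by apply/andP; split; lra.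
have d01 : 0 < delta <= 1 by rewrite d0 ltW.
have [n /andP[n1 n2]] := power_scale i0 d01.
have [m /andP[m1 m2]] := power_scale j0 d01.
rewrite !exprVn in n1 n2 m1 m2.
have p6 k : 0 < (6 : R) ^+ k by rewrite exprn_gt0.
have p2 k : 0 < (2 : R) ^+ k by rewrite exprn_gt0.
have nm : (n <= m)%N.
  rewrite leqNgt; apply/negP => mn; have := lt_le_trans m1 n2; apply/negP.
  rewrite -leNgt lef_pV2 ?posrE// (@le_trans _ _ (6 ^+ m.+1))//.
    by rewrite lerXn2r ?nnegrE// ler_nat.
  by rewrite ler_weXn2l// ler1n.
(* Two more levels make both sides of a cell at most [delta / 2], so that their sum bounds the
   diameter. *)
have up : (covering_number (graph (@curve R)) delta <=
    (6 ^ n.+2 * 2 ^ (m.+2 - n.+2))%:R%:E)%E.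
  apply: covering_upper => //.
  rewrite exprS invfM [in X in _ + X]exprS [in X in _ + X]invfM.
  by move: n1 m1; move: (_ ^+ n.+1)^-1 (_ ^+ m.+1)^-1 => x y; lra.
have lo : ((6 ^ n * 2 ^ (m - n))%:R%:E <=
    15%:R%:E * covering_number (graph (@curve R)) delta)%E.
  apply: covering_lower => //.
    by rewrite -ler_pdivlMr// mul1r.
  by rewrite -ler_pdivlMr// mul1r.
have Lup := ln_cells (nm : n.+2 <= m.+2)%N; have Llo := ln_cells nm.
have Nup : 0 < (6 ^ n.+2 * 2 ^ (m.+2 - n.+2))%:R :> R.
  by rewrite ltr0n muln_gt0 !expn_gt0.
have Nlo : 0 < (6 ^ n * 2 ^ (m - n))%:R :> R.
  by rewrite ltr0n muln_gt0 !expn_gt0.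
move: up lo Lup Llo Nup Nlo.
move: (_ * _)%:R (_ * _)%:R => V U.
case: covering_number => [x| |]; last 2 first.
- by rewrite leye_eq.
- by rewrite mulrNy gtr0_sg// mul1e.
rewrite -EFinM !lee_fin => xU Vx lU lV U0 V0.
have x0 : 0 < x by rewrite -(@pmulr_rgt0 R 15)//; exact: lt_le_trans Vx.
exists x; split=> //.
have h1 : ln x <= ln U by rewrite ler_ln ?posrE.
have h2 : ln V <= ln 15 + ln x by rewrite -lnM ?posrE// ler_ln ?posrE// mulr_gt0.
rewrite lU in h1; rewrite lV in h2.
have L6 : 0 < ln 6 :> R by rewrite ln_gt0// ltr1n.
have l3 : 0 < ln 3 :> R by rewrite ln_gt0// ltr1n.
have l6 : ln 6 = ln 2 + ln 3 :> R.
  by rewrite -lnM ?posrE//; congr ln; lra.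
have e1 : n%:R * ln 6 <= ln delta^-1.
  rewrite mulr_natl -lnXn// ler_ln ?posrE ?invr_gt0//.
  by rewrite -[leLHS]invrK lef_pV2 ?posrE ?invr_gt0.
have e2 : ln delta^-1 <= (n.+1)%:R * ln 6.
  rewrite mulr_natl -lnXn// ler_ln ?posrE ?invr_gt0//.
  by rewrite -[leRHS]invrK lef_pV2 ?posrE ?invr_gt0// ltW.
have e3 : m%:R * ln 2 <= ln delta^-1.
  rewrite mulr_natl -lnXn// ler_ln ?posrE ?invr_gt0//.
  by rewrite -[leLHS]invrK lef_pV2 ?posrE ?invr_gt0.
have e4 : ln delta^-1 <= (m.+1)%:R * ln 2.
  rewrite mulr_natl -lnXn// ler_ln ?posrE ?invr_gt0//.
  by rewrite -[leRHS]invrK lef_pV2 ?posrE ?invr_gt0// ltW.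
have f1 : n%:R * ln 3 <= ln delta^-1 * (ln 3 / ln 6).
  by rewrite mulrA ler_pdivlMr// mulrAC ler_wpM2r// ltW.
have f2 : ln delta^-1 * (ln 3 / ln 6) <= n.+1%:R * ln 3.
  by rewrite mulrA ler_pdivrMr// [leRHS]mulrAC ler_wpM2r// ltW.
rewrite -(@natr1 R n.+1) in h1; rewrite -(@natr1 R n) in h1 f2.
rewrite -(@natr1 R m.+1) in h1; rewrite -(@natr1 R m) in h1 e4.
have l15 : 0 <= ln 15 :> R by rewrite ln_ge0// ler1n.
have -> : (1 + ln 3 / ln 6) * ln delta^-1 =
    ln delta^-1 + ln delta^-1 * (ln 3 / ln 6) by rewrite mulrDl mul1r [_ / _ * _]mulrC.
rewrite ler_norml; move: (ln delta^-1) h1 h2 e1 e2 e3 e4 f1 f2 => L.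
rewrite l6 in L6 *.
move: (L * _) => Y h1 h2 e1 e2 e3 e4 f1 f2.
by apply/andP; split; lra.
Qed.

Lemma curve_minkowski_dim : has_minkowski_dim (graph (@curve R)) (1 + ln 3 / ln 6).
Proof.
set c : R := ln 15 + 2 * ln 6.
have c0 : 0 < c by rewrite addr_gt0 ?mulr_gt0// ln_gt0// ltr1n.
pose g delta : R := ln (fine (covering_number (graph (@curve R)) delta)) / ln delta^-1.
have gE delta : 0 < delta < 1 ->
    (lne (covering_number (graph (@curve R)) delta) * ((ln delta^-1)^-1)%:E)%E = (g delta)%:E.
  by move=> /covering_ln[x [xE x0 _]]; rewrite /g xE lne_EFin.
apply/cvg_EFin.
  near=> delta; rewrite gE//; apply/andP; split; near: delta;
    [exact: nbhs_right_gt|exact: nbhs_right_lt].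
apply/cvgrPdist_le => e e0.
have r0 : 0 < expR (- (c / e)) by exact: expR_gt0.
near=> delta.
have d01 : 0 < delta < 1.
  by apply/andP; split; near: delta; [exact: nbhs_right_gt|exact: nbhs_right_lt].
have /andP[d0 d1] := d01.
have de : delta < expR (- (c / e)) by near: delta; exact: nbhs_right_lt.
have [x [xE x0 hx]] := covering_ln d01.
have L0 : c / e < ln delta^-1.
  by rewrite lnV ?posrE// ltrNr -[ltRHS]expRK ltr_ln ?posrE.
have Lp : 0 < ln delta^-1 by apply: lt_trans L0; rewrite divr_gt0.
rewrite /= gE//= /g xE /= -[X in X - _](mulfK (lt0r_neq0 Lp)) -mulrBl normrM normfV (gtr0_norm Lp).
rewrite ler_pdivrMr// distrC (le_trans hx)//.
by rewrite -/c -ler_pdivrMl// mulrC ltW.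
Unshelve. all: by end_near.
Qed.

End Minkowski.

Theorem corollary1p6 (R : realType) (d : measure_display)
    (T : measurableType d) (P : probability T R) (B : R -> {RV P >-> R})
    (hB : standard_brownian_motion B) :
  exists f : R -> R,
    (forall t : R, t \in `[0, 1] -> f t \in `[0, 1]) /\
    graph f = K /\
    holder (theta R) f /\
    has_minkowski_dim (graph f) (1 + ln 3 / ln 6) /\
    {ae P, forall w, hausdorff_dim (graph (fun t => B t w + f t)) =
      ((log_base 2 (5 `^ (2 * theta R) + 1) + 1) / 2)%:E} /\
    (Order.max (hausdorff_dim (graph f)) (3 / 2)%:E <
      ((log_base 2 (5 `^ (2 * theta R) + 1) + 1) / 2)%:E)%E /\
    Order.max (hausdorff_dim (graph f)) (3 / 2)%:E =
      (log_base 2 (5 `^ theta R + 1))%:E.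
Proof.
exists curve; split; first by move=> t; rewrite !in_itv01; exact: curve01.
split; first exact: graph_curve.
split; first exact: curve_holder.
split; first exact: curve_minkowski_dim.
split; first exact: (path_dim hB).
have -> : Order.max (hausdorff_dim (graph curve)) (3 / 2)%:E =
    (log_base 2 (5 `^ theta R + 1))%:E :> \bar R.
  by rewrite curve_dim; apply/max_idPl; rewrite lee_fin ltW// curve_dim_gt.
by split=> //; rewrite lte_fin curve_dim_lt.
Qed.
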